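(* Let $k$ be a field, $Q=k[X]$ a polynomial ring in finitely many variables, $H\subseteq J\unlhd Q$ prime ideals, $A=Q/H$, $L=J\cdot A$, $\mathfrak a=L\cdot A_L$ the maximal ideal of the localization $A_L$, and $K=A_L/\mathfrak a$. Let $J=\langle f_1,\dots,f_s\rangle$ be a fixed system of generators and let $\mathfrak I_{\mathrm{in}}\unlhd K[Y_1,\dots,Y_s]$ be the homogeneous ideal defined in the context. Then the following are equivalent: (i) $A_L$ is a regular local ring, i.e. $\dim_K(\mathfrak a/\mathfrak a^2)=\dim A_L$; (ii) $\mathrm{Gr}_{\mathfrak a}(A_L)=\bigoplus_{n\ge0}\mathfrak a^n/\mathfrak a^{n+1}$ is isomorphic to a polynomial ring (over $K$, in finitely many variables); (iii) $\mathfrak I_{\mathrm{in}}$ is generated by linear elements (homogeneous elements of degree $1$ in $Y_1,\dots,Y_s$).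
   Context: Let $U\subseteq X$ be a maximal independent set of variables with respect to $J$ (i.e. $J\cap k[U]=0$ and $U$ is maximal with this property), and $V=X\setminus U$, so that $J\cdot k(U)[V]$ is a maximal ideal of $k(U)[V]$. Put $Q^0=k(U)[V]$, $H^0=H\cdot Q^0$, $J^0=J\cdot Q^0$; the residue field $K=A_L/\mathfrak a$ is identified with $Q^0/J^0$. Let $Y=(Y_1,\dots,Y_s)$ be new variables and $$\mathfrak I=\langle f_1-Y_1,\dots,f_s-Y_s\rangle+H^0\cdot Q^0[Y]\unlhd Q^0[Y].$$ For $0\neq g\in Q^0[Y]$ let $\mathrm{in}_w(g)$ be the sum of the terms of $g$ of lowest degree in $Y$ (the variables in $V$ having weight $0$), and let $g_{\mathrm{in}}\in K[Y]$ be the image of $\mathrm{in}_w(g)$ under coefficientwise reduction $Q^0[Y]\to(Q^0/J^0)[Y]=K[Y]$; put $0_{\mathrm{in}}=0$. Then $\mathfrak I_{\mathrm{in}}\unlhd K[Y]$ is the ideal generated by all $g_{\mathrm{in}}$ with $g\in\mathfrak I$. It is the kernel of the surjective graded $K$-algebra homomorphism $\lambda:K[Y]\to\mathrm{Gr}_{\mathfrak a}(A_L)$ sending $Y_j$ to the class of $f_j$ in $\mathfrak a/\mathfrak a^2$. *)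

(* Defs.v *)
From HB Require Import structures.
From mathcomp Require Import all_boot all_algebra.
From mathcomp Require Import generic_quotient ring_quotient fraction.
From mathcomp Require Import boolp.
From mathcomp Require Import mpoly.

Set Implicit Arguments.
Unset Strict Implicit.
Unset Printing Implicit Defensive.

Import GRing.Theory.
Local Open Scope ring_scope.
Local Open Scope quotient_scope.

Section IdealOperations.
Variable R : comNzRingType.
Implicit Types (S : R -> Prop) (I J : {pred R}).

(* [ideal_gen S] may be the unit ideal, unlike an [idealr], which is proper. *)
Definition ideal_gen S : {pred R} := fun x =>
  `[< exists m (c g : 'I_m -> R),
        (forall i, S (g i)) /\ x = \sum_(i < m) c i * g i >].

Definition ideal_add I J : {pred R} := fun x =>
  `[< exists y z, [/\ y \in I, z \in J & x = y + z] >].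

Definition ideal_exp I (e : nat) : {pred R} :=
  ideal_gen (fun x => exists g : 'I_e -> R,
    (forall i, g i \in I) /\ x = \prod_(i < e) g i).

Lemma ideal_genP S x : reflect
  (exists m (c g : 'I_m -> R),
     (forall i, S (g i)) /\ x = \sum_(i < m) c i * g i)
  (x \in ideal_gen S).
Proof. exact: asboolP. Qed.

Lemma ideal_gen0 S : 0 \in ideal_gen S.
Proof.
apply/ideal_genP; exists 0%N, (fun=> 0), (fun=> 0).
by split=> [[]//|]; rewrite big_ord0.
Qed.

Lemma mem_ideal_gen S x : S x -> x \in ideal_gen S.
Proof.
move=> Sx; apply/ideal_genP; exists 1%N, (fun=> 1), (fun=> x).
by split=> //; rewrite big_ord1 mul1r.
Qed.

Lemma ideal_genD S : {in ideal_gen S &, forall x y, x + y \in ideal_gen S}.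
Proof.
move=> _ _ /ideal_genP[m [c [g [Sg ->]]]] /ideal_genP[m' [c' [g' [Sg' ->]]]].
apply/ideal_genP; exists (m + m')%N.
exists (fun i => match split i with inl j => c j | inr j => c' j end).
exists (fun i => match split i with inl j => g j | inr j => g' j end).
split=> [i|]; first by case: split.
rewrite big_split_ord /=; congr (_ + _); apply: eq_bigr => i _.
  by rewrite (unsplitK (inl i : 'I_m + 'I_m')).
by rewrite (unsplitK (inr i : 'I_m + 'I_m')).
Qed.

Lemma ideal_genMl S a : {in ideal_gen S, forall x, a * x \in ideal_gen S}.
Proof.
move=> _ /ideal_genP[m [c [g [Sg ->]]]]; apply/ideal_genP.
exists m, (fun i => a * c i), g; split=> //.
by rewrite mulr_sumr; apply: eq_bigr => i _; rewrite mulrA.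
Qed.

Lemma ideal_gen_zmod_closed S : zmod_closed (ideal_gen S).
Proof.
split=> [|x y Sx Sy]; first exact: ideal_gen0.
by rewrite -mulN1r ideal_genD ?ideal_genMl.
Qed.

HB.instance Definition _ S :=
  GRing.isZmodClosed.Build R (ideal_gen S) (ideal_gen_zmod_closed S).
HB.instance Definition _ I e := GRing.ZmodClosed.copy (ideal_exp I e)
  (ideal_gen (fun x => exists g : 'I_e -> R,
    (forall i, g i \in I) /\ x = \prod_(i < e) g i)).

Lemma ideal_gen_min S (I : zmodClosed R) :
    (forall a, {in I, forall x, a * x \in I}) ->
  (forall x, S x -> x \in I) -> {subset ideal_gen S <= I}.
Proof.
move=> IM SI _ /ideal_genP[m [c [g [Sg ->]]]].
by apply: rpred_sum => i _; apply/IM/SI.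
Qed.

Lemma ideal_expM I d e :
  {in ideal_exp I d & ideal_exp I e,
    forall x y, x * y \in ideal_exp I (d + e)}.
Proof.
move=> _ _ /ideal_genP[m [c [g [Ig ->]]]] /ideal_genP[m' [c' [g' [Ig' ->]]]].
rewrite mulr_suml rpred_sum // => i _; rewrite mulr_sumr rpred_sum // => j _.
rewrite mulrACA ideal_genMl // mem_ideal_gen //.
have [u [uI ->]] := Ig i; have [v [vI ->]] := Ig' j.
exists (fun t => match split t with inl p => u p | inr p => v p end).
split=> [t|]; first by case: split.
rewrite big_split_ord /=; congr (_ * _); apply: eq_bigr => t _.
  by rewrite (unsplitK (inl t : 'I_d + 'I_e)).
by rewrite (unsplitK (inr t : 'I_d + 'I_e)).
Qed.

Lemma ideal_exp0 I x : x \in ideal_exp I 0.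
Proof.
rewrite -[x]mulr1 ideal_genMl // mem_ideal_gen //.
by exists (fun=> 1); split=> [[]//|]; rewrite big_ord0.
Qed.

Lemma ideal_exp1 I : {subset I <= ideal_exp I 1}.
Proof.
move=> x Ix; apply: mem_ideal_gen.
by exists (fun=> x); split=> //; rewrite big_ord1.
Qed.

Lemma ideal_exp_sub (I : idealr R) e : {subset ideal_exp I e.+1 <= I}.
Proof.
apply: ideal_gen_min => [a x|_ [g [Ig ->]]]; first exact: idealMr.
by rewrite big_ord_recl mulrC idealMr.
Qed.

End IdealOperations.

Definition ideal_ext (R S : comNzRingType) (phi : R -> S) (I : {pred R}) :
  {pred S} := ideal_gen (fun y => exists2 x, x \in I & y = phi x).

HB.instance Definition _ (R S : comNzRingType) (phi : R -> S) (I : {pred R}) :=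
  GRing.ZmodClosed.copy (ideal_ext phi I)
    (ideal_gen (fun y => exists2 x, x \in I & y = phi x)).

(* Maximality is recorded as invertibility modulo S of every x outside S. *)
HB.mixin Record isMaximalIdealr (R : nzRingType) (S : R -> bool) := {
  maximal_idealr_subproof :
    forall x : R, x \notin S -> exists y, y * x - 1 \in S
}.

#[short(type="maximal_idealr")]
HB.structure Definition MaximalIdealr (R : nzRingType) :=
  {S of PrimeIdealr R S & isMaximalIdealr R S}.

Section QuotientRings.
Variables (R : comNzRingType) (I : idealr R).
Local Notation RI := {ideal_quot I}.

Definition qproj (x : R) : RI := \pi_RI x.

Lemma qproj_is_zmod_morphism : zmod_morphism qproj.
Proof. exact: (rmorphB \pi_RI). Qed.

Lemma qproj_is_monoid_morphism : monoid_morphism qproj.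
Proof. by split; [exact: (rmorph1 \pi_RI) | exact: (rmorphM \pi_RI)]. Qed.

HB.instance Definition _ :=
  GRing.isZmodMorphism.Build R RI qproj qproj_is_zmod_morphism.
HB.instance Definition _ :=
  GRing.isMonoidMorphism.Build R RI qproj qproj_is_monoid_morphism.

Lemma qproj_eq0 x : (qproj x == 0) = (x \in I).
Proof. by rewrite -(rmorph0 qproj) /qproj -Quotient.idealrBE subr0. Qed.

Lemma qprojP (y : RI) : exists x, y = qproj x.
Proof. by exists (repr y); rewrite /qproj reprK. Qed.

Lemma qproj_repr (y : RI) : qproj (repr y) = y.
Proof. exact: reprK. Qed.

Definition iq_unit : pred RI := fun x => `[< exists y, y * x = 1 >].
Definition iq_inv (x : RI) : RI :=
  if pselect (exists y, y * x = 1) is left ex then projT1 (cid ex) else x.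

Lemma iq_mulVr : {in iq_unit, left_inverse 1 iq_inv *%R}.
Proof.
by move=> x /asboolP ux; rewrite /iq_inv; case: pselect => // ?; case: cid.
Qed.

Lemma iq_unitPl (x y : RI) : y * x = 1 -> iq_unit x.
Proof. by move=> yx; apply/asboolP; exists y. Qed.

Lemma iq_inv_out : {in [predC iq_unit], iq_inv =1 id}.
Proof.
move=> x /negP nux; rewrite /iq_inv; case: pselect => // ux.
by case: nux; apply/asboolP.
Qed.

HB.instance Definition _ :=
  GRing.ComNzRing_hasMulInverse.Build RI iq_mulVr iq_unitPl iq_inv_out.

End QuotientRings.

HB.instance Definition _ (R : comNzRingType) (I : prime_idealr R) :=
  GRing.ComUnitRing_isIntegral.Build {ideal_quot I}
    (@Quotient.rquot_IdomainAxiom R I).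

Lemma iq_fieldP (R : comNzRingType) (I : maximal_idealr R) :
  GRing.field_axiom {ideal_quot I}.
Proof.
move=> y; have [x ->] := qprojP y.
rewrite qproj_eq0 => /maximal_idealr_subproof[z].
rewrite -qproj_eq0 rmorphB rmorph1 rmorphM subr_eq0 => /eqP zx.
by apply/asboolP; exists (qproj I z).
Qed.

HB.instance Definition _ (R : comNzRingType) (I : maximal_idealr R) :=
  GRing.UnitRing_isField.Build {ideal_quot I} (@iq_fieldP R I).

Definition prime_chain (R : comNzRingType) d (P : 'I_d.+1 -> prime_idealr R) :=
  forall i j : 'I_d.+1, (i < j)%N ->
    {subset P i <= P j} /\ ~ {subset P j <= P i}.

Definition has_krull_dim (R : comNzRingType) (d : nat) : Prop :=
  (exists P : 'I_d.+1 -> prime_idealr R, prime_chain P) /\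
  (forall e (P : 'I_e.+1 -> prime_idealr R), prime_chain P -> (e <= d)%N).

Definition has_dim (F : fieldType) (V : lmodType F) (d : nat) : Prop :=
  exists v2r : V -> 'rV[F]_d, linear v2r /\ bijective v2r.

Section IdealElt.
Variables (R : comNzRingType) (I : idealr R).

Record ideal_elt := IdealElt { ideal_val : R; ideal_valP : ideal_val \in I }.

HB.instance Definition _ := [isSub for ideal_val].
HB.instance Definition _ := [Choice of ideal_elt by <:].
HB.instance Definition _ := [SubChoice_isSubZmodule of ideal_elt by <:].

Definition ideal_sqr : {pred ideal_elt} :=
  fun x => ideal_val x \in ideal_exp I 2.

Lemma ideal_sqr_zmod_closed : zmod_closed ideal_sqr.
Proof.
by split=> [|x y xI yI]; rewrite /in_mem /= /ideal_sqr /= ?rpred0 ?rpredB.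
Qed.

HB.instance Definition _ :=
  GRing.isZmodClosed.Build ideal_elt ideal_sqr ideal_sqr_zmod_closed.

Definition ideal_scale (a : R) (x : ideal_elt) : ideal_elt :=
  IdealElt (idealMr a (ideal_valP x)).

End IdealElt.

Section Cotangent.
Variables (R : comNzRingType) (m : maximal_idealr R).
Local Notation K := {ideal_quot m}.

Definition cotangent := Quotient.quot (@ideal_sqr R m).

HB.instance Definition _ := GRing.Zmodule.on cotangent.

Definition cot_proj (x : ideal_elt m) : cotangent := \pi_cotangent x.

Lemma cot_proj_is_zmod_morphism : zmod_morphism cot_proj.
Proof. exact: (raddfB \pi_cotangent). Qed.

HB.instance Definition _ := GRing.isZmodMorphism.Build (ideal_elt m) cotangent
  cot_proj cot_proj_is_zmod_morphism.

Lemma cot_proj_eq0 x : (cot_proj x == 0) = (ideal_val x \in ideal_exp m 2).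
Proof. by rewrite -(raddf0 cot_proj) /cot_proj -Quotient.idealrBE subr0. Qed.

Lemma cot_projP (v : cotangent) : exists x, v = cot_proj x.
Proof. by exists (repr v); rewrite /cot_proj reprK. Qed.

Definition cot_scale (c : K) (v : cotangent) : cotangent :=
  cot_proj (ideal_scale (repr c) (repr v)).

Lemma cot_scaleE a x :
  cot_scale (qproj m a) (cot_proj x) = cot_proj (ideal_scale a x).
Proof.
rewrite /cot_scale; set r := repr _; set y := repr _.
have rK : r - a \in m by rewrite -qproj_eq0 rmorphB /= qproj_repr subrr.
have yK : ideal_val (y - x) \in ideal_exp m 2.
  by rewrite -cot_proj_eq0 raddfB /= /cot_proj reprK subrr.
apply/eqP; rewrite -subr_eq0 -raddfB cot_proj_eq0 /=.
have -> : r * ideal_val y - a * ideal_val x = (r - a) * ideal_val y + a * ideal_val (y - x).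
  by rewrite /= mulrBl mulrBr addrA subrK.
by apply: rpredD; [apply: (@ideal_expM R m 1 1); apply: ideal_exp1 => //;
  exact: ideal_valP | exact: ideal_genMl].
Qed.

Lemma cot_scaleA a b v : cot_scale a (cot_scale b v) = cot_scale (a * b) v.
Proof.
have [a' ->] := qprojP a; have [b' ->] := qprojP b; have [x ->] := cot_projP v.
rewrite -rmorphM !cot_scaleE; congr cot_proj; apply: val_inj => /=.
by rewrite mulrA.
Qed.

Lemma cot_scale1 : left_id 1 cot_scale.
Proof.
move=> v; have [x ->] := cot_projP v; rewrite -(rmorph1 (qproj m)) cot_scaleE.
by congr cot_proj; apply: val_inj; rewrite /= mul1r.
Qed.

Lemma cot_scaleDr : right_distributive cot_scale +%R.
Proof.
move=> a u v; have [b ->] := qprojP a.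
have [x ->] := cot_projP u; have [y ->] := cot_projP v.
rewrite -raddfD !cot_scaleE -raddfD; congr cot_proj; apply: val_inj => /=.
by rewrite mulrDr.
Qed.

Lemma cot_scaleDl v : {morph cot_scale^~ v : a b / a + b}.
Proof.
move=> a b; have [x ->] := cot_projP v.
have [a' ->] := qprojP a; have [b' ->] := qprojP b.
rewrite -rmorphD !cot_scaleE -raddfD; congr cot_proj; apply: val_inj => /=.
by rewrite mulrDl.
Qed.

HB.instance Definition _ := GRing.Zmodule_isLmodule.Build K cotangent
  cot_scaleA cot_scale1 cot_scaleDr cot_scaleDl.

End Cotangent.

Definition is_regular_local (R : comNzRingType) (m : maximal_idealr R) : Prop :=
  exists d, has_dim (cotangent m) d /\ has_krull_dim R d.

Section AssociatedGraded.
Variables (R : comNzRingType) (m : maximal_idealr R).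
Local Notation K := {ideal_quot m}.

(* The direct sum of the m^i / m^(i+1) is built as the quotient of
   R[mt] = { p in R[t] | p_i in m^i for all i } by its ideal
   { p | p_i in m^(i+1) for all i }, both direct sums being taken degreewise. *)
Definition rees_pred : {pred {poly R}} :=
  fun p => `[< forall i, p`_i \in ideal_exp m i >].

Lemma rees_subring_closed : subring_closed rees_pred.
Proof.
split=> [|p q|p q].
- apply/asboolP=> i; rewrite coef1; case: i => [|i]; last exact: rpred0.
  exact: ideal_exp0.
- move=> /asboolP pP /asboolP qP; apply/asboolP=> i.
  by rewrite coefB rpredB.
move=> /asboolP pP /asboolP qP; apply/asboolP=> i.
rewrite coefM rpred_sum // => j _.
by have := ideal_expM (pP j) (qP (i - j)%N); rewrite subnKC ?leq_ord.
Qed.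

HB.instance Definition _ :=
  GRing.isSubringClosed.Build {poly R} rees_pred rees_subring_closed.

Record rees := Rees { rees_val : {poly R}; rees_valP : rees_val \in rees_pred }.

HB.instance Definition _ := [isSub for rees_val].
HB.instance Definition _ := [Choice of rees by <:].
HB.instance Definition _ := [SubChoice_isSubComNzRing of rees by <:].

Definition rees_shift : {pred rees} :=
  fun p => `[< forall i, (rees_val p)`_i \in ideal_exp m i.+1 >].

Lemma rees_shift_idealr_closed : idealr_closed rees_shift.
Proof.
split.
- by apply/asboolP=> i; rewrite coef0 rpred0.
- apply/asboolP=> /(_ 0%N); rewrite coef1 => /ideal_exp_sub.
  by rewrite idealr1.
move=> a u v /asboolP uP /asboolP vP; apply/asboolP=> i.
rewrite coefD rpredD // coefM rpred_sum // => j _.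
have /asboolP aP := rees_valP a.
by have := ideal_expM (aP j) (uP (i - j)%N); rewrite addnS subnKC ?leq_ord.
Qed.

HB.instance Definition _ :=
  isIdealr.Build rees rees_shift rees_shift_idealr_closed.

Definition gr := {ideal_quot rees_shift}.

HB.instance Definition _ := GRing.ComUnitRing.on gr.

Lemma rees_constP (a : R) : a%:P \in rees_pred.
Proof.
apply/asboolP=> i; rewrite coefC; case: i => [|i]; last exact: rpred0.
exact: ideal_exp0.
Qed.

Definition rees_const (a : R) : rees := Rees (rees_constP a).

Lemma rees_const_is_zmod_morphism : zmod_morphism rees_const.
Proof. by move=> a b; apply: val_inj; rewrite /= polyCB. Qed.

Lemma rees_const_is_monoid_morphism : monoid_morphism rees_const.
Proof. by split=> [|a b]; apply: val_inj; rewrite /= ?polyCM. Qed.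

HB.instance Definition _ :=
  GRing.isZmodMorphism.Build R rees rees_const rees_const_is_zmod_morphism.
HB.instance Definition _ :=
  GRing.isMonoidMorphism.Build R rees rees_const rees_const_is_monoid_morphism.

Definition gr_const (c : K) : gr := qproj rees_shift (rees_const (repr c)).

Lemma gr_constE a : gr_const (qproj m a) = qproj rees_shift (rees_const a).
Proof.
apply/eqP; rewrite -subr_eq0 -!rmorphB qproj_eq0; apply/asboolP=> i /=.
rewrite coefC; case: i => [|i]; last exact: rpred0.
by rewrite ideal_exp1 // -qproj_eq0 rmorphB /= qproj_repr subrr.
Qed.

Lemma gr_const_is_zmod_morphism : zmod_morphism gr_const.
Proof.
move=> a b; have [x ->] := qprojP a; have [y ->] := qprojP b.
by rewrite -rmorphB !gr_constE -!rmorphB.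
Qed.

Lemma gr_const_is_monoid_morphism : monoid_morphism gr_const.
Proof.
split=> [|a b]; first by rewrite -(rmorph1 (qproj m)) gr_constE !rmorph1.
have [x ->] := qprojP a; have [y ->] := qprojP b.
by rewrite -rmorphM !gr_constE -!rmorphM.
Qed.

HB.instance Definition _ :=
  GRing.isZmodMorphism.Build K gr gr_const gr_const_is_zmod_morphism.
HB.instance Definition _ :=
  GRing.isMonoidMorphism.Build K gr gr_const gr_const_is_monoid_morphism.

Definition gr_scale (c : K) (x : gr) : gr := gr_const c * x.

Lemma gr_scaleA a b v : gr_scale a (gr_scale b v) = gr_scale (a * b) v.
Proof. by rewrite /gr_scale rmorphM mulrA. Qed.

Lemma gr_scale1 : left_id 1 gr_scale.
Proof. by move=> v; rewrite /gr_scale rmorph1 mul1r. Qed.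

Lemma gr_scaleDr : right_distributive gr_scale +%R.
Proof. by move=> a u v; rewrite /gr_scale mulrDr. Qed.

Lemma gr_scaleDl v : {morph gr_scale^~ v : a b / a + b}.
Proof. by move=> a b; rewrite /gr_scale rmorphD mulrDl. Qed.

HB.instance Definition _ := GRing.Zmodule_isLmodule.Build K gr
  gr_scaleA gr_scale1 gr_scaleDr gr_scaleDl.

Lemma gr_scaleAl (c : K) (x y : gr) : c *: (x * y) = c *: x * y.
Proof. by rewrite /GRing.scale /= /gr_scale mulrA. Qed.

HB.instance Definition _ := GRing.Lmodule_isLalgebra.Build K gr gr_scaleAl.
HB.instance Definition _ := GRing.Lalgebra_isComAlgebra.Build K gr.

End AssociatedGraded.

Definition is_polynomial_ring (F : fieldType) (S : comAlgType F) : Prop :=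
  exists d (phi : {lrmorphism {mpoly F[d]} -> S}), bijective phi.

Section Localization.
Variables (A : idomainType) (L : prime_idealr A).
Local Notation "x %:F" := (@FracField.tofrac A x) (at level 1).

Definition loc_pred : {pred {fraction A}} :=
  fun x => `[< exists a b, b \notin L /\ x = a%:F / b%:F >].

Lemma notin_prime_neq0 b : b \notin L -> b%:F != 0.
Proof. by apply: contraNneq => /eqP; rewrite tofrac_eq0 => /eqP->; exact: rpred0. Qed.

Lemma loc_subring_closed : subring_closed loc_pred.
Proof.
split.
- apply/asboolP; exists 1, 1; rewrite idealr1; split=> //.
  by rewrite rmorph1 divr1.
- move=> _ _ /asboolP[a [b [bL ->]]] /asboolP[c [d [dL ->]]]; apply/asboolP.
  exists (a * d - c * b), (b * d); rewrite prime_idealrM negb_or bL dL.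
  split=> //; rewrite -mulNr addf_div ?notin_prime_neq0 //.
  by rewrite rmorphB !rmorphM mulNr.
move=> _ _ /asboolP[a [b [bL ->]]] /asboolP[c [d [dL ->]]]; apply/asboolP.
exists (a * c), (b * d); rewrite prime_idealrM negb_or bL dL; split=> //.
by rewrite !rmorphM mulf_div.
Qed.

HB.instance Definition _ :=
  GRing.isSubringClosed.Build {fraction A} loc_pred loc_subring_closed.

Record loc := Loc { loc_val : {fraction A}; loc_valP : loc_val \in loc_pred }.

HB.instance Definition _ := [isSub for loc_val].
HB.instance Definition _ := [Choice of loc by <:].
HB.instance Definition _ := [SubChoice_isSubComNzRing of loc by <:].

Lemma loc_inP (a : A) : a%:F \in loc_pred.
Proof.
by apply/asboolP; exists a, 1; rewrite idealr1 rmorph1 divr1.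
Qed.

Definition loc_in (a : A) : loc := Loc (loc_inP a).

Lemma loc_in_is_zmod_morphism : zmod_morphism loc_in.
Proof. by move=> a b; apply: val_inj; rewrite /= rmorphB. Qed.

Lemma loc_in_is_monoid_morphism : monoid_morphism loc_in.
Proof. by split=> [|a b]; apply: val_inj; rewrite /= ?rmorph1 ?rmorphM. Qed.

HB.instance Definition _ :=
  GRing.isZmodMorphism.Build A loc loc_in loc_in_is_zmod_morphism.
HB.instance Definition _ :=
  GRing.isMonoidMorphism.Build A loc loc_in loc_in_is_monoid_morphism.

Definition loc_ideal : {pred loc} := ideal_ext loc_in L.

HB.instance Definition _ := GRing.ZmodClosed.copy loc_ideal (ideal_ext loc_in L).

Lemma loc_idealP x : reflect
  (exists a b, [/\ a \in L, b \notin L & loc_val x = a%:F / b%:F])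
  (x \in loc_ideal).
Proof.
apply: (iffP idP) => [/ideal_genP[n [c [g [gL ->]]]]|[a [b [aL bL xE]]]].
  elim/big_ind: _ => [|x1 x2|i _].
  - by exists 0, 1; rewrite idealr0 idealr1 rmorph0 mul0r.
  - move=> [a [b [aL bL aE]]] [c' [d [cL dL cE]]].
    exists (a * d + c' * b), (b * d).
    rewrite prime_idealrM negb_or bL dL rpredD; first last.
    + by rewrite mulrC idealMr.
    + by rewrite mulrC idealMr.
    split=> //; rewrite /= aE cE addf_div ?notin_prime_neq0 //.
    by rewrite rmorphD !rmorphM.
  have [a aL ->] := gL i; have /asboolP[b [d [dL cE]]] := loc_valP (c i).
  exists (b * a), d; split=> //; first exact: idealMr.
  by rewrite /= cE rmorphM mulrAC.
have vP : b%:F^-1 \in loc_pred.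
  by apply/asboolP; exists 1, b; rewrite rmorph1 mul1r.
have -> : x = Loc vP * loc_in a by apply: val_inj; rewrite /= xE mulrC.
by apply: ideal_genMl; apply: mem_ideal_gen; exists a.
Qed.

Lemma loc_ideal_in a : (loc_in a \in loc_ideal) = (a \in L).
Proof.
apply/loc_idealP/idP=> [[b [c [bL cL /= aE]]]|aL]; last first.
  by exists a, 1; rewrite idealr1 rmorph1 divr1.
have /eqP : (a * c)%:F = b%:F.
  by rewrite tofracM aE divfK // notin_prime_neq0.
by rewrite tofrac_eq => /eqP acE; move: bL; rewrite -acE prime_idealrM (negPf cL) orbF.
Qed.

Lemma loc_valM_in (x : loc) :
  exists a b, [/\ b \notin L, loc_in b * x = loc_in a
                & (x \in loc_ideal) = (a \in L)].
Proof.
have /asboolP[a [b [bL xE]]] := loc_valP x; exists a, b.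
have bxE : loc_in b * x = loc_in a.
  by apply: val_inj; rewrite /= xE mulrC divfK // notin_prime_neq0.
split=> //; apply/idP/idP=> [xL|aL].
  by rewrite -loc_ideal_in -bxE; apply: ideal_genMl.
by apply/loc_idealP; exists a, b.
Qed.

Lemma loc_ideal_idealr_closed : idealr_closed loc_ideal.
Proof.
split; first exact: rpred0.
  by rewrite -(rmorph1 loc_in) loc_ideal_in idealr1.
by move=> a u v uL vL; apply: rpredD => //; apply: ideal_genMl.
Qed.

HB.instance Definition _ := isIdealr.Build loc loc_ideal loc_ideal_idealr_closed.

Lemma loc_ideal_maximal (x : loc) :
  x \notin loc_ideal -> exists y, y * x - 1 \in loc_ideal.
Proof.
have [a [b [bL bxE ->]]] := loc_valM_in x => aL.
have vP : (1%:F / a%:F) \in loc_pred by apply/asboolP; exists 1, a.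
exists (Loc vP * loc_in b).
suff -> : Loc vP * loc_in b * x = 1 by rewrite subrr rpred0.
rewrite -mulrA bxE; apply: val_inj.
by rewrite /= rmorph1 div1r mulVf // notin_prime_neq0.
Qed.

Lemma loc_ideal_prime : prime_idealr_closed loc_ideal.
Proof.
move=> u v uvL; apply/orP; case: (boolP (u \in loc_ideal)); first by left.
move=> /loc_ideal_maximal[y yuL]; right.
have -> : v = y * (u * v) - v * (y * u - 1).
  by rewrite mulrBr mulr1 mulrA [v * _]mulrC subKr.
by apply: rpredB; apply: ideal_genMl.
Qed.

HB.instance Definition _ := isPrimeIdealrClosed.Build loc loc_ideal loc_ideal_prime.
HB.instance Definition _ := isMaximalIdealr.Build loc loc_ideal loc_ideal_maximal.

End Localization.

Arguments loc_ideal {A} L _.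
Arguments loc_in {A} L a.

Section QuotientLocalization.
Variables (Q : comNzRingType) (H J : prime_idealr Q) (sHJ : {subset H <= J}).

(* [sHJ] is an argument because it makes the extended ideal prime. *)
Definition quo_prime of {subset H <= J} : {pred {ideal_quot H}} :=
  ideal_ext (qproj H) J.
Local Notation L := (quo_prime sHJ).

HB.instance Definition _ := GRing.ZmodClosed.copy L (ideal_ext (qproj H) J).

Lemma quo_primeE x : (qproj H x \in L) = (x \in J).
Proof.
apply/idP/idP=> [|xJ]; last by apply: mem_ideal_gen; exists x.
case/ideal_genP=> [n [c [g [gJ xE]]]].
suff [y yJ yE] : exists2 y, y \in J & qproj H x = qproj H y.
  move/eqP: yE; rewrite -subr_eq0 -rmorphB qproj_eq0 => /sHJ xyJ.
  by rewrite -(subrK y x) rpredD.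
rewrite xE; elim/big_ind: _ => [|_ _ [y yJ ->] [z zJ ->]|i _].
- by exists 0; rewrite ?idealr0 ?rmorph0.
- by exists (y + z); rewrite ?rpredD ?rmorphD.
have [y yJ ->] := gJ i; have [z ->] := qprojP (c i).
by exists (z * y); rewrite ?idealMr ?rmorphM.
Qed.

Lemma quo_prime_idealr_closed : idealr_closed L.
Proof.
split; first exact: rpred0.
  by rewrite -(rmorph1 (qproj H)) quo_primeE idealr1.
by move=> a u v uL vL; apply: rpredD => //; apply: ideal_genMl.
Qed.

Lemma quo_prime_closed : prime_idealr_closed L.
Proof.
move=> u v; have [x ->] := qprojP u; have [y ->] := qprojP v.
by rewrite -rmorphM !quo_primeE prime_idealrM.
Qed.

HB.instance Definition _ := isIdealr.Build _ L quo_prime_idealr_closed.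
HB.instance Definition _ := isPrimeIdealrClosed.Build _ L quo_prime_closed.

Definition to_residue (q : Q) : {ideal_quot (loc_ideal L)} :=
  qproj (loc_ideal L) (loc_in L (qproj H q)).

HB.instance Definition _ := GRing.RMorphism.copy to_residue
  (qproj (loc_ideal L) \o (loc_in L \o qproj H)).

Lemma to_residue_eq0 q : (to_residue q == 0) = (q \in J).
Proof. by rewrite qproj_eq0 loc_ideal_in quo_primeE. Qed.

End QuotientLocalization.

Section IndependentVariables.
Variables (k : fieldType) (n : nat) (U : {set 'I_n}).
Local Notation Q := {mpoly k[n]}.
Local Notation kU := {mpoly k[#|U|]}.
Local Notation Q0 := {mpoly {fraction kU}[#|~: U|]}.

Definition kU_in : kU -> Q :=
  mmap (@mpolyC n k) (fun j : 'I_#|U| => 'X_(enum_val j)).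
HB.instance Definition _ := GRing.RMorphism.on kU_in.

Definition independent (J : {pred Q}) : Prop :=
  forall p : kU, kU_in p \in J -> p = 0.

Definition kU_in0 : kU -> Q0 :=
  @mpolyC #|~: U| {fraction kU} \o @FracField.tofrac kU.
HB.instance Definition _ := GRing.RMorphism.on kU_in0.

Lemma notin_setC (i : 'I_n) : i \notin U -> i \in ~: U.
Proof. by rewrite inE. Qed.

(* Q0 is k(U)[V] with V the complement of U; the j-th variable of k[U] (resp.
   of Q0 over k(U)) stands for X_i, where i is the j-th element of U (resp. V). *)
Definition Q_in0_var (i : 'I_n) : Q0 :=
  match boolP (i \in U) with
  | AltTrue iU => kU_in0 'X_(enum_rank_in iU i)
  | AltFalse iU => 'X_(enum_rank_in (notin_setC iU) i)
  end.

Definition Q_in0 : Q -> Q0 := mmap (kU_in0 \o @mpolyC #|U| k) Q_in0_var.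
HB.instance Definition _ := GRing.RMorphism.on Q_in0.

End IndependentVariables.

Definition max_independent (k : fieldType) (n : nat) (J : {pred {mpoly k[n]}})
  (U : {set 'I_n}) : Prop :=
  maxset (fun W => `[< independent W J >]) U.

Section InitialIdeal.
Variables (k : fieldType) (n : nat).
Local Notation Q := {mpoly k[n]}.
Variables (H J : prime_idealr Q) (sHJ : {subset H <= J}) (U : {set 'I_n}).
Local Notation kU := {mpoly k[#|U|]}.
Local Notation Q0 := {mpoly {fraction kU}[#|~: U|]}.
Local Notation K := {ideal_quot (loc_ideal (quo_prime sHJ))}.

(* When U is independent modulo J, the denominator has nonzero residue, and
   [frac_to_residue] is the extension to k(U) of the map from k[U] to K. *)
Definition frac_to_residue (x : {fraction kU}) : K :=
  to_residue sHJ (kU_in \n_(repr x)) / to_residue sHJ (kU_in \d_(repr x)).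

Definition Q0_to_residue : Q0 -> K :=
  mmap frac_to_residue (fun j => to_residue sHJ 'X_(enum_val j)).

(* The base value [msize g] exceeds the degree of every monomial of g, so the
   minimum is the lowest degree in Y, and the initial form of 0 is 0. *)
Definition init_form (s : nat) (g : {mpoly Q0[s]}) : {mpoly Q0[s]} :=
  pihomog mdeg (\big[minn/msize g]_(m <- msupp g) mdeg m) g.

Definition init_red (s : nat) (g : {mpoly Q0[s]}) : {mpoly K[s]} :=
  map_mpoly Q0_to_residue (init_form g).

Definition graph_ideal (s : nat) (f : 'I_s -> Q) : {pred {mpoly Q0[s]}} :=
  ideal_add
    (ideal_gen (fun p => exists j, p = (Q_in0 U (f j))%:MP - 'X_j))
    (ideal_ext (@mpolyC s Q0) (ideal_ext (Q_in0 U) H)).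

Definition init_ideal (s : nat) (f : 'I_s -> Q) : {pred {mpoly K[s]}} :=
  ideal_gen (fun p => exists2 g, g \in graph_ideal f & p = init_red g).

End InitialIdeal.

Arguments init_ideal {k n H J} sHJ U {s} f _.

Lemma frac_reprE (A : idomainType) (x : {fraction A}) :
  x = FracField.tofrac (\n_(repr x)) / FracField.tofrac (\d_(repr x)).
Proof.
have dn0 : FracField.tofrac (\d_(repr x)) != 0.
  by rewrite tofrac_eq0 denom_ratioP.
apply: (mulIf dn0); rewrite divfK // -{1}[x]reprK; set r := repr x.
unlock FracField.tofrac; rewrite -[LHS]FracField.pi_mul.
apply/eqmodP; rewrite /= FracField.equivfE /FracField.mulf.
by rewrite !numden_Ratio ?mulr1 ?oner_eq0 ?mulf_neq0 ?denom_ratioP // mulrC.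
Qed.

Lemma Q_in0_varT (k : fieldType) n (U : {set 'I_n}) i (iU : i \in U) :
  Q_in0_var k U i = kU_in0 'X_(enum_rank_in iU i).
Proof.
rewrite /Q_in0_var; move: (boolP _) => a.
refine (match a with AltTrue h => _ | AltFalse h => _ end).
  by rewrite (bool_irrelevance h iU).
by have := h; rewrite iU.
Qed.

Lemma Q_in0_varF (k : fieldType) n (U : {set 'I_n}) i (iU : i \notin U) :
  Q_in0_var k U i = 'X_(enum_rank_in (notin_setC iU) i).
Proof.
rewrite /Q_in0_var; move: (boolP _) => a.
refine (match a with AltTrue h => _ | AltFalse h => _ end).
  by have := iU; rewrite h.
by rewrite (bool_irrelevance h iU).
Qed.

Lemma mpoly_rmorph_ext m (R S : comNzRingType)
    (g h : {rmorphism {mpoly R[m]} -> S}) :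
  (forall c, g c%:MP = h c%:MP) -> (forall i, g 'X_i = h 'X_i) -> g =1 h.
Proof.
move=> gC gX p; rewrite (mpolyE p) !rmorph_sum; apply: eq_bigr => mm _ /=.
rewrite -mul_mpolyC !rmorphM gC mpolyXE_id !rmorph_prod; congr (_ * _).
by apply: eq_bigr => i _; rewrite !rmorphXn gX.
Qed.

Section Identification.
Variables (k : fieldType) (n : nat).
Local Notation Q := {mpoly k[n]}.
Variables (H J : prime_idealr Q) (sHJ : {subset H <= J}) (U : {set 'I_n}).
Local Notation kU := {mpoly k[#|U|]}.
Local Notation Q0 := {mpoly {fraction kU}[#|~: U|]}.
Local Notation K := {ideal_quot (loc_ideal (quo_prime sHJ))}.
Hypothesis indU : independent U J.
Local Notation "x %:F" := (@FracField.tofrac _ x) (at level 1).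

Definition kU_res : kU -> K := to_residue sHJ \o @kU_in k n U.
HB.instance Definition _ := GRing.RMorphism.on kU_res.

Lemma kU_res_eq0 b : (kU_res b == 0) = (b == 0).
Proof.
rewrite /kU_res /= to_residue_eq0; apply/idP/eqP=> [/indU//|->].
by rewrite rmorph0 rpred0.
Qed.

Lemma frac_to_residueE a b : b != 0 ->
  frac_to_residue sHJ (a%:F / b%:F) = kU_res a / kU_res b.
Proof.
move=> b0; rewrite /frac_to_residue; set r := repr _.
change (kU_res \n_r / kU_res \d_r = kU_res a / kU_res b).
have d0 : \d_r != 0 by exact: denom_ratioP.
have rE : a * \d_r = b * \n_r.
  apply/eqP; rewrite -tofrac_eq !tofracM.
  have /eqP : a%:F / b%:F = (\n_r)%:F / (\d_r)%:F by exact: frac_reprE.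
  by rewrite eqr_div ?tofrac_eq0; [rewrite [b%:F * _]mulrC|by []|by []].
apply/eqP; rewrite eqr_div ?kU_res_eq0; [|by []|by []].
by rewrite -!rmorphM rE mulrC.
Qed.

Lemma frac_to_residue_zmod : zmod_morphism (@frac_to_residue k n H J sHJ U).
Proof.
move=> x y; rewrite (frac_reprE x) (frac_reprE y).
set a := \n_ _; set b := \d_ _; set c := \n_ _; set d := \d_ _.
have b0 : b != 0 by exact: denom_ratioP.
have d0 : d != 0 by exact: denom_ratioP.
rewrite -mulNr addf_div ?tofrac_eq0 // -tofracN -!tofracM -tofracD.
rewrite !frac_to_residueE ?mulf_neq0 //.
by rewrite -mulNr addf_div ?kU_res_eq0 // !rmorphD !rmorphM rmorphN.
Qed.

Lemma frac_to_residue_monoid : monoid_morphism (@frac_to_residue k n H J sHJ U).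
Proof.
split=> [|x y].
  have := frac_to_residueE 1 (oner_neq0 kU).
  by rewrite tofrac1 divr1 rmorph1 divr1.
rewrite (frac_reprE x) (frac_reprE y).
set a := \n_ _; set b := \d_ _; set c := \n_ _; set d := \d_ _.
have b0 : b != 0 by exact: denom_ratioP.
have d0 : d != 0 by exact: denom_ratioP.
rewrite mulf_div -!tofracM !frac_to_residueE ?mulf_neq0 //.
by rewrite mulf_div !rmorphM.
Qed.

Definition frac_to_residue_rmorph : {rmorphism {fraction kU} -> K} :=
  HB.pack (@frac_to_residue k n H J sHJ U)
   (GRing.isZmodMorphism.Build _ _ _ frac_to_residue_zmod)
   (GRing.isMonoidMorphism.Build _ _ _ frac_to_residue_monoid).

Definition Q0_to_residue_rmorph : {rmorphism Q0 -> K} :=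
  mmap frac_to_residue_rmorph (fun j => to_residue sHJ 'X_(enum_val j)).

Local Notation rho := (@Q0_to_residue k n H J sHJ U).
Lemma Q0_to_residue_rmorphE : Q0_to_residue_rmorph =1 rho.
Proof. by []. Qed.

Lemma Q0_to_residue_kU (p : kU) : rho (kU_in0 p) = kU_res p.
Proof.
rewrite /Q0_to_residue /kU_in0 /= (mmapC _ frac_to_residue_rmorph) /=.
have := frac_to_residueE p (oner_neq0 kU).
by rewrite rmorph1 divr1 rmorph1 divr1.
Qed.

Lemma Q0_to_residue_Q q : rho (Q_in0 U q) = to_residue sHJ q.
Proof.
rewrite -Q0_to_residue_rmorphE.
apply: (mpoly_rmorph_ext (g := Q0_to_residue_rmorph \o Q_in0 U)) => [c|i] /=.
  rewrite /Q_in0 (mmapC _ (@kU_in0 k n U \o @mpolyC #|U| k)) /=.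
  rewrite -[mmap _ _ _]/(rho _) Q0_to_residue_kU /kU_res /= /kU_in.
  by rewrite (mmapC _ (@mpolyC n k)).
rewrite /Q_in0 (mmapX _ (@kU_in0 k n U \o @mpolyC #|U| k)) mmap1U.
case: (boolP (i \in U)) => iU; last first.
  rewrite Q_in0_varF (mmapX _ frac_to_residue_rmorph) mmap1U enum_rankK_in //.
  by rewrite inE.
rewrite Q_in0_varT.
rewrite -[mmap _ _ _]/(rho _) Q0_to_residue_kU /kU_res /= /kU_in.
by rewrite (mmapX _ (@mpolyC n k)) mmap1U enum_rankK_in.
Qed.

Lemma Q_in0_kU (p : kU) : Q_in0 U (kU_in p) = kU_in0 p.
Proof.
apply: (mpoly_rmorph_ext (g := Q_in0 U \o @kU_in k n U)
   (h := @kU_in0 k n U)) => [c|i] /=.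
  rewrite /kU_in (mmapC _ (@mpolyC n k)) /Q_in0.
  by rewrite (mmapC _ (@kU_in0 k n U \o @mpolyC #|U| k)).
rewrite /kU_in (mmapX _ (@mpolyC n k)) mmap1U /Q_in0.
rewrite (mmapX _ (@kU_in0 k n U \o @mpolyC #|U| k)) mmap1U.
by rewrite (Q_in0_varT _ (enum_valP i)) enum_valK_in.
Qed.

Lemma Q_in0_V (j : 'I_#|~: U|) : Q_in0 U ('X_(enum_val j) : Q) = 'X_j.
Proof.
rewrite /Q_in0 (mmapX _ (@kU_in0 k n U \o @mpolyC #|U| k)) mmap1U.
have jU : enum_val j \notin U by have := enum_valP j; rewrite inE.
by rewrite (Q_in0_varF _ jU) enum_valK_in.
Qed.

Lemma kU_in0_unit (b : kU) : b != 0 -> exists v : Q0, v * kU_in0 b = 1.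
Proof.
move=> b0; exists (b%:F^-1)%:MP; rewrite /kU_in0 /= -mpolyCM.
by rewrite mulVf ?tofrac_eq0.
Qed.

Lemma Q0_clear (x : Q0) : exists (b : kU) q, b != 0 /\ kU_in0 b * x = Q_in0 U q.
Proof.
elim/(@mpolyind #|~: U| {fraction kU}): x => [|c m p _ _ [b [q [b0 bE]]]].
  by exists 1, 0; rewrite oner_neq0 mulr0 rmorph0.
have [mq mE] : exists q : Q, Q_in0 U q = 'X_[m] :> Q0.
  exists (\prod_i ('X_(enum_val i) : Q) ^+ m i).
  rewrite rmorph_prod mpolyXE_id; apply: eq_bigr => i _.
  by rewrite rmorphXn /= Q_in0_V.
exists (\d_(repr c) * b), (kU_in (\n_(repr c) * b) * mq + kU_in \d_(repr c) * q).
split; first by rewrite mulf_neq0 ?denom_ratioP.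
rewrite rmorphD !rmorphM /= !Q_in0_kU mE -bE mulrDr !mulrA; congr (_ + _).
rewrite -mul_mpolyC mulrA; congr (_ * _).
rewrite mulrAC; congr (_ * _).
rewrite {2}(frac_reprE c) /kU_in0 /= -mpolyCM mulrC divfK //.
by rewrite tofrac_eq0 denom_ratioP.
Qed.

(* [Q0_to_residue] extends [to_residue] ([Q0_to_residue_Q]) and has kernel J^0:
   it is the embedding Q^0/J^0 -> K along which the two fields are identified. *)
Lemma Q0_to_residue_eq0 (x : Q0) : rho x = 0 <-> x \in ideal_ext (Q_in0 U) J.
Proof.
split=> [x0|/ideal_genP[m [c [g [gJ ->]]]]].
  have [b [q [b0 bE]]] := Q0_clear x; have [v vE] := kU_in0_unit b0.
  have qJ : q \in J.
    rewrite -(to_residue_eq0 sHJ) -Q0_to_residue_Q -bE -Q0_to_residue_rmorphE rmorphM /=.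
    by rewrite -[X in _ * X]/(rho x) x0 mulr0.
  rewrite -[x]mul1r -vE -mulrA bE ideal_genMl // mem_ideal_gen //.
  by exists q.
rewrite -Q0_to_residue_rmorphE rmorph_sum big1 // => i _.
have [q qJ ->] := gJ i; rewrite rmorphM; apply/eqP; rewrite mulf_eq0; apply/orP.
by right; rewrite Q0_to_residue_rmorphE Q0_to_residue_Q to_residue_eq0.
Qed.
End Identification.

Definition generated_by_linear (F : fieldType) (s : nat)
  (I : {pred {mpoly F[s]}}) : Prop :=
  exists S : {mpoly F[s]} -> Prop,
    (forall p, S p -> p \is 1.-homog) /\ I =i ideal_gen S.

(* Main.v *)
Require Import Defs.
From HB Require Import structures.
From mathcomp Require Import all_boot all_algebra.
From mathcomp Require Import ring_quotient fraction mpoly.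
From mathcomp Require Import fingroup perm boolp ring.

(** Write [R] for the local ring, [m] for its maximal ideal, [K] for the residue
    field and [gr m] for the associated graded ring. A family [x] that generates
    [m] defines a surjection [gr_map] from [K[Y]] to [gr m] that sends [Y_j] to
    the class of [x_j]. The proof compares the family given by the [f_j] with a
    family [z] of [d] generators that is linearly independent modulo the square
    of [m], and shows that each of the three conditions says that the surjection
    [K[Z] -> gr m] attached to [z] is injective. In terms of [R] injectivity
    means that [z] is quasi-regular: a form of degree [n] in [z] lies in
    [m ^ (n + 1)] only if its coefficients lie in [m].

    The ideal of initial forms is the kernel of the surjection attached to the
    [f_j] ([init_ideal_kernel]). Indeed, an element of the graph ideal vanishes
    at [Y = f] modulo [H], so that the value of its lowest form is of higher
    order. Conversely, if a form [G] of degree [n] has a value in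
    [m ^ (n + 1)], this value is also that of a form [F] of degree [n + 1], and
    [G - F] belongs to the graph ideal up to denominators.

    Linear generation of this kernel amounts to injectivity for [z], because the
    two families are exchanged by linear substitutions, and the kernel for [z]
    contains no linear form ([linear_kernel_injective]). If [gr m] is any
    polynomial ring, lifting its variables to [K[Z]] turns the surjection for
    [z] into an endomorphism of [K[Z]] tangent to the identity, and such an
    endomorphism is injective ([polynomial_gr_map_injective]).

    It remains to see that [z] is quasi-regular if and only if [R] has dimension
    [d] ([quasi_regular_krull_dim]). The intermediate notion is lexicographic
    independence: no expression
    [z_1 ^ a_1 (z_2 ^ a_2 ( ... (u + c_d z_d) ... ) + c_1 z_1)] with [u] a unit
    vanishes. If such an expression vanished, [m] would be minimal over [d - 1]
    elements, and by Krull's height theorem no chain of primes would have length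
    [d] ([lex_independent_of_chain]). By Krull's intersection theorem every
    nonzero element of [R] is such an expression; as these expressions are
    closed under products, under lexicographic independence the ideals
    [(z_1, ..., z_i)] are prime and form a strictly increasing chain of length
    [d] ([chain_of_lex_independent]). So [z] is also a regular sequence, hence
    quasi-regular ([lex_independent_quasi_regular]). Finally, in a quasi-regular
    family a monomial is not in the ideal of the lexicographically larger
    monomials ([quasi_regular_lex_independent]).

    The rings are Noetherian by Hilbert's basis theorem. *)

Set Implicit Arguments.
Unset Strict Implicit.
Unset Printing Implicit Defensive.

Import GRing.Theory.
Local Open Scope ring_scope.

(** * Ideals in Noetherian rings *)

Section Ideals.
Variable R : comNzRingType.
Implicit Types (I J P Q : R -> Prop).

(** Unlike an [idealr], such an ideal may be the unit ideal, and no boolean test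
    for membership is required. *)
Record is_ideal I : Prop := IsIdeal {
  ideal0 : I 0;
  idealD : forall x y, I x -> I y -> I (x + y);
  idealM : forall a x, I x -> I (a * x) }.

Record is_prime P : Prop := IsPrime {
  prime_ideal : is_ideal P;
  prime1 : ~ P 1;
  primeM : forall a b, P (a * b) -> P a \/ P b }.

Definition sub_ideal I J := forall x, I x -> J x.

Definition finitely_generated I := exists t (g : 'I_t -> R),
  (forall i, I (g i)) /\
  (forall r, I r -> exists a : 'I_t -> R, r = \sum_i a i * g i).

Definition noetherian := forall I, is_ideal I -> finitely_generated I.

(** The ideal [I + (y)]. *)
Definition adjoin I y : R -> Prop := fun r => exists c, I (r - c * y).

Lemma ideal_opp I x : is_ideal I -> I x -> I (- x).
Proof. by move=> iI Ix; rewrite -mulN1r; apply: idealM. Qed.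

Lemma ideal_sub I x y : is_ideal I -> I x -> I y -> I (x - y).
Proof. by move=> iI Ix Iy; apply: idealD => //; apply: ideal_opp. Qed.

Lemma ideal_mulr I a x : is_ideal I -> I x -> I (x * a).
Proof. by move=> iI Ix; rewrite mulrC; apply: idealM. Qed.

Lemma ideal_sum I (T : Type) (r : seq T) (p : pred T) (F : T -> R) :
  is_ideal I -> (forall i, p i -> I (F i)) -> I (\sum_(i <- r | p i) F i).
Proof.
move=> iI IF; elim/big_rec: _ => [|i x pi Ix]; first exact: ideal0.
by apply: idealD => //; apply: IF.
Qed.

Lemma ideal_subr I x y : is_ideal I -> I (x - y) -> I y -> I x.
Proof. by move=> iI Ixy Iy; rewrite -(subrK y x); apply: idealD. Qed.

Lemma ideal_sub_l I x y : is_ideal I -> I (x - y) -> I x -> I y.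
Proof.
by move=> iI Ixy Ix; rewrite -(subKr x y); apply: ideal_sub.
Qed.

Lemma primeX P x n : is_prime P -> P (x ^+ n) -> P x.
Proof.
move=> pP; elim: n => [|n IHn]; first by rewrite expr0 => /(prime1 pP).
by rewrite exprS => /(primeM pP)[].
Qed.

Lemma adjoin_ideal I y : is_ideal I -> is_ideal (adjoin I y).
Proof.
move=> iI; split.
- by exists 0; rewrite mul0r subr0; apply: ideal0.
- move=> a b [c Ic] [d Id]; exists (c + d).
  have -> : a + b - (c + d) * y = (a - c * y) + (b - d * y) by ring.
  exact: idealD.
move=> a x [c Ic]; exists (a * c); rewrite -mulrA -mulrBr; exact: idealM.
Qed.

Lemma sub_adjoin I y : sub_ideal I (adjoin I y).
Proof. by move=> x Ix; exists 0; rewrite mul0r subr0. Qed.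

Lemma mem_adjoin I y : is_ideal I -> adjoin I y y.
Proof. by move=> iI; exists 1; rewrite mul1r subrr; apply: ideal0. Qed.

Lemma adjoin_min I y J :
  is_ideal J -> sub_ideal I J -> J y -> sub_ideal (adjoin I y) J.
Proof.
move=> iJ sIJ Jy x [c /sIJ Jx]; apply: (ideal_subr iJ Jx); exact: idealM.
Qed.

Section Noetherian.
Hypothesis nR : noetherian.

Lemma ideal_acc (I : nat -> R -> Prop) :
  (forall n, is_ideal (I n)) -> (forall n, sub_ideal (I n) (I n.+1)) ->
  exists N, forall n, sub_ideal (I n) (I N).
Proof.
move=> iI sI.
have mono n m : (n <= m)%N -> sub_ideal (I n) (I m).
  by move/subnK <-; elim: (m - n)%N => // d IH x Ix; rewrite addSn; apply/sI/IH.
have iU : is_ideal (fun x => exists n, I n x).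
  split; first by exists 0%N; apply: ideal0.
    move=> x y [n Ix] [m Iy]; exists (maxn n m); apply: idealD => //.
      by apply: mono Ix; rewrite leq_maxl.
    by apply: mono Iy; rewrite leq_maxr.
  by move=> a x [n Ix]; exists n; apply: idealM.
have [t [g [Ig gen]]] := nR iU; have [N IN] := choice Ig.
exists (\max_i N i)%N => n x Ix; have [|a ->] := gen x; first by exists n.
apply: ideal_sum => // i _; apply: idealM => //.
by apply: mono (IN i); apply: leq_bigmax.
Qed.

(** Otherwise dependent choice would produce a strictly increasing sequence. *)
Lemma exists_max_ideal (F : (R -> Prop) -> Prop) I0 :
    (forall I, F I -> is_ideal I) -> F I0 ->
  exists M, F M /\ forall J, F J -> sub_ideal M J -> sub_ideal J M.
Proof.
move=> iF F0; apply: contrapT => noM.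
have step (M : {I | F I}) :
    exists M' : {I | F I}, sub_ideal (sval M) (sval M') /\
                           ~ sub_ideal (sval M') (sval M).
  apply: contrapT => noM'; apply: noM; exists (sval M).
  split=> [|J FJ sMJ]; first exact: svalP.
  by apply: contrapT => nJM; apply: noM'; exists (exist _ J FJ).
have [next nextP] := choice step.
pose M n := iter n next (exist _ I0 F0).
have [N NP] := @ideal_acc (fun n => sval (M n)) (fun n => iF _ (svalP (M n)))
  (fun n => (nextP (M n)).1).
exact: (nextP (M N)).2 (NP N.+1).
Qed.

(** An ideal maximal among those that avoid a multiplicative set is prime. *)
Lemma exists_prime_avoiding I (S : R -> Prop) :
    is_ideal I -> S 1 -> (forall s t, S s -> S t -> S (s * t)) ->
    (forall s, S s -> ~ I s) ->
  exists P, [/\ is_prime P, sub_ideal I P & forall s, S s -> ~ P s].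
Proof.
move=> iI S1 SM SI.
pose F J := [/\ is_ideal J, sub_ideal I J & forall s, S s -> ~ J s].
have [||M [[iM IM SnM] maxM]] := @exists_max_ideal F I; [by move=> J [] | by split |].
have meet a : ~ M a -> exists s c, S s /\ M (s - c * a).
  move=> nMa; apply: contrapT => nmeet; apply/nMa/(maxM (adjoin M a)).
  - split; first exact: adjoin_ideal.
      by move=> x /IM; apply: sub_adjoin.
    by move=> s Ss [c Mc]; apply: nmeet; exists s, c.
  - exact: sub_adjoin.
  exact: mem_adjoin.
exists M; split=> //; split=> // [|a b Mab]; first exact: SnM.
have [|nMa] := pselect (M a); [by left | right; apply: contrapT => nMb].
have [s [c [Ss Msc]]] := meet a nMa; have [t [d [St Mtd]]] := meet b nMb.
apply: (SnM (s * t)); first exact: SM.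
have -> : s * t = s * (t - d * b) + (d * b) * (s - c * a) + (c * d) * (a * b).
  by ring.
by apply: idealD => //; first apply: idealD => //; apply: idealM.
Qed.
End Noetherian.

(** [I] is the contraction of its extension to the localization at [P]. *)
Definition saturated P I := forall s r, ~ P s -> I (s * r) -> I r.

Lemma prime_prod P t (F : 'I_t -> R) :
  is_prime P -> (forall i, ~ P (F i)) -> ~ P (\prod_i F i).
Proof.
move=> pP nPF; apply: (big_rec (fun x => ~ P x)) => [|i x _ nPx].
  exact: prime1.
by case/(primeM pP) => //; apply: nPF.
Qed.

(** Modulo the prime the matrix is diagonal, so that its determinant is the
    product of the diagonal entries. *)
Lemma det_diagonal_mod_prime P t (B : 'M[R]_t) :
    is_prime P -> (forall i j, i != j -> P (B i j)) -> (forall i, ~ P (B i i)) ->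
  ~ P (\det B).
Proof.
move=> pP offB diagB; have iP := prime_ideal pP.
rewrite /determinant (bigD1 (1%g : {perm _})) //=; set S := \sum_(_ | _) _ => Pdet.
have PS : P S.
  apply: ideal_sum => // s ns1; apply: idealM => //.
  have [i si] : exists i, s i != i.
    apply/existsP; apply: contraNT ns1; rewrite negb_exists => /forallP sid.
    by apply/eqP/permP => i; rewrite perm1; apply/eqP; have := sid i; rewrite negbK.
  by rewrite (bigD1 i) //=; apply: ideal_mulr => //; apply: offB; rewrite eq_sym.
have := ideal_sub iP Pdet PS; rewrite addrK odd_perm1 expr0 mul1r.
by apply: prime_prod => // i; rewrite perm1.
Qed.

(** The determinant trick, carried out in the localization at [P]: the
    multipliers [s] play the role of the denominators. *)
Lemma nakayama P I t (g : 'I_t -> R) :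
    is_prime P -> is_ideal I -> saturated P I ->
    (forall i, exists s (a : 'I_t -> R),
       [/\ ~ P s, forall j, P (a j) & I (s * g i - \sum_j a j * g j)]) ->
  forall i, I (g i).
Proof.
move=> pP iI satI rel; have iP := prime_ideal pP.
have [s /choice[a /all_and3[nPs Pa Isa]]] := choice rel.
pose B : 'M[R]_t := \matrix_(i, j) (s i *+ (i == j) - a i j).
have nPdet : ~ P (\det B).
  apply: det_diagonal_mod_prime => // [i j|i]; rewrite mxE.
    by move=> /negPf ->; rewrite mulr0n sub0r; apply: ideal_opp.
  by rewrite eqxx => Ps; apply: (nPs i); apply: (ideal_subr iP Ps).
have IB i : I (\sum_j B i j * g j).
  have -> : \sum_j B i j * g j = s i * g i - \sum_j a i j * g j; last by [].
  rewrite [X in X - _](_ : _ = \sum_j (s i *+ (i == j)) * g j); last first.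
    rewrite (bigD1 i) //= eqxx big1 ?addr0 // => j /negPf nij.
    by rewrite eq_sym nij mul0r.
  by rewrite -sumrB; apply: eq_bigr => j _; rewrite mxE mulrBl.
move=> i; apply: (satI _ _ nPdet).
have -> : \det B * g i = \sum_j (\adj B *m B) i j * g j.
  rewrite mul_adj_mx (bigD1 i) //= mxE eqxx big1 ?addr0 // => j /negPf nij.
  by rewrite mxE eq_sym nij mul0r.
under eq_bigr do rewrite mxE mulr_suml.
rewrite exchange_big /=; apply: ideal_sum => // j _.
under eq_bigr do rewrite -mulrA.
by rewrite -mulr_sumr; apply: idealM.
Qed.

End Ideals.

(** * Krull's height and intersection theorems *)

Section Height.
Variable R : comNzRingType.
Implicit Types (I J P Q : R -> Prop).

Definition minimal_over P I := forall P',
  is_prime P' -> sub_ideal I P' -> sub_ideal P' P -> sub_ideal P P'.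

Definition saturation P I : R -> Prop := fun r => exists s, ~ P s /\ I (s * r).

Lemma saturation_ideal P I : is_prime P -> is_ideal I -> is_ideal (saturation P I).
Proof.
move=> pP iI; split.
- by exists 1; split; [exact: prime1 | rewrite mulr0; apply: ideal0].
- move=> x y [s [nPs Isx]] [t [nPt Ity]]; exists (s * t); split.
    by case/(primeM pP).
  have -> : s * t * (x + y) = t * (s * x) + s * (t * y) by ring.
  by apply: idealD => //; apply: idealM.
by move=> a x [s [nPs Isx]]; exists s; split=> //; rewrite mulrCA; apply: idealM.
Qed.

Lemma saturation_saturated P I : is_prime P -> saturated P (saturation P I).
Proof.
move=> pP s r nPs [t [nPt It]]; exists (t * s); rewrite -mulrA; split=> //.
by case/(primeM pP).
Qed.

Lemma sub_saturation P I : is_prime P -> sub_ideal I (saturation P I).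
Proof. by move=> pP x Ix; exists 1; rewrite mul1r; split; [exact: prime1|]. Qed.

Lemma saturation_mono P I J :
  sub_ideal I J -> sub_ideal (saturation P I) (saturation P J).
Proof. by move=> sIJ x [s [nPs /sIJ Jsx]]; exists s. Qed.

Lemma adjoin_mono I J y : sub_ideal I J -> sub_ideal (adjoin I y) (adjoin J y).
Proof. by move=> sIJ x [c /sIJ Jx]; exists c. Qed.

Lemma prime_saturated P Q : is_prime Q -> sub_ideal Q P -> saturated P Q.
Proof. by move=> pQ sQP s r nPs /(primeM pQ)[/sQP|]. Qed.

Definition descending (J : nat -> R -> Prop) := forall n, sub_ideal (J n.+1) (J n).

Lemma descending_leq (J : nat -> R -> Prop) m n :
  descending J -> (m <= n)%N -> sub_ideal (J n) (J m).
Proof.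
move=> dJ /subnK <-; elim: (n - m)%N => // d IH x.
by rewrite addSn => /dJ /IH.
Qed.

Definition stationary (J : nat -> R -> Prop) :=
  exists N, forall n, (N <= n)%N -> sub_ideal (J N) (J n).

Hypothesis nR : noetherian R.

(** A colon ideal [(M : y)] that is maximal among the proper ones is prime, and
    it is squeezed between [M] and [P]. *)
Lemma exists_colon_prime P M :
    is_prime P -> is_ideal M -> saturated P M -> minimal_over P M -> ~ M 1 ->
  exists y, ~ M y /\ forall r, P r -> M (r * y).
Proof.
move=> pP iM satM minM nM1.
pose F C := exists2 y, ~ M y & C = (fun r => M (r * y)).
have iF C : F C -> is_ideal C.
  move=> [y _ ->]; split; first by rewrite mul0r; apply: ideal0.
    by move=> a b; rewrite mulrDl; apply: idealD.
  by move=> a b; rewrite -mulrA; apply: idealM.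
have [||C [[y nMy ->] maxC]] := @exists_max_ideal R nR F (fun r => M (r * 1)).
- exact: iF.
- by exists 1.
exists y; split=> // r Pr; apply: (minM (fun r => M (r * y))) Pr => //.
- split; first by apply: iF; exists y.
    by rewrite mul1r.
  move=> a b Mab; have [Mby|nMby] := pselect (M (b * y)); first by right.
  left; apply: (maxC (fun r => M (r * (b * y)))).
  + by exists (b * y).
  + by move=> x Mx; rewrite mulrCA; apply: idealM.
  by rewrite mulrA.
- by move=> x Mx; apply: ideal_mulr.
by move=> x Mxy; apply: contrapT => nPx; apply: nMy; apply: satM Mxy.
Qed.

(** The ring [R/I], localized at a minimal prime [P] of [I], is Artinian. In a
    maximal counterexample [I], some [y] outside [I] is killed by [P]; a chain
    above [I] stabilizes as soon as both its sum with [y] and the answer to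
    whether it contains [y] do. *)
Lemma stationary_above_minimal P I (J : nat -> R -> Prop) :
    is_prime P -> is_ideal I -> saturated P I -> minimal_over P I ->
    (forall n, is_ideal (J n)) -> (forall n, saturated P (J n)) ->
    (forall n, sub_ideal I (J n)) -> descending J ->
  stationary J.
Proof.
move=> pP iI0 satI0 minI0 iJ0 satJ0 sIJ0 dJ0; apply: contrapT => nstatJ0.
pose F I := [/\ is_ideal I, saturated P I, minimal_over P I & exists J : nat -> R -> Prop,
  [/\ forall n, is_ideal (J n), forall n, saturated P (J n),
      forall n, sub_ideal I (J n), descending J & ~ stationary J]].
have [||M [[iM satM minM [J1 [iJ satJ sMJ dJ nstatJ]]] maxM]] :=
  @exists_max_ideal R nR F I.
- by move=> ? [].
- by split=> //; exists J.
have nM1 : ~ M 1.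
  move=> M1; apply: nstatJ; exists 0%N => n _ x _; apply: sMJ.
  by rewrite -[x]mulr1; apply: idealM.
have [y [nMy PM]] := exists_colon_prime pP iM satM minM nM1.
pose M' := saturation P (adjoin M y).
have iM' : is_ideal M' by apply/saturation_ideal/adjoin_ideal.
have sMM' : sub_ideal M M'.
  by move=> x Mx; apply: sub_saturation => //; apply: sub_adjoin.
have nFM' : ~ F M'.
  move=> FM'; apply/nMy/(maxM _ FM' sMM').
  by apply: sub_saturation => //; apply: mem_adjoin.
have [N1 N1P] : stationary (fun n => saturation P (adjoin (J1 n) y)).
  apply: contrapT => nstat; apply: nFM'; split=> //.
  - exact: saturation_saturated.
  - by move=> P' pP' sM'P'; apply: minM => // x /sMM'/sM'P'.
  exists (fun n => saturation P (adjoin (J1 n) y)); split=> // n.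
  - by apply/saturation_ideal/adjoin_ideal.
  - exact: saturation_saturated.
  - by apply/saturation_mono/adjoin_mono.
  by apply/saturation_mono/adjoin_mono/dJ.
have [N2 N2P] : exists N2, (forall n, J1 n y) \/ ~ J1 N2 y.
  have [Jy|nJy] := pselect (forall n, J1 n y); first by exists 0%N; left.
  by have /existsNP[N2 nJN2] := nJy; exists N2; right.
apply: nstatJ; exists (maxn N1 N2) => n; rewrite geq_max => /andP[leN1 leN2] x Jx.
have JN1x : saturation P (adjoin (J1 N1) y) x.
  apply: sub_saturation => //; apply: sub_adjoin.
  by apply: descending_leq Jx => //; apply: leq_maxl.
have [s [nPs [c Jsx]]] := N1P n leN1 x JN1x.
have [Jy|nJN2] := N2P.
  by apply: (satJ n s) => //; apply: (ideal_subr (iJ n) Jsx); apply: idealM.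
apply: (satJ n s) => //; apply: (ideal_subr (iJ n) Jsx); apply: sMJ; apply: PM.
apply: contrapT => nPc; apply: nJN2; apply: (satJ _ _ _ nPc).
have JN2 := descending_leq dJ leN2 Jsx.
apply: (ideal_sub_l (iJ N2) JN2); apply: idealM => //.
by apply: descending_leq Jx => //; apply: leq_maxr.
Qed.

Definition ideal_prod I J : R -> Prop :=
  fun x => x \in ideal_gen (fun z => exists a b, [/\ I a, J b & z = a * b]).

Lemma ideal_gen_ideal (S : R -> Prop) : is_ideal (fun x => x \in ideal_gen S).
Proof.
split=> [|x y Sx Sy|a x Sx]; first exact: ideal_gen0.
  exact: ideal_genD.
exact: ideal_genMl.
Qed.

Lemma ideal_gen_sub (S : R -> Prop) I :
  is_ideal I -> (forall x, S x -> I x) -> forall x, x \in ideal_gen S -> I x.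
Proof.
move=> iI SI _ /ideal_genP[t [c [g [Sg ->]]]].
by apply: ideal_sum => // i _; apply: (idealM iI); apply: SI.
Qed.

Definition ideal_plus I J : R -> Prop := fun x => exists2 y, J y & I (x - y).

Lemma ideal_plus_ideal I J : is_ideal I -> is_ideal J -> is_ideal (ideal_plus I J).
Proof.
move=> iI iJ; split.
- by exists 0; rewrite ?subr0; apply: ideal0.
- move=> x y [a Ja Ia] [b Jb Ib]; exists (a + b); first exact: idealD.
  have -> : x + y - (a + b) = (x - a) + (y - b) by ring.
  exact: idealD.
by move=> c x [a Ja Ia]; exists (c * a); rewrite -?mulrBr; apply: idealM.
Qed.

(** Analogue of the symbolic powers of [Q / Q1] in [R / Q1]: each step multiplies
    by [Q] and contracts from the localization at [Q]. *)
Fixpoint symbolic_power Q1 Q n : R -> Prop :=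
  if n is n.+1
  then saturation Q (ideal_plus (ideal_prod Q (symbolic_power Q1 Q n)) Q1)
  else fun=> True.

Section SymbolicPower.
Variables (Q1 Q : R -> Prop).
Hypotheses (pQ1 : is_prime Q1) (pQ : is_prime Q) (sQ1Q : sub_ideal Q1 Q).
Local Notation S := (symbolic_power Q1 Q).

Lemma symbolic_power_ideal n : is_ideal (S n).
Proof.
case: n => [|n]; first by [].
apply: saturation_ideal => //; apply: ideal_plus_ideal (prime_ideal pQ1).
exact: ideal_gen_ideal.
Qed.

Lemma symbolic_power_saturated n : saturated Q (S n).
Proof. by case: n => [|n] //; apply: saturation_saturated. Qed.

Lemma symbolic_power_base n : sub_ideal Q1 (S n).
Proof.
case: n => [|n] //= x Q1x; apply: sub_saturation => //; exists x => //.
by rewrite subrr; apply: ideal_gen0.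
Qed.

Lemma symbolic_power_descending : descending S.
Proof.
elim=> [|n IHn] //; apply: saturation_mono => x [y Q1y Qxy]; exists y => //.
apply: ideal_gen_sub Qxy => [|_ [a [b [Qa Sb ->]]]]; first exact: ideal_gen_ideal.
by apply: mem_ideal_gen; exists a, b; split=> //; apply: IHn.
Qed.

(** By Nakayama's lemma at [Q], stationarity puts a symbolic power, hence [Q]
    itself, inside [Q1]. *)
Lemma symbolic_power_stationary N : sub_ideal (S N) (S N.+1) -> sub_ideal Q Q1.
Proof.
move=> sSN; have iQ1 := prime_ideal pQ1; have iQ := prime_ideal pQ.
have sSQ1 : sub_ideal (S N) Q1.
  have [t [g [Sg gen]]] := nR (symbolic_power_ideal N).
  have gQ1 : forall i, Q1 (g i).
    apply: (nakayama pQ iQ1) => [|i]; first exact: prime_saturated.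
    have [s [nQs [y Q1y Qy]]] := sSN _ (Sg i).
    pose C x := exists a : 'I_t -> R, (forall j, Q (a j)) /\ x = \sum_j a j * g j.
    have [a [Qa aE]] : C (s * g i - y).
      apply: (ideal_gen_sub _ _ Qy) => [|_ [a [b [Qa Sb ->]]]].
        split.
        - exists (fun=> 0); split=> [_|]; first exact: ideal0.
          by rewrite big1 // => j _; rewrite mul0r.
        - move=> _ _ [a [Qa ->]] [b [Qb ->]]; exists (fun j => a j + b j).
          split=> [j|]; first exact: idealD.
          by rewrite -big_split; apply: eq_bigr => j _; rewrite mulrDl.
        move=> c _ [a [Qa ->]]; exists (fun j => c * a j).
        split=> [j|]; first exact: idealM.
        by rewrite mulr_sumr; apply: eq_bigr => j _; rewrite mulrA.
      have [c ->] := gen b Sb; exists (fun j => a * c j).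
      split=> [j|]; first exact: ideal_mulr.
      by rewrite mulr_sumr; apply: eq_bigr => j _; rewrite mulrA.
    by exists s, a; split=> //; rewrite -aE subKr.
  by move=> x /gen[a ->]; apply: ideal_sum => // i _; apply: idealM.
move=> q Qq; apply: contrapT => nQ1q.
suff: S 0%N 1 -> Q1 1 by move=> /(_ I); apply: prime1.
elim: N {sSN} sSQ1 => [|N IHN] sSQ1; first exact: sSQ1.
apply: IHN => x Sx; have Q1qx : Q1 (q * x).
  apply: sSQ1; apply: sub_saturation => //; exists 0; first exact: ideal0.
  by rewrite subr0; apply: mem_ideal_gen; exists q, x.
by case: (primeM pQ1 Q1qx).
Qed.
End SymbolicPower.

(** Krull's principal ideal theorem, relative to [Q1]: a prime that is minimal
    over [Q1 + (x)] has height at most one above [Q1]. *)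
Lemma principal_ideal_theorem P Q Q1 x :
    is_prime P -> is_prime Q -> is_prime Q1 -> sub_ideal Q1 Q -> sub_ideal Q P ->
    ~ sub_ideal P Q -> P x -> minimal_over P (adjoin Q1 x) ->
  sub_ideal Q Q1.
Proof.
move=> pP pQ pQ1 sQ1Q sQP nsPQ Px minP.
have iQ := prime_ideal pQ; have iP := prime_ideal pP; have iQ1 := prime_ideal pQ1.
have nQx : ~ Q x.
  by move=> Qx; apply: nsPQ; apply: (minP Q) => //; apply: (adjoin_min iQ).
pose S := symbolic_power Q1 Q.
have iS n : is_ideal (S n) by apply: symbolic_power_ideal.
have satS n : saturated Q (S n) by apply: symbolic_power_saturated.
have [N /(_ N.+1 (leqnSn _)) NP] : stationary (fun n => saturation P (adjoin (S n) x)).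
  apply: (@stationary_above_minimal P (saturation P (adjoin Q1 x))) => //.
  - exact/saturation_ideal/adjoin_ideal.
  - exact: saturation_saturated.
  - move=> P' pP' sP' sP'P; apply: minP => // z Q1z; apply: sP'.
    exact: sub_saturation.
  - by move=> n; apply/saturation_ideal/adjoin_ideal.
  - by move=> n; apply: saturation_saturated.
  - by move=> n; apply/saturation_mono/adjoin_mono/symbolic_power_base.
  by move=> n; apply/saturation_mono/adjoin_mono/symbolic_power_descending.
apply: (symbolic_power_stationary pQ1 pQ sQ1Q (N := N)).
have [t [g [Sg gen]]] := nR (iS N).
(* At [P], the ideals [S N] and [S N.+1] coincide modulo [x]. *)
have satSP : saturated P (S N.+1) by move=> s r nPs; apply: satS => /sQP.
have Sg1 : forall i, S N.+1 (g i).
  apply: (nakayama pP (iS _) satSP) => i.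
  have [|s [nPs [c Ssc]]] := NP (g i).
    by apply: sub_saturation => //; apply: sub_adjoin.
  have [|a cE] := gen c.
    apply: (satS N x) => //; rewrite mulrC; apply: (ideal_sub_l (iS N) (x := s * g i)).
      exact: symbolic_power_descending Ssc.
    by apply: idealM.
  exists s, (fun j => a j * x); split=> // [j|]; first exact: idealM.
  move: Ssc; rewrite cE mulr_suml; congr (S _ (_ - _)).
  by apply: eq_bigr => j _; ring.
move=> r /gen[a ->]; apply: (ideal_sum _ (iS N.+1)) => // i _.
exact: (idealM (iS N.+1)).
Qed.

Definition chain e (C : nat -> R -> Prop) :=
  (forall i, (i <= e)%N -> is_prime (C i)) /\
  (forall i, (i < e)%N -> sub_ideal (C i) (C i.+1) /\ ~ sub_ideal (C i.+1) (C i)).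

(** Krull's height theorem. Let [Q] be maximal among the primes that lie between
    the last but one member of the chain and [P] and differ from [P]. Some
    generator [y] is outside [Q], so [P] is minimal over [Q + (y)], and the
    other generators have, up to multipliers, powers of the form [a y + b] with
    [b] in [Q]. By the principal ideal theorem [Q] is minimal over the [b]. *)
Theorem height_theorem (ys : seq R) P e C :
    is_prime P -> (forall y, y \in ys -> P y) ->
    minimal_over P (fun x => x \in ys) ->
    chain e C -> sub_ideal (C e) P ->
  (e <= size ys)%N.
Proof.
elim: {ys}(size ys) {-2}ys (erefl (size ys)) P e C => [|r IHr] ys sz_ys P [|e] C //.
  move/size0nil: sz_ys => -> pP _ minP [pC sC] sCP.
  have [sC01 nsC10] := sC 0%N isT.
  have sC1P : sub_ideal (C 1%N) P.
    have : forall i, (i <= e)%N -> sub_ideal (C (e.+1 - i)%N) P.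
      elim=> [|i IHi] lti x; first by rewrite subn0; apply: sCP.
      rewrite subSS => Cx; apply: IHi (ltnW lti) _ _; rewrite subSn ?(ltnW lti) //.
      by apply: (sC _ _).1 Cx; rewrite ltnS leq_subr.
    by move=> /(_ e (leqnn e)); rewrite subSn // subnn.
  case: nsC10 => x /sC1P; apply: minP => //; first exact: pC.
  by move=> z /sC01/sC1P.
move=> pP Pys minP [pC sC] sCP; rewrite sz_ys ltnS.
have [sCe nsCe] := sC e (leqnn _).
pose F Q := [/\ is_prime Q, sub_ideal (C e) Q, sub_ideal Q P & ~ sub_ideal P Q].
have [||Q [[pQ sCQ sQP nsPQ] maxQ]] := @exists_max_ideal R nR F (C e).
- by move=> I [/prime_ideal].
- split=> //; [exact: pC | by move=> x /sCe/sCP | move=> sPC].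
  by apply: nsCe => x /sCP/sPC.
have iQ := prime_ideal pQ.
have [y ys_y nQy] : exists2 y, y \in ys & ~ Q y.
  apply: contrapT => noy; apply: nsPQ; apply: (minP Q) => // x ys_x.
  by apply: contrapT => nQx; apply: noy; exists x.
have minPQ : minimal_over P (adjoin Q y).
  move=> P' pP' sQP' sP'P; apply: contrapT => nsPP'.
  apply/nQy/(maxQ P'); last by apply/sQP'/mem_adjoin.
    split=> // x; first by move=> /sCQ/sub_adjoin-/(_ y)/sQP'.
  by move=> x /sub_adjoin-/(_ y)/sQP'.
have /choice[b bP] : forall z, exists bz, z \in ys ->
    Q bz /\ exists s n, ~ P s /\ adjoin (eq bz) y (s * z ^+ n).
  move=> z.
  have [ys_z|] := boolP (z \in ys); last by exists 0.
  (* Otherwise a prime between [Q + (y)] and [P] would avoid the powers of [z]. *)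
  pose T w := exists s n, ~ P s /\ w = s * z ^+ n.
  have [|nT] := pselect (exists2 w, T w & adjoin Q y w).
    move=> [_ [s [n [nPs ->]]] [c Qb]]; exists (s * z ^+ n - c * y) => _.
    by split=> //; exists s, n; split=> //; exists c.
  have [||||P' [pP' sP' nTP']] := @exists_prime_avoiding R nR (adjoin Q y) T.
  - exact: adjoin_ideal.
  - by exists 1, 0%N; rewrite mul1r; split; first exact: prime1.
  - move=> _ _ [s [n [nPs ->]]] [s' [n' [nPs' ->]]]; exists (s * s'), (n + n')%N.
    by split; [case/(primeM pP) | rewrite exprD mulrACA].
  - by move=> w Tw Qw; apply: nT; exists w.
  case: (nTP' z); first by exists 1, 1%N; rewrite mul1r; split; first exact: prime1.
  apply: (minPQ P') => // [w P'w|]; last exact: Pys.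
  by apply: contrapT => nPw; apply: (nTP' w) => //; exists w, 0%N; rewrite mulr1.
have sz_bs : size (map b (rem y ys)) = r by rewrite size_map size_rem // sz_ys.
rewrite -sz_bs; apply: (IHr _ sz_bs Q e C) => //.
- by move=> _ /mapP[z /mem_rem/bP[Qb _] ->].
- move=> Q' pQ' sbQ' sQ'Q; have iQ' := prime_ideal pQ'.
  apply: (principal_ideal_theorem pP pQ pQ' sQ'Q sQP nsPQ (Pys y ys_y)).
  move=> P' pP' sQ'P' sP'P; have iP' := prime_ideal pP'.
  have P'y : P' y by apply/sQ'P'/mem_adjoin/prime_ideal.
  apply: minP => // z ys_z; have [->//|nzy] := eqVneq z y.
  have [_ [s [n [nPs [c bE]]]]] := bP z ys_z.
  have P'szn : P' (s * z ^+ n).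
    apply: (ideal_subr iP' (y := c * y)); last exact: idealM.
    rewrite -bE; apply: sQ'P'; apply: sub_adjoin; apply: sbQ'.
    by apply: map_f; move: ys_z; rewrite (perm_mem (perm_to_rem ys_y)) inE (negPf nzy).
  by case/(primeM pP'): P'szn => [/sP'P//|/(primeX pP')].
by split=> i lti; [apply: pC; apply: leqW | apply: sC; apply: leqW].
Qed.

(** In [R/I] the element [r] is [x ^ n] times some [r_n], for each [n]. Once the
    annihilators of the powers of [x] have stabilized to [I'], the ideals
    generated by [r_n] over [I'] increase; where they stop, [r_(n+1)] is a
    multiple of [x r_(n+1)] modulo [I'], hence lies in [I']. *)
Lemma krull_intersection_principal I x :
    is_ideal I -> (forall c, exists d, d * (1 - c * x) = 1) ->
  forall r, (forall n, adjoin I (x ^+ n) r) -> I r.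
Proof.
move=> iI unit1 r /choice[a Ia].
pose A n z := I (x ^+ n * z).
have iA n : is_ideal (A n).
  split; rewrite /A; first by rewrite mulr0; apply: ideal0.
    by move=> u v; rewrite mulrDr; apply: idealD.
  by move=> c u; rewrite mulrCA; apply: idealM.
have [|t tP] := ideal_acc nR iA.
  by move=> n z Az; rewrite /A exprS -mulrA; apply: idealM.
have step n : A t (a (t + n)%N - x * a (t + n.+1)%N).
  apply: (tP (t + n)%N); rewrite /A addnS.
  have -> : x ^+ (t + n) * (a (t + n)%N - x * a (t + n).+1) =
     (r - a (t + n).+1 * x ^+ (t + n).+1) - (r - a (t + n)%N * x ^+ (t + n)).
    by rewrite exprS; ring.
  by apply: ideal_sub.
have [| |N NP] := @ideal_acc R nR (fun n => adjoin (A t) (a (t + n)%N)).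
- by move=> n; apply: adjoin_ideal.
- move=> n; apply: adjoin_min; [exact: adjoin_ideal | exact: sub_adjoin |].
  by exists x; apply: step.
have [c Ac] := NP N.+1 _ (mem_adjoin _ (iA t)).
set a1 := a (t + N.+1)%N in Ac *.
have Aa1 : A t ((1 - c * x) * a1).
  have -> : (1 - c * x) * a1 = (a1 - c * a (t + N)%N) + c * (a (t + N)%N - x * a1).
    by ring.
  by apply: (idealD (iA t)) => //; apply: (idealM (iA t)); apply: step.
have [d dE] := unit1 c.
have {}Aa1 : A t a1 by rewrite -[a1]mul1r -dE -mulrA; apply: (idealM (iA t)).
apply: (ideal_subr iI (Ia (t + N.+1)%N)); rewrite mulrC exprD -mulrA mulrCA.
exact: idealM.
Qed.

End Height.

(** * Hilbert's basis theorem and localization *)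

Section HilbertBasis.
Variable R : comNzRingType.
Hypothesis nR : noetherian R.
Local Notation A := {poly R}.

Definition span_seq (l : seq A) (p : A) :=
  exists a : nat -> A, p = \sum_(i < size l) a i * l`_i.

(** If [I] is not finitely generated, pick successively polynomials of least
    degree outside the ideal of the previous ones. Some leading coefficient is
    a combination of the earlier ones, and cancelling it lowers the degree. *)
Theorem hilbert_basis : noetherian A.
Proof.
move=> I iI; apply: contrapT => nfg.
have ex l : exists p, (forall q, q \in l -> I q) ->
    [/\ I p, ~ span_seq l p &
        forall q, I q -> ~ span_seq l q -> (size p <= size q)%N].
  have [lI|] := pselect (forall q, q \in l -> I q); last by exists 0.
  pose B n := `[< exists q, [/\ I q, ~ span_seq l q & size q = n] >].
  have exB : exists n, B n.
    apply: contrapT => nB; apply: nfg.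
    exists (size l), (fun i : 'I_(size l) => l`_i); split=> [i|r Ir].
      by apply: lI; apply: mem_nth.
    apply: contrapT => nr; apply: nB; exists (size r); apply/asboolP.
    by exists r; split=> // -[a rE]; apply: nr; exists (fun i => a i).
  case: (ex_minnP exB) => m /asboolP[p [Ip np sz_p]] min_m; exists p => _.
  split=> // q Iq nq; rewrite sz_p; apply: min_m; apply/asboolP.
  by exists q.
have [next nextP] := choice ex.
pose L n := iter n (fun l => rcons l (next l)) [::]; pose f n := next (L n).
have sz_L n : size (L n) = n by elim: n => //= n IHn; rewrite size_rcons IHn.
have nth_L n i : (i < n)%N -> (L n)`_i = f i.
  elim: n => // n IHn; rewrite ltnS leq_eqVlt /= nth_rcons sz_L.
  by case/predU1P=> [->|lti]; rewrite ?ltnn ?eqxx // lti; apply: IHn.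
have IL n q : q \in L n -> I q.
  elim: n q => // n IHn q; rewrite /= mem_rcons inE => /predU1P[->|/IHn//].
  by have [] := nextP _ IHn.
have If n : I (f n) by have [] := nextP _ (@IL n).
have nf n : ~ span_seq (L n) (f n) by have [] := nextP _ (@IL n).
have minf n q : I q -> ~ span_seq (L n) q -> (size (f n) <= size q)%N.
  by have [_ _] := nextP _ (@IL n); apply.
have spanL n p : span_seq (L n) p <-> exists a : nat -> A, p = \sum_(i < n) a i * f i.
  rewrite /span_seq sz_L; split=> -[a ->]; exists a; apply: eq_bigr => i _.
    by rewrite nth_L.
  by rewrite nth_L.
have span0 n : span_seq (L n) 0.
  by apply/spanL; exists (fun=> 0); rewrite big1 // => i _; rewrite mul0r.
have spanD n p q : span_seq (L n) p -> span_seq (L n) q -> span_seq (L n) (p + q).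
  move=> /spanL[a ->] /spanL[b ->]; apply/spanL; exists (fun i => a i + b i).
  by rewrite -big_split; apply: eq_bigr => i _; rewrite mulrDl.
have f_neq0 n : f n != 0 by apply/eqP => f0; apply: (nf n); rewrite f0.
have sz_f i N : (i < N)%N -> (size (f i) <= size (f N))%N.
  move=> ltiN; apply: minf => // /spanL[a fE]; apply: (nf N); apply/spanL.
  exists (fun j => if (j < i)%N then a j else 0); rewrite fE.
  rewrite (big_ord_widen N (fun j => a j * f j) (ltnW ltiN)) big_mkcond.
  by apply: eq_bigr => j _; case: ifP => // _; rewrite mul0r.
pose LC n r := exists c : nat -> R, r = \sum_(i < n) c i * lead_coef (f i).
have [||N NP] := @ideal_acc R nR LC.
- move=> n; split.
  + by exists (fun=> 0); rewrite big1 // => i _; rewrite mul0r.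
  + move=> _ _ [a ->] [b ->]; exists (fun i => a i + b i).
    by rewrite -big_split; apply: eq_bigr => i _; rewrite mulrDl.
  move=> c _ [a ->]; exists (fun i => c * a i).
  by rewrite mulr_sumr; apply: eq_bigr => i _; rewrite mulrA.
- move=> n _ [a ->]; exists (fun j => if (j < n)%N then a j else 0).
  rewrite big_ord_recr /= ltnn mul0r addr0.
  by apply: eq_bigr => j _; rewrite ltn_ord.
have [|c lcE] := NP N.+1 (lead_coef (f N)).
  exists (fun j => (j == N)%:R); rewrite big_ord_recr /= eqxx mul1r big1 ?add0r //.
  by move=> j _; rewrite ltn_eqF ?mul0r.
pose h := \sum_(i < N) (c i *: 'X^(size (f N) - size (f i))) * f i.
have Ih : I h by apply: ideal_sum => // i _; apply: idealM.
have spanh : span_seq (L N) h.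
  by apply/spanL; exists (fun i => c i *: 'X^(size (f N) - size (f i))).
have nspan : ~ span_seq (L N) (f N - h).
  by move=> /spanD/(_ spanh); rewrite subrK; apply: nf.
have := minf N _ (ideal_sub iI (If N) Ih) nspan; apply/negP; rewrite -ltnNge.
have sz_gt0 : (0 < size (f N))%N by rewrite size_poly_gt0.
rewrite -(prednK sz_gt0) ltnS; apply/leq_sizeP => j lej.
rewrite coefB coef_sum; have [ejN|] := eqVneq j (size (f N)).-1; last first.
  move=> nej; have ltj : (size (f N) <= j)%N.
    by rewrite -(prednK sz_gt0) ltn_neqAle eq_sym nej.
  rewrite nth_default // sub0r big1 ?oppr0 // => i _.
  rewrite -scalerAl coefZ coefXnM; case: ifP => [_|_]; first by rewrite mulr0.
  rewrite nth_default ?mulr0 //.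
  by rewrite leq_subRL ?subnK ?(leq_trans (leq_subr _ _) ltj) ?sz_f.
apply/eqP; rewrite subr_eq0 ejN -lead_coefE lcE; apply/eqP/eq_bigr => i _.
rewrite -scalerAl coefZ coefXnM; congr (_ * _).
have sz_fi : (0 < size (f i))%N by rewrite size_poly_gt0.
have szi := sz_f i N (ltn_ord i).
have -> : ((size (f N)).-1 < size (f N) - size (f i))%N = false.
  by apply/negbTE; rewrite -leqNgt -subn1 leq_sub2l.
by rewrite lead_coefE; congr (_`_ _); rewrite -!subn1 subnAC subKn.
Qed.
End HilbertBasis.

Section Transfer.

Lemma noetherian_surj (R S : comNzRingType) (phi : {rmorphism R -> S}) :
  (forall y, exists x, phi x = y) -> noetherian R -> noetherian S.
Proof.
move=> surj nR I iI.
have iJ : is_ideal (fun x => I (phi x)).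
  split; first by rewrite rmorph0; apply: ideal0.
    by move=> x y; rewrite rmorphD; apply: idealD.
  by move=> a x; rewrite rmorphM; apply: idealM.
have [t [g [Ig gen]]] := nR _ iJ; exists t, (phi \o g); split=> // r.
have [x <-] := surj r => /gen[a ->]; exists (phi \o a).
by rewrite rmorph_sum; apply: eq_bigr => i _; rewrite rmorphM.
Qed.

Lemma noetherian_field (k : fieldType) : noetherian k.
Proof.
move=> I iI; have [[x [Ix nx0]]|I0] := pselect (exists x, I x /\ x != 0).
  exists 1%N, (fun=> x); split=> // r _; exists (fun=> r / x).
  by rewrite big_ord1 divfK.
exists 0%N, (fun=> 0); split=> [[]//|r Ir]; exists (fun=> 0).
rewrite big_ord0; apply/eqP; apply: contrapT => /negP nr0.
by apply: I0; exists r.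
Qed.

Lemma noetherian_mpoly (k : fieldType) n : noetherian {mpoly k[n]}.
Proof.
elim: n => [|n IHn].
  apply: (@noetherian_surj k _ (@mpolyC 0 k)) (@noetherian_field k).
  by move=> p; exists p@_0; apply: mpolyKC.
pose phi : {rmorphism {poly {mpoly k[n]}} -> {mpoly k[n.+1]}} :=
  horner_eval ('X_ord_max) \o map_poly (@mwiden n k).
apply: (@noetherian_surj _ _ phi) (hilbert_basis IHn) => p.
elim/mpolyind: p => [|c m p _ _ [q <-]]; first by exists 0; rewrite rmorph0.
have [r rE] : exists r, phi r = 'X_[m].
  have exX i : exists r, phi r = 'X_i.
    have [j ->|->] := unliftP ord_max i; last first.
      by exists 'X; rewrite /phi /= /horner_eval map_polyX hornerX.
    exists ('X_j)%:P; rewrite /phi /= /horner_eval map_polyC hornerC /=.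
    rewrite mwidenX mnmwiden1; congr 'X_[U_(_)].
    by apply: val_inj; rewrite /= /bump leqNgt ltn_ord.
  have [r rE] := choice exX; exists (\prod_i r i ^+ m i).
  rewrite rmorph_prod mpolyXE_id; apply: eq_bigr => i _.
  by rewrite rmorphXn rE.
exists (c%:MP%:P * r + q); rewrite rmorphD rmorphM rE; congr (_ + _).
by rewrite /phi /= /horner_eval map_polyC hornerC /= mwidenC mul_mpolyC.
Qed.

Lemma noetherian_quot (R : comNzRingType) (I : idealr R) :
  noetherian R -> noetherian {ideal_quot I}.
Proof.
by apply: (noetherian_surj (phi := qproj I)) => y; have [x ->] := qprojP y; exists x.
Qed.

Section Loc.
Variables (A : idomainType) (L : prime_idealr A).

Lemma loc_in_unit b : b \notin L -> exists v, v * loc_in L b = 1.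
Proof.
move=> bL.
have vP : (FracField.tofrac 1 / FracField.tofrac b) \in loc_pred L.
  by apply/asboolP; exists 1, b.
exists (Loc vP); apply: val_inj.
by rewrite /= rmorph1 div1r mulVf // (notin_prime_neq0 bL).
Qed.

Lemma loc_local (x : loc L) : x \notin loc_ideal L -> exists v, v * x = 1.
Proof.
have [a [b [bL bxE ->]]] := loc_valM_in x => /loc_in_unit[v vE].
by exists (v * loc_in L b); rewrite -mulrA bxE.
Qed.

(** An ideal of the localization is generated by its contraction. *)
Lemma noetherian_loc : noetherian A -> noetherian (loc L).
Proof.
move=> nA I iI.
have iJ : is_ideal (fun a => I (loc_in L a)).
  split; first by rewrite rmorph0; apply: ideal0.
    by move=> x y; rewrite rmorphD; apply: idealD.
  by move=> a x; rewrite rmorphM; apply: idealM.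
have [t [g [Ig gen]]] := nA _ iJ.
exists t, (fun i => loc_in L (g i)); split=> // x Ix.
have [a [b [bL bxE _]]] := loc_valM_in x; have [v vE] := loc_in_unit bL.
have [|c aE] := gen a; first by rewrite -bxE; apply: idealM.
exists (fun i => v * loc_in L (c i)).
rewrite -[x]mul1r -vE -mulrA bxE aE rmorph_sum mulr_sumr.
by apply: eq_bigr => i _; rewrite rmorphM mulrA.
Qed.
End Loc.
End Transfer.

(** * Lexicographic independence in a local ring *)

Section LocalRing.
Variables (R : comNzRingType) (m : R -> Prop).
Hypotheses (nR : noetherian R) (pm : is_prime m).
Hypothesis local_m : forall r, ~ m r -> exists v, v * r = 1.
Implicit Types (I P : R -> Prop) (xs : seq R).

Let im : is_ideal m := prime_ideal pm.

Definition zero_ideal : R -> Prop := fun r => r = 0.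

Lemma zero_ideal_ideal : is_ideal zero_ideal.
Proof.
by split=> [|x y -> ->|a x ->]; rewrite /zero_ideal ?addr0 ?mulr0.
Qed.

Lemma sub_unit x c : m x -> exists d, d * (1 - c * x) = 1.
Proof.
move=> mx; apply: local_m => m1; apply: (prime1 pm).
by apply: (ideal_subr im m1); apply: idealM.
Qed.

Lemma prime_sub_local P : is_prime P -> sub_ideal P m.
Proof.
move=> pP r Pr; apply: contrapT => /local_m[v vE].
by apply: (prime1 pP); rewrite -vE; apply: (idealM (prime_ideal pP)).
Qed.

Lemma foldl_adjoin_ideal I xs : is_ideal I -> is_ideal (foldl (@adjoin R) I xs).
Proof. by elim: xs I => //= x xs IHxs I iI; apply/IHxs/adjoin_ideal. Qed.

Lemma foldl_adjoin_min I xs P :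
    is_ideal P -> sub_ideal I P -> (forall x, x \in xs -> P x) ->
  sub_ideal (foldl (@adjoin R) I xs) P.
Proof.
move=> iP; elim: xs I => //= x xs IHxs I sIP Pxs.
apply: IHxs => [|y xs_y]; last by apply: Pxs; rewrite inE xs_y orbT.
by apply: adjoin_min => //; apply: Pxs; rewrite mem_head.
Qed.

(** Written out, the element is a unit times a monomial in [xs] plus a combination
    of lexicographically larger monomials. Such expressions characterize the Krull
    dimension in the work of Coquand and Lombardi. *)
Fixpoint has_leading_monomial xs r :=
  if xs is x :: xs' then
    exists a r' c, has_leading_monomial xs' r' /\ r = x ^+ a * (r' + c * x)
  else ~ m r.

Definition lex_independent I xs := forall r, I r -> ~ has_leading_monomial xs r.

Lemma has_leading_monomial1 xs : has_leading_monomial xs 1.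
Proof.
elim: xs => [|x xs IHxs]; first exact: prime1.
by exists 0%N, 1, 0; rewrite mul0r addr0 mulr1.
Qed.

Lemma has_leading_monomialM xs r s :
  has_leading_monomial xs r -> has_leading_monomial xs s ->
  has_leading_monomial xs (r * s).
Proof.
elim: xs r s => [|x xs IHxs] r s /=; first by move=> nr ns /(primeM pm)[].
move=> [a [r' [c [lr' ->]]]] [b [s' [d [ls' ->]]]].
exists (a + b)%N, (r' * s'), (r' * d + c * s' + c * d * x).
by split; [exact: IHxs | rewrite exprD; ring].
Qed.

(** Divide by the highest possible power of the first generator, which exists
    by Krull's intersection theorem, and go on modulo this generator. *)
Lemma leading_monomial_exists xs I r :
    is_ideal I -> (forall x, x \in xs -> m x) ->
    sub_ideal m (foldl (@adjoin R) I xs) -> ~ I r ->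
  exists r', I (r - r') /\ has_leading_monomial xs r'.
Proof.
elim: xs I r => [|x xs IHxs] I r iI mxs /= smI nIr.
  exists r; rewrite subrr; split; first exact: ideal0.
  by move=> /smI.
have mx : m x by apply: mxs; rewrite mem_head.
pose B n := `[< ~ adjoin I (x ^+ n) r >].
have exB : exists n, B n.
  apply: contrapT => nB; apply: nIr.
  apply: (krull_intersection_principal nR iI (x := x)) => [c|n].
    exact: sub_unit.
  by apply: contrapT => nIn; apply: nB; exists n; apply/asboolP.
case: (ex_minnP exB) => -[|a] /asboolP nIa min_a.
  by case: nIa; exists r; rewrite mulr1 subrr; apply: ideal0.
have [c Ic] : adjoin I (x ^+ a) r.
  apply: contrapT => nI; have := min_a a; rewrite ltnn => H.
  by have : false by apply: H; apply/asboolP.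
have nIc : ~ adjoin I x c.
  move=> [d Id]; apply: nIa; exists d.
  have -> : r - d * x ^+ a.+1 = (r - c * x ^+ a) + x ^+ a * (c - d * x).
    by rewrite exprS; ring.
  by apply: idealD => //; apply: idealM.
have [| | |r' [[e Ie] lr']] := IHxs (adjoin I x) c _ _ _ nIc.
- exact: adjoin_ideal.
- by move=> z xs_z; apply: mxs; rewrite inE xs_z orbT.
- exact: smI.
exists (x ^+ a * (r' + e * x)); split; last by exists a, r', e.
have -> : r - x ^+ a * (r' + e * x) =
    (r - c * x ^+ a) + x ^+ a * (c - r' - e * x) by ring.
by apply: idealD => //; apply: idealM.
Qed.

Lemma lex_independent_adjoin I x xs :
  lex_independent I (x :: xs) -> lex_independent (adjoin I x) xs.
Proof.
move=> ind r [c Ic] lr; apply: (ind _ Ic); exists 0%N, r, (- c).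
by rewrite mul1r mulNr.
Qed.

Lemma lex_independent_notin I x xs : lex_independent I (x :: xs) -> ~ I x.
Proof.
move=> ind Ix; apply: (ind _ Ix); exists 1%N, 1, 0.
by rewrite mul0r addr0 mulr1; split=> //; apply: has_leading_monomial1.
Qed.

(** Elements outside [I] have leading monomials modulo [I], and leading
    monomials multiply. *)
Lemma lex_independent_prime I xs :
    is_ideal I -> (forall x, x \in xs -> m x) ->
    sub_ideal m (foldl (@adjoin R) I xs) -> lex_independent I xs ->
  is_prime I.
Proof.
move=> iI mxs smI ind; split=> //.
  by move=> /ind; apply; apply: has_leading_monomial1.
move=> a b Iab; have [|nIa] := pselect (I a); [by left|right].
apply: contrapT => nIb.
have [a' [Ia' la']] := leading_monomial_exists iI mxs smI nIa.
have [b' [Ib' lb']] := leading_monomial_exists iI mxs smI nIb.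
apply: (ind (a' * b')); last exact: has_leading_monomialM.
have -> : a' * b' = a * b - (b * (a - a') + a' * (b - b')) by ring.
by apply: ideal_sub => //; apply: idealD => //; apply: idealM.
Qed.

Lemma chain_of_lex_independent I xs :
    is_ideal I -> (forall x, x \in xs -> m x) ->
    sub_ideal m (foldl (@adjoin R) I xs) -> lex_independent I xs ->
  exists C, chain (size xs) C /\ C 0%N = I.
Proof.
elim: xs I => [|x xs IHxs] I iI mxs smI ind;
  have pI := lex_independent_prime iI mxs smI ind.
  by exists (fun=> I); split.
have [| | | |C [[pC sC] C0]] := IHxs (adjoin I x).
- exact: adjoin_ideal.
- by move=> z xs_z; apply: mxs; rewrite inE xs_z orbT.
- exact: smI.
- exact: lex_independent_adjoin.
exists (fun i => if i is i'.+1 then C i' else I); split=> //; split.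
  by case=> // i; rewrite ltnS => lei; apply: pC.
case=> [_|i lti]; last exact: sC.
rewrite C0; split; first exact: sub_adjoin.
by move=> /(_ x (mem_adjoin _ iI)); apply: lex_independent_notin ind.
Qed.

Lemma ideal_congrX I x y n : is_ideal I -> I (x - y) -> I (x ^+ n - y ^+ n).
Proof. by move=> iI Ixy; rewrite subrXX; apply: ideal_mulr. Qed.

(** The elements [ys] identify every generator with a power of the last one, [t],
    with exponents so large that the leading monomial of [r] becomes the lowest
    power of [t] in [r]. *)
Lemma leading_monomial_power x xs r :
    (forall z, z \in x :: xs -> m z) -> has_leading_monomial (x :: xs) r ->
  exists ys W, [/\ size ys = size xs, forall y, y \in ys -> m y &
    forall P, is_ideal P -> (forall y, y \in ys -> P y) ->
      (exists2 u, ~ m u & P (r - last x xs ^+ W * u)) /\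
      (P (last x xs) -> forall z, z \in x :: xs -> P z)].
Proof.
elim: xs x r => [|x2 xs IHxs] x r mxs [a [r' [c [lr' ->]]]].
  exists [::], a; split=> // P iP _; split; last by move=> Px z; rewrite inE => /eqP->.
  exists (r' + c * x); last by rewrite subrr; apply: ideal0.
  move=> mr; apply: lr'; rewrite -(addrK (c * x) r'); apply: ideal_sub => //.
  by apply: idealM => //; apply: mxs; rewrite mem_head.
have mxs2 z : z \in x2 :: xs -> m z by move=> xs_z; apply: mxs; rewrite inE xs_z orbT.
have [ys [W [sz_ys mys ysP]]] := IHxs x2 r' mxs2 lr'.
set t := last x2 xs in ysP *; have mt : m t by apply/mxs2/mem_last.
(* The exponent [W.+1] makes [c * x] a multiple of [t ^+ W.+1], hence of higher
   order than [r'], which is a unit times [t ^+ W]. *)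
exists (x - t ^+ W.+1 :: ys), (W.+1 * a + W)%N; split=> [|y|P iP Pys].
- by rewrite /= sz_ys.
- rewrite inE => /predU1P[->|/mys//]; apply: ideal_sub => //.
    by apply: mxs; rewrite mem_head.
  by rewrite exprS; apply: ideal_mulr.
have Px : P (x - t ^+ W.+1) by apply: Pys; rewrite mem_head.
have [|[u nmu Pu] Pt] := ysP P iP.
  by move=> y ys_y; apply: Pys; rewrite inE ys_y orbT.
split=> [|{}/Pt Pt z].
  exists (u + c * t).
    move=> mu; apply: nmu; rewrite -(addrK (c * t) u).
    by apply: ideal_sub => //; apply: idealM.
  have -> : x ^+ a * (r' + c * x) - last x (x2 :: xs) ^+ (W.+1 * a + W) * (u + c * t) =
      (r' + c * x) * (x ^+ a - (t ^+ W.+1) ^+ a) +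
      (t ^+ W.+1) ^+ a * ((r' - t ^+ W * u) + c * (x - t ^+ W.+1)).
    rewrite -exprM exprD [t ^+ W.+1 in RHS]exprS /=; rewrite -/t; ring.
  apply: idealD => //; apply: idealM => //; first exact: ideal_congrX.
  by apply: idealD => //; apply: idealM.
rewrite inE => /predU1P[->|/Pt//]; apply: (ideal_subr iP Px).
by rewrite exprS; apply: ideal_mulr => //; apply: Pt; apply: mem_last.
Qed.

Lemma chain_leq_generators xs e (C : nat -> R -> Prop) :
    (forall x, x \in xs -> m x) -> sub_ideal m (foldl (@adjoin R) zero_ideal xs) ->
  chain e C -> (e <= size xs)%N.
Proof.
move=> mxs smI chC; apply: (height_theorem nR pm mxs _ chC).
  move=> P pP Pxs _ z /smI; apply: foldl_adjoin_min => //; first exact: prime_ideal.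
  by move=> _ ->; apply: (ideal0 (prime_ideal pP)).
by apply: prime_sub_local; apply: chC.1.
Qed.

(** A combination of the generators with a leading monomial that vanished would
    make the maximal ideal minimal over one element fewer. *)
Lemma lex_independent_of_chain xs (C : nat -> R -> Prop) :
    (forall x, x \in xs -> m x) -> sub_ideal m (foldl (@adjoin R) zero_ideal xs) ->
    chain (size xs) C -> lex_independent zero_ideal xs.
Proof.
case: xs => [|x xs] mxs smI chC r -> l0; first by apply: l0; apply: ideal0.
have [ys [W [sz_ys mys ysP]]] := leading_monomial_power mxs l0.
suff: (size (x :: xs) <= size ys)%N by rewrite sz_ys ltnn.
apply: (height_theorem nR pm mys _ chC); last first.
  by apply: prime_sub_local; apply: chC.1.
move=> P pP Pys sPm; have iP := prime_ideal pP.
have [[u nmu Pu] Pt] := ysP P iP Pys.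
have {}Pu : P (last x xs ^+ W * u).
  by rewrite -[_ * u]opprK; apply: ideal_opp => //; rewrite -sub0r.
case/(primeM pP): Pu => [/(primeX pP)/Pt Pxs|/sPm//] z /smI.
by apply: foldl_adjoin_min => // _ ->; apply: ideal0.
Qed.

End LocalRing.

(** * Forms and quasi-regular sequences *)

Lemma mcoeff_pihomog (R : nzRingType) d e (p : {mpoly R[d]}) a :
  (pihomog mdeg e p)@_a = if mdeg a == e then p@_a else 0.
Proof.
elim/mpolyind: p => [|c b p _ _ IHp]; first by rewrite pihomog0 mcoeff0 if_same.
rewrite linearP /= pihomogX !mcoeffD !mcoeffZ IHp.
case: eqP => eb; last first.
  rewrite mcoeff0 mulr0 add0r mcoeffX; case: eqP => // ea.
  by case: eqP eb => [->|]; rewrite ?ea // mulr0 add0r.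
by rewrite mcoeffX; case: eqP => [<-|_]; case: eqP => //; rewrite mulr0 add0r.
Qed.

Lemma pihomog_map_mpoly (R S : nzRingType) (phi : {additive R -> S}) d e
    (p : {mpoly R[d]}) :
  pihomog mdeg e (map_mpoly phi p) = map_mpoly phi (pihomog mdeg e p).
Proof.
apply/mpolyP => b; rewrite mcoeff_pihomog !mcoeff_map_mpoly mcoeff_pihomog.
by case: ifP => // _; rewrite raddf0.
Qed.

Lemma linear_formE (R : nzRingType) d (F : {mpoly R[d]}) :
  F \is 1.-homog -> F = \sum_i F@_U_(i) *: 'X_i.
Proof.
move=> hF; apply/mpolyP => b; rewrite raddf_sum /=.
have [/eqP/mdeg1P[j /eqP->]|nb] := eqVneq (mdeg b) 1%N.
  rewrite (bigD1 j) //= mcoeffZ mcoeffXU eqxx mulr1 big1 ?addr0 // => i nij.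
  by rewrite mcoeffZ mcoeffXU (negPf nij) mulr0.
rewrite (dhomog_nemf_coeff hF nb) big1 // => i _.
rewrite mcoeffZ mcoeffX; case: eqP => [E|_]; last by rewrite mulr0.
by rewrite -E mdeg1 in nb.
Qed.

Section Forms.
Variables (R : comNzRingType) (d : nat) (z : 'I_d -> R).
Implicit Types (F G H p : {mpoly R[d]}) (I : R -> Prop).

Definition is_form i n F := forall a, F@_a != 0 ->
  mdeg a = n /\ forall j : 'I_d, (i <= j)%N -> a j = 0%N.

Lemma form0 i n : is_form i n 0.
Proof. by move=> a; rewrite mcoeff0 eqxx. Qed.

Lemma formD i n F G : is_form i n F -> is_form i n G -> is_form i n (F + G).
Proof.
move=> fF fG a; rewrite mcoeffD; have [->|/fF//] := eqVneq (F@_a) 0.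
by rewrite add0r => /fG.
Qed.

Lemma formZ i n c F : is_form i n F -> is_form i n (c *: F).
Proof.
by move=> fF a; rewrite mcoeffZ; have [->|/fF//] := eqVneq F@_a 0; rewrite mulr0 eqxx.
Qed.

Lemma form_sum i n (T : Type) (r : seq T) (P : pred T) (F : T -> {mpoly R[d]}) :
  (forall x, P x -> is_form i n (F x)) -> is_form i n (\sum_(x <- r | P x) F x).
Proof.
move=> fF; elim/big_rec: _ => [|x G Px fG]; first exact: form0.
by apply: formD => //; apply: fF.
Qed.

Lemma formX i n a : mdeg a = n -> (forall j : 'I_d, (i <= j)%N -> a j = 0%N) ->
  is_form i n 'X_[a].
Proof.
move=> da za b; rewrite mcoeffX; have [<- _|_] := eqVneq a b; first by [].
by rewrite eqxx.
Qed.

Lemma formM i n n' F G : is_form i n F -> is_form i n' G -> is_form i (n + n') (F * G).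
Proof.
move=> fF fG a; rewrite -mcoeff_msupp => /msuppM_le/allpairsP[[b c] /=].
rewrite !mcoeff_msupp => -[/fF[<- zb] /fG[<- zc] ->].
by rewrite mdegD; split=> // j lej; rewrite mnmDE zb ?zc.
Qed.

Lemma form_leq i i' n F : (i <= i')%N -> is_form i n F -> is_form i' n F.
Proof. by move=> le fF a /fF[da za]; split=> // j /(leq_trans le)/za. Qed.

(** This is the [n]-th power of the ideal of the first [i] elements. *)
Definition form_value i n r := exists2 F, is_form i n F & F.@[z] = r.
Local Notation V := form_value.

Lemma form_value_ideal i n : is_ideal (V i n).
Proof.
split; first by exists 0; [exact: form0 | rewrite meval0].
  move=> _ _ [F fF <-] [G fG <-]; exists (F + G); last exact: mevalD.
  exact: formD.
by move=> c _ [F fF <-]; exists (c *: F); [exact: formZ | rewrite mevalZ].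
Qed.

Lemma form_valueM i n n' r s : V i n r -> V i n' s -> V i (n + n') (r * s).
Proof.
move=> [F fF <-] [G fG <-]; exists (F * G); first exact: formM.
by rewrite mevalM.
Qed.

Lemma form_value_leq i i' n r : (i <= i')%N -> V i n r -> V i' n r.
Proof. by move=> le [F fF <-]; exists F => //; apply: form_leq fF. Qed.

Lemma form_value_var i (j : 'I_d) : (j < i)%N -> V i 1 (z j).
Proof.
move=> lt; exists 'X_j; last by rewrite mevalXU.
apply: formX => [|j' le]; first exact: mdeg1.
by rewrite mnm1E; case: eqP => // ejj; move: le; rewrite -ejj leqNgt lt.
Qed.

Lemma form_value_0 i r : V i 0 r.
Proof.
exists (r%:MP); last by rewrite mevalC.
move=> a; rewrite mcoeffC; have [->|] := eqVneq a 0%MM; last by rewrite mulr0 eqxx.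
by rewrite mdeg0; split=> // j _; rewrite mnm0E.
Qed.

Lemma form_value_sub i n I :
    is_ideal I ->
    (forall a, mdeg a = n -> (forall j : 'I_d, (i <= j)%N -> a j = 0%N) ->
       I ('X_[a]).@[z]) ->
  sub_ideal (V i n) I.
Proof.
move=> iI IX _ [F fF <-]; rewrite (mpolyE F) raddf_sum /= big_seq.
apply: ideal_sum => // a; rewrite mcoeff_msupp => /fF[da za].
by rewrite mevalZ; apply: idealM => //; apply: IX.
Qed.

Lemma form_value1_min i I :
  is_ideal I -> (forall j : 'I_d, (j < i)%N -> I (z j)) -> sub_ideal (V i 1) I.
Proof.
move=> iI Iz; apply: form_value_sub => // a /eqP/mdeg1P[j /eqP->] za.
rewrite mevalXU; apply: Iz; rewrite ltnNge; apply/negP => /za.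
by rewrite mnm1E eqxx.
Qed.

Lemma form_value0_eq0 n r : V 0 n.+1 r -> r = 0.
Proof.
apply: (form_value_sub (@zero_ideal_ideal R)) => a da za.
by move: da; rewrite mdegE big1 // => j _; apply: za.
Qed.

Definition coefs_in I F := forall a, I F@_a.

Definition coefs_value i n r :=
  exists F, [/\ is_form i n F, coefs_in (V i 1) F & F.@[z] = r].

Lemma coefs_value_ideal i n : is_ideal (coefs_value i n).
Proof.
have iV := form_value_ideal i 1; split.
- exists 0; split; [exact: form0 | | exact: meval0].
  by move=> a; rewrite mcoeff0; apply: ideal0.
- move=> _ _ [F [fF cF <-]] [G [fG cG <-]]; exists (F + G).
  split; [exact: formD | | exact: mevalD].
  by move=> a; rewrite mcoeffD; apply: idealD.
move=> c _ [F [fF cF <-]]; exists (c *: F); split; [exact: formZ | | exact: mevalZ].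
by move=> a; rewrite mcoeffZ; apply: idealM.
Qed.

(** Pulling a variable out of each monomial turns a form of degree [n + 1] into
    a form of degree [n] with coefficients in the ideal of the variables. *)
Lemma form_valueSE i n r : V i n.+1 r <-> coefs_value i n r.
Proof.
split.
  apply: form_value_sub (coefs_value_ideal i n) _ _ => a da za.
  have [j aj] : exists j, a j != 0%N.
    apply: contrapT => a0; move: da; rewrite mdegE big1 // => j _.
    by have [//|aj] := eqVneq (a j) 0%N; case: a0; exists j.
  have ltj : (j < i)%N by rewrite ltnNge; apply: contraNN aj => /za->.
  have leU : (U_(j) <= a)%MM.
    by apply/mnm_lepP => j'; rewrite mnm1E; case: eqP => // <-; rewrite lt0n.
  exists (z j *: 'X_[a - U_(j)]); split.
  - apply/formZ/formX.
      by apply/eqP; rewrite -(eqn_add2r (mdeg U_(j))) -mdegD submK // da mdeg1 addn1.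
    by move=> j' /za; rewrite mnmBE => ->.
  - move=> b; rewrite mcoeffZ; apply: ideal_mulr (form_value_ideal i 1) _.
    exact: form_value_var.
  by rewrite -{2}(submK leU) mpolyXD mevalZ mevalM mevalXU mulrC.
move=> [F [fF cF <-]]; rewrite (mpolyE F) raddf_sum /= big_seq.
apply: ideal_sum (form_value_ideal i n.+1) _ => a.
rewrite mcoeff_msupp mevalZ => /fF[da za]; rewrite -add1n.
by apply: form_valueM => //; exists 'X_[a] => //; apply: formX.
Qed.

Lemma form_valueS i n r : V i n.+1 r -> V i n r.
Proof. by move=> /form_valueSE[F [fF _ <-]]; exists F. Qed.

Definition quasi_regular_below i :=
  forall n F, is_form i n F -> V i n.+1 F.@[z] -> coefs_in (V i 1) F.

Lemma quasi_regular_below0 : quasi_regular_below 0.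
Proof.
move=> n F fF /form_value0_eq0 F0 a; have [->|/fF[_ za]] := eqVneq F@_a 0.
  exact: (ideal0 (form_value_ideal 0 1)).
have a0 : a = 0%MM by apply/mnmP => j; rewrite za // mnm0E.
have FE : F = (F@_0%MM)%:MP.
  apply/mpolyP => b; rewrite mcoeffC; have [->|nb] := eqVneq b 0%MM.
    by rewrite mulr1.
  rewrite mulr0; apply/eqP; apply: contraNT nb => /fF[_ zb].
  by apply/eqP/mnmP => j; rewrite zb // mnm0E.
rewrite a0; move: F0; rewrite FE mevalC mcoeffC eqxx mulr1 => ->.
exact: (ideal0 (form_value_ideal 0 1)).
Qed.

(** An element regular modulo the ideal of a quasi-regular family is regular
    modulo the powers of this ideal. *)
Lemma regular_mod_power i x :
    quasi_regular_below i -> (forall a, V i 1 (x * a) -> V i 1 a) ->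
  forall n a, V i n (x * a) -> V i n a.
Proof.
move=> qr reg; elim=> [|n IHn] a Vxa; first exact: form_value_0.
have [F fF FE] := IHn a (form_valueS Vxa).
have cF : coefs_in (V i 1) F.
  have := qr n (x *: F) (formZ (c := x) fF); rewrite mevalZ FE => /(_ Vxa) cxF b.
  by apply: reg; rewrite -mcoeffZ.
by apply/form_valueSE; exists F.
Qed.

Lemma coefs_in_mulX I (j : 'I_d) F :
  is_ideal I -> coefs_in I F -> coefs_in I ('X_j * F).
Proof.
move=> iI cF a; rewrite (mpolyE F) mulr_sumr raddf_sum /=.
by apply: ideal_sum => // b _; rewrite -scalerAr mcoeffZ; apply: ideal_mulr.
Qed.

Lemma form_split (i : 'I_d) n F : is_form i.+1 n.+1 F ->
  exists G H, [/\ is_form i n.+1 G, is_form i.+1 n H & F = G + 'X_i * H].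
Proof.
move=> fF.
exists (\sum_(a <- msupp F | a i == 0%N) F@_a *: 'X_[a]).
exists (\sum_(a <- msupp F | a i != 0%N) F@_a *: 'X_[a - U_(i)]); split.
- rewrite big_seq_cond; apply: form_sum => a; rewrite mcoeff_msupp.
  move=> /andP[/fF[da za] /eqP ai]; apply/formZ/formX => // j.
  by rewrite leq_eqVlt => /predU1P[/val_inj<-//|/za].
- rewrite big_seq_cond; apply: form_sum => a; rewrite mcoeff_msupp.
  move=> /andP[/fF[da za] ai]; apply/formZ/formX; last first.
    by move=> j /za; rewrite mnmBE => ->.
  have leU : (U_(i) <= a)%MM.
    by apply/mnm_lepP => j; rewrite mnm1E; case: eqP => // <-; rewrite lt0n.
  by apply/eqP; rewrite -(eqn_add2r (mdeg U_(i))) -mdegD submK // da mdeg1 addn1.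
rewrite {1}(mpolyE F) (bigID (fun a : 'X_{1..d} => a i == 0%N)) /=; congr (_ + _).
rewrite mulr_sumr; apply: eq_bigr => a ai; rewrite -scalerAr -mpolyXD addmC submK //.
by apply/mnm_lepP => j; rewrite mnm1E; case: eqP => // <-; rewrite lt0n.
Qed.

(** If the form [G + X_i H] vanishes, where [X_i] does not occur in [G], then
    [z_i H(z)] is the value of a form in the first [i] variables, and so is
    [H(z)] by regularity, say of [h]. Hence the induction on the degree applies
    to [H], and quasi-regularity of the first [i] elements to [G + z_i h]. *)
Lemma quasi_regular_belowS (i : 'I_d) :
    quasi_regular_below i -> (forall a, V i 1 (z i * a) -> V i 1 a) ->
  quasi_regular_below i.+1.
Proof.
move=> qr reg; have iV n := form_value_ideal i.+1 n.
have sV a : V i 1 a -> V i.+1 1 a by apply: form_value_leq.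
(* Values in the next power can be rewritten with coefficients in the ideal. *)
suff qr0 n F : is_form i.+1 n F -> F.@[z] = 0 -> coefs_in (V i.+1 1) F.
  move=> n F fF /form_valueSE[F' [fF' cF' FE]] a.
  rewrite -(subrK F' F) mcoeffD; apply: idealD => //; apply: qr0 (n) _ _ _ _.
    by rewrite -scaleN1r; apply: formD => //; apply: formZ.
  by rewrite mevalB FE subrr.
elim: n F => [|n IHn] F fF F0 a.
  have [->|/fF[/eqP]] := eqVneq F@_a 0; first exact: (ideal0 (iV _)).
  rewrite mdeg_eq0 => /eqP -> _.
  have FE : F = (F@_0%MM)%:MP.
    apply/mpolyP => b; rewrite mcoeffC; have [->|nb] := eqVneq b 0%MM.
      by rewrite mulr1.
    rewrite mulr0; apply/eqP; apply: contraNT nb => /fF[/eqP].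
    by rewrite mdeg_eq0.
  move: F0; rewrite FE mevalC mcoeffC eqxx mulr1 => ->; exact: (ideal0 (iV _)).
have [G [H [fG fH FE]]] := form_split fF.
have VH : V i n.+1 H.@[z].
  apply: (regular_mod_power qr reg); exists (- G).
    by rewrite -scaleN1r; apply: formZ.
  apply/eqP; rewrite mevalN eq_sym -subr_eq0 opprK -[z i]mevalXU -mevalM -mevalD.
  by rewrite addrC -FE F0.
have cH : coefs_in (V i.+1 1) H.
  have [h fh hE] := VH.
  have /form_valueSE[H' [fH' cH' HE]] : V i.+1 n.+1 H.@[z].
    exact: form_value_leq VH.
  move=> b; rewrite -(subrK H' H) mcoeffD; apply: idealD => //.
  apply: IHn; last by rewrite mevalB HE subrr.
  by rewrite -scaleN1r; apply: formD => //; apply: formZ.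
have [h fh hE] := VH.
have cGh : coefs_in (V i 1) (G + z i *: h).
  apply: (qr n.+1); first by apply: formD => //; apply: formZ.
  rewrite mevalD mevalZ hE -[z i]mevalXU -mevalM -mevalD -FE F0.
  exact: (ideal0 (form_value_ideal _ _)).
rewrite FE mcoeffD; apply: idealD => //; last exact: coefs_in_mulX.
rewrite -[G](addrK (z i *: h)) mcoeffB; apply: ideal_sub => //.
  exact/sV/cGh.
by rewrite mcoeffZ; apply: ideal_mulr => //; apply: form_value_var.
Qed.

End Forms.

(** * Quasi-regularity and lexicographic independence *)

Lemma idealr_is_prime (R : comNzRingType) (P : prime_idealr R) :
  is_prime (fun r => r \in P).
Proof.
split=> [||a b]; last by rewrite prime_idealrM => /orP.
  split=> [|x y Px Py|a x Px]; [exact: idealr0 | exact: rpredD | exact: idealMr].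
by rewrite idealr1.
Qed.

Section QuasiRegular.
Variables (R : comNzRingType) (m : maximal_idealr R).
Hypotheses (nR : noetherian R).
Hypothesis local_m : forall r, r \notin m -> exists v, v * r = 1.
Variables (d : nat) (z : 'I_d -> R).
Hypothesis z_gen : forall r, r \in m <-> form_value z d 1 r.
Implicit Types (I P : R -> Prop).
Local Notation V := (form_value z).
Local Notation zs := (codom z).
Local Notation mP := (fun r => r \in m).

Local Notation pm := (idealr_is_prime m).
Let im : is_ideal mP := prime_ideal pm.

Lemma local_mP r : ~ mP r -> exists v, v * r = 1.
Proof. by move=> /negP; apply: local_m. Qed.

Lemma mem_gen_max i : z i \in m.
Proof. by apply/z_gen; apply: form_value_var. Qed.

Lemma ideal_exp_prod (T : Type) (s : seq T) (g : T -> R) (e : T -> nat) :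
  (forall t, g t \in ideal_exp m (e t)) ->
  \prod_(t <- s) g t \in ideal_exp m (\sum_(t <- s) e t).
Proof.
move=> mg; elim: s => [|t s IHs]; first by rewrite !big_nil ideal_exp0.
by rewrite !big_cons ideal_expM.
Qed.

Lemma ideal_expX x n : x \in m -> x ^+ n \in ideal_exp m n.
Proof.
move=> mx; elim: n => [|n IHn]; first exact: ideal_exp0.
by rewrite exprS -add1n ideal_expM // ideal_exp1.
Qed.

Lemma monomial_value_exp a : ('X_[a]).@[z] \in ideal_exp m (mdeg a).
Proof.
rewrite mevalX mdegE; apply: ideal_exp_prod => i.
exact/ideal_expX/mem_gen_max.
Qed.

Lemma ideal_expE n r : r \in ideal_exp m n <-> V d n r.
Proof.
split.
  apply: ideal_gen_sub (form_value_ideal z d n) _ _ => _ [g [mg ->]].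
  suff: V d (\sum_(i < n) 1)%N (\prod_(i < n) g i) by rewrite sum1_card card_ord.
  apply: (big_ind2 (fun e x => V d e x)) => [|x1 n1 x2 n2|i _].
  - exact: form_value_0.
  - exact: form_valueM.
  exact/z_gen.
apply: (form_value_sub (I := fun r => r \in ideal_exp m n)) => [|a <- _]; last first.
  exact: monomial_value_exp.
exact: ideal_gen_ideal.
Qed.

Lemma ideal_expW n : {subset ideal_exp m n.+1 <= ideal_exp m n}.
Proof. by move=> r /ideal_expE/form_valueS/ideal_expE. Qed.

Definition quasi_regular := forall n (F : {mpoly R[d]}),
  F \is n.-homog -> F.@[z] \in ideal_exp m n.+1 -> forall a, F@_a \in m.

Lemma form_homog n (F : {mpoly R[d]}) : is_form d n F <-> F \is n.-homog.
Proof.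
split=> [fF|/dhomogP hF a]; first by apply/dhomogP => a; rewrite mcoeff_msupp => /fF[].
rewrite -mcoeff_msupp => /hF; split=> // j.
by rewrite leqNgt ltn_ord.
Qed.

Lemma quasi_regularE : quasi_regular <-> quasi_regular_below z d.
Proof.
split=> qr n F /form_homog hF.
  by move=> /ideal_expE /(qr n F hF) mF a; apply/z_gen/mF.
by move=> /ideal_expE /(qr n F hF) mF a; apply/z_gen/mF.
Qed.

Lemma sub_foldl_adjoin I xs : is_ideal I -> sub_ideal I (foldl (@adjoin R) I xs).
Proof.
elim: xs I => [|x xs IHxs] I iI r Ir //=; apply: IHxs; first exact: adjoin_ideal.
exact: sub_adjoin.
Qed.

Lemma mem_foldl_adjoin I xs x :
  is_ideal I -> x \in xs -> foldl (@adjoin R) I xs x.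
Proof.
elim: xs I => //= y xs IHxs I iI; rewrite inE => /predU1P[->|xs_x].
  by apply: sub_foldl_adjoin; [exact: adjoin_ideal | exact: mem_adjoin].
by apply: IHxs => //; apply: adjoin_ideal.
Qed.

Lemma lex_independentW I I' xs : sub_ideal I I' ->
  lex_independent mP I' xs -> lex_independent mP I xs.
Proof. by move=> sI ind r /sI; apply: ind. Qed.

Lemma nth_codom (i : 'I_d) x0 : nth x0 zs i = z i.
Proof. by rewrite (nth_map i) ?size_enum_ord // nth_ord_enum. Qed.

Lemma drop_codom (i : 'I_d) : drop i zs = z i :: drop i.+1 zs.
Proof. by rewrite (drop_nth 0) ?size_codom ?card_ord // nth_codom. Qed.

Lemma lex_independent_drop i : lex_independent mP (@zero_ideal R) zs ->
  (i <= d)%N -> lex_independent mP (V i 1) (drop i zs).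
Proof.
move=> ind; elim: i => [_|i IHi lti].
  by rewrite drop0; apply: lex_independentW ind => r /form_value0_eq0.
have := IHi (ltnW lti); rewrite (drop_codom (Ordinal lti)).
move=> /lex_independent_adjoin; apply: lex_independentW.
have iV := form_value_ideal z i 1.
apply: form_value1_min => [|j]; first exact: adjoin_ideal.
rewrite ltnS leq_eqVlt => /predU1P[eji|ltj].
  by rewrite (_ : Ordinal lti = j); [exact: mem_adjoin | exact: val_inj].
exact/sub_adjoin/form_value_var.
Qed.

Lemma gen_sub_foldl i :
  sub_ideal mP (foldl (@adjoin R) (V i 1) (drop i zs)).
Proof.
have iV := form_value_ideal z i 1.
move=> r /z_gen; apply: form_value1_min => [|j _]; first exact: foldl_adjoin_ideal.
have [ltj|lej] := ltnP j i.
  by apply: sub_foldl_adjoin => //; apply: form_value_var.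
apply: mem_foldl_adjoin => //; rewrite -(nth_codom j 0) -(subnKC lej) -nth_drop.
apply: mem_nth; rewrite size_drop size_codom card_ord ltn_sub2r //.
exact: leq_ltn_trans lej _.
Qed.

Lemma mem_drop_max i x : x \in drop i zs -> x \in m.
Proof. by move=> /mem_drop/codomP[j ->]; apply: mem_gen_max. Qed.

(** The ideals of the first generators are prime, so that each generator is
    regular modulo the previous ones. *)
Lemma lex_independent_quasi_regular :
  lex_independent mP (@zero_ideal R) zs -> quasi_regular.
Proof.
move=> ind; apply/quasi_regularE.
suff: forall i, (i <= d)%N -> quasi_regular_below z i by apply.
elim=> [_|i IHi lti]; first exact: quasi_regular_below0.
have ind_i := lex_independent_drop ind (ltnW lti).
apply: (quasi_regular_belowS (i := Ordinal lti)) (IHi (ltnW lti)) _ => a /=.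
have pV : is_prime (V i 1).
  apply: (lex_independent_prime nR pm local_mP _ _ _ ind_i).
  - exact: form_value_ideal.
  - exact: mem_drop_max.
  exact: gen_sub_foldl.
case/(primeM pV) => // Vz.
by move: ind_i; rewrite (drop_codom (Ordinal lti)) => /(lex_independent_notin pm).
Qed.

(** The strict lexicographic order. The inequality in the second disjunct amounts
    to an equality, because of the first one; in this form it is evident that
    the monomials above a given one are stable under multiplication. *)
Fixpoint lex_lt (js : seq 'I_d) (a b : 'X_{1..d}) :=
  if js is j :: js' then (a j < b j)%N || (a j <= b j)%N && lex_lt js' a b
  else false.

Lemma lex_lt_irr js a : lex_lt js a a = false.
Proof. by elim: js => //= j js ->; rewrite ltnn andbF. Qed.

Lemma lex_lt_up js a (b b' : 'X_{1..d}) :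
  (forall j, b j <= b' j)%N -> lex_lt js a b -> lex_lt js a b'.
Proof.
move=> leb; elim: js => //= j js IHjs /orP[lt|/andP[le /IHjs ->]].
  by rewrite (leq_trans lt (leb j)).
by rewrite (leq_trans le (leb j)) orbT.
Qed.

Lemma lex_lt_eq js (a a' b b' : 'X_{1..d}) :
  {in js, a =1 a'} -> {in js, b =1 b'} -> lex_lt js a b = lex_lt js a' b'.
Proof.
elim: js => //= j js IHjs ea eb; rewrite ea ?eb ?mem_head //; congr (_ || _ && _).
by apply: IHjs => i js_i; [apply: ea | apply: eb]; rewrite inE js_i orbT.
Qed.

Definition supported (M : pred 'X_{1..d}) n (p : {mpoly R[d]}) :=
  forall b, p@_b != 0 -> M b /\ (n <= mdeg b)%N.

Lemma supported0 M n : supported M n 0.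
Proof. by move=> b; rewrite mcoeff0 eqxx. Qed.

Lemma supportedD M n p q : supported M n p -> supported M n q -> supported M n (p + q).
Proof.
move=> sp sq b; rewrite mcoeffD; have [->|/sp//] := eqVneq p@_b 0.
by rewrite add0r => /sq.
Qed.

Lemma supportedZ M n c p : supported M n p -> supported M n (c *: p).
Proof.
by move=> sp b; rewrite mcoeffZ; have [->|/sp//] := eqVneq p@_b 0; rewrite mulr0 eqxx.
Qed.

Lemma supportedX (M : pred 'X_{1..d}) n b :
  M b -> (n <= mdeg b)%N -> supported M n 'X_[b].
Proof.
move=> Mb le b'; rewrite mcoeffX; have [<- _|_] := eqVneq b b'; first by [].
by rewrite eqxx.
Qed.

Definition supported_value M n r := exists2 p, supported M n p & p.@[z] = r.

Lemma supported_value_ideal M n : is_ideal (supported_value M n).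
Proof.
split; first by exists 0; [exact: supported0 | rewrite meval0].
  move=> _ _ [p sp <-] [q sq <-]; exists (p + q); last exact: mevalD.
  exact: supportedD.
by move=> c _ [p sp <-]; exists (c *: p); [exact: supportedZ | rewrite mevalZ].
Qed.

Lemma supported_value_exp M n p : supported M n p -> p.@[z] \in ideal_exp m n.
Proof.
move=> sp; rewrite (mpolyE p) raddf_sum /= big_seq; apply: rpred_sum => b.
rewrite mcoeff_msupp mevalZ => /sp[_ le]; apply: ideal_genMl.
have := monomial_value_exp b; elim: (mdeg b) le => [|e IHe].
  by rewrite leqn0 => /eqP->.
by rewrite leq_eqVlt ltnS => /predU1P[->//|le] /ideal_expW; apply: IHe.
Qed.

(** By quasi-regularity the lowest form of an element of high order has
    coefficients in [m], which can be expanded in the generators without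
    leaving a set of exponents that is closed upwards. *)
Lemma supported_value_order (M : pred 'X_{1..d}) n p :
    quasi_regular ->
    (forall b b' : 'X_{1..d}, (forall j, b j <= b' j)%N -> M b -> M b') ->
    supported M 0 p -> p.@[z] \in ideal_exp m n ->
  supported_value M n p.@[z].
Proof.
move=> qr upM sp; elim: n => [_|n IHn mp]; first by exists p.
have [p1 sp1 pE] := IHn (ideal_expW mp); rewrite -pE in mp *.
pose q := p1 - pihomog mdeg n p1.
have sq : supported M n.+1 q.
  move=> b; rewrite mcoeffB mcoeff_pihomog; have [|ne] := eqVneq (mdeg b) n.
    by rewrite subrr eqxx.
  by rewrite subr0 => /sp1[Mb le]; rewrite ltn_neqAle eq_sym ne.
have mh : (pihomog mdeg n p1).@[z] \in ideal_exp m n.+1.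
  have := rpredB mp (supported_value_exp sq).
  by rewrite -mevalB /q opprB addrC subrK.
have hom : pihomog mdeg n p1 \is n.-homog.
  apply/dhomogP => b; rewrite mcoeff_msupp mcoeff_pihomog.
  by case: (mdeg b =P n) => //; rewrite eqxx.
have cm := qr n _ hom mh.
have iT := supported_value_ideal M n.+1.
rewrite -(subrK (pihomog mdeg n p1) p1) mevalD; apply: (idealD iT); first by exists q.
rewrite (mpolyE (pihomog mdeg n p1)) raddf_sum /= big_seq.
apply: (ideal_sum _ iT) => b supp_b; rewrite mevalZ.
have /dhomogP/(_ b supp_b) /= db := hom.
have [Mb _] : M b /\ (n <= mdeg b)%N.
  by apply: sp1; move: supp_b; rewrite mcoeff_msupp mcoeff_pihomog db eqxx.
have /z_gen := cm b; move: (mcoeff b _) => c; move: c.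
pose T c := supported_value M n.+1 (c * ('X_[b]).@[z]).
apply: (@form_value1_min _ _ _ _ T) => [|j _].
  split; rewrite /T; first by rewrite mul0r; apply: (ideal0 iT).
    by move=> x y Tx Ty; rewrite mulrDl; apply: (idealD iT).
  by move=> x y Ty; rewrite -mulrA; apply: (idealM iT).
exists 'X_[U_(j) + b]; last by rewrite mpolyXD mevalM mevalXU.
apply: supportedX; last by rewrite mdegD mdeg1 db.
by apply: upM Mb => i; rewrite mnmDE leq_addl.
Qed.

Lemma leading_monomial_mpoly (js : seq 'I_d) r : uniq js ->
    has_leading_monomial mP (map z js) r ->
  exists (a : 'X_{1..d}) p u, [/\ u \notin m, forall j, j \notin js -> a j = 0%N,
    forall b, p@_b != 0 -> lex_lt js a b & r = u * ('X_[a]).@[z] + p.@[z]].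
Proof.
elim: js r => [|j js IHjs] r /=.
  move=> _ /negP nr; exists 0%MM, 0, r; split=> // [j _|b|]; first by rewrite mnm0E.
    by rewrite mcoeff0 eqxx.
  by rewrite mpolyX0 meval1 mulr1 meval0 addr0.
move=> /andP[js_j u_js] [e [r' [c [lr' ->]]]].
have [a [p [u [nmu a0 pa ->]]]] := IHjs r' u_js lr'.
have aj : a j = 0%N by apply: a0.
exists (U_(j) *+ e + a)%MM, ('X_[U_(j) *+ e] * p + c *: 'X_[U_(j) *+ e.+1]), u.
have Uj i n : (U_(j) *+ n)%MM i = (if j == i then n else 0)%N.
  by rewrite mulmnE mnm1E; case: eqP; rewrite ?mul1n ?mul0n.
split=> // [i|b nz|].
- rewrite inE negb_or => /andP[nij js_i].
  by rewrite mnmDE Uj eq_sym (negPf nij) a0.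
- have [nz1|nz2] : ('X_[U_(j) *+ e] * p)@_b != 0 \/ 'X_[U_(j) *+ e.+1]@_b != 0 :> R.
  + have [E|] := eqVneq ('X_[U_(j) *+ e] * p)@_b 0; last by left.
    right; apply: contraNneq nz => E2.
    by rewrite mcoeffD E mcoeffZ E2 mulr0 addr0.
  + move: nz1; rewrite -mcoeff_msupp => /msuppM_le/allpairsP[[b1 b2] /=].
    rewrite !mcoeff_msupp => -[/= nzb1 nzb2 ->].
    have -> : b1 = (U_(j) *+ e)%MM.
      by move: nzb1; rewrite mcoeffX; case: (_ =P b1) => // _; rewrite mulr0n eqxx.
    rewrite !mnmDE !Uj eqxx aj addn0 leq_addr /=.
    rewrite (@lex_lt_eq _ _ a _ b2) ?pa ?orbT // => i js_i;
      rewrite mnmDE Uj; case: eqP => // E; by rewrite -E (negPf js_j) in js_i.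
  have <- : (U_(j) *+ e.+1)%MM = b.
    by move: nz2; rewrite mcoeffX; case: (_ =P b) => // _; rewrite mulr0n eqxx.
  by rewrite mnmDE !Uj eqxx aj addn0 ltnSn.
rewrite mpolyXD !(mevalM, mevalD, mevalZ).
have XU n : ('X_[U_(j) *+ n]).@[z] = z j ^+ n.
  rewrite mevalX (bigD1 j) //= Uj eqxx big1 ?mulr1 // => i nij.
  by rewrite Uj eq_sym (negPf nij).
by rewrite !XU exprS; ring.
Qed.

(** If [u * z ^ a + p(z)] vanishes, the other terms of [p] can be raised to degree
    at least that of [a] without meeting [a]; the form of this degree then has
    the unit coefficient [u]. *)
Lemma quasi_regular_lex_independent :
  quasi_regular -> lex_independent mP (@zero_ideal R) zs.
Proof.
move=> qr r -> /(@leading_monomial_mpoly (enum 'I_d) _ (enum_uniq _)).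
move=> [a [p [u [nmu _ pa E]]]]; pose M := lex_lt (enum 'I_d) a.
have mp : p.@[z] \in ideal_exp m (mdeg a).
  have -> : p.@[z] = - (u * ('X_[a]).@[z]) by apply/eqP; rewrite -addr_eq0 addrC -E.
  by rewrite rpredN ideal_genMl // monomial_value_exp.
have [||q sq qE] := @supported_value_order M (mdeg a) p qr _ _ mp.
- by move=> b b'; apply: lex_lt_up.
- by move=> b /pa.
pose F := pihomog mdeg (mdeg a) (u *: 'X_[a] + q).
have hom : F \is (mdeg a).-homog.
  apply/dhomogP => b; rewrite mcoeff_msupp mcoeff_pihomog.
  by case: (mdeg b =P mdeg a) => //; rewrite eqxx.
case/negP: nmu; have := qr _ F hom _ a.
rewrite mcoeff_pihomog eqxx mcoeffD mcoeffZ mcoeffX eqxx mulr1.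
have -> : q@_a = 0.
  by apply/eqP; apply/negP => /negP/sq[]; rewrite /M lex_lt_irr.
rewrite addr0; apply.
have -> : F.@[z] = - (u *: 'X_[a] + q - F).@[z].
  by rewrite mevalB [X in X - _]mevalD mevalZ qE -E sub0r opprK.
rewrite rpredN; apply: (@supported_value_exp predT) => b.
rewrite mcoeffB mcoeff_pihomog mcoeffD mcoeffZ mcoeffX.
have [->|ne] := eqVneq (mdeg b) (mdeg a); first by rewrite subrr eqxx.
rewrite subr0; case: (a =P b) ne => [->|_ ne]; first by rewrite eqxx.
by rewrite mulr0 add0r => /sq[_ le]; rewrite ltn_neqAle eq_sym ne.
Qed.

End QuasiRegular.

(** * Dimension and minimal generators *)

Section PrimePred.
Variables (R : comNzRingType) (P : R -> Prop).

Definition prime_pred of is_prime P : {pred R} := fun r => `[< P r >].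

Hypothesis pP : is_prime P.

Lemma prime_predE r : r \in prime_pred pP <-> P r.
Proof. by split=> [/asboolP|Pr]; last exact/asboolP. Qed.

Lemma prime_pred_idealr_closed : idealr_closed (prime_pred pP).
Proof.
have iP := prime_ideal pP; split.
- by apply/prime_predE; apply: ideal0.
- by apply/negP => /prime_predE; apply: prime1.
move=> a u v /prime_predE Pu /prime_predE Pv; apply/prime_predE.
by apply: (idealD iP) => //; apply: (idealM iP).
Qed.

Lemma prime_pred_prime_closed : prime_idealr_closed (prime_pred pP).
Proof.
move=> u v /prime_predE /(primeM pP)[] Pw; apply/orP; [left|right];
  exact/prime_predE.
Qed.

HB.instance Definition _ := isIdealr.Build R (prime_pred pP) prime_pred_idealr_closed.
HB.instance Definition _ :=
  isPrimeIdealrClosed.Build R (prime_pred pP) prime_pred_prime_closed.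
End PrimePred.

Lemma prime_chain_chain (R : comNzRingType) e (P : 'I_e.+1 -> prime_idealr R) :
  prime_chain P -> chain e (fun i r => r \in P (inord i)).
Proof.
move=> chP; split=> i lti; first exact: idealr_is_prime.
by apply: chP; rewrite !inordK // ltnS ltnW.
Qed.

Lemma chain_prime_chain (R : comNzRingType) e (C : nat -> R -> Prop) :
  chain e C -> exists P : 'I_e.+1 -> prime_idealr R, prime_chain P.
Proof.
move=> [pC sC]; have pC' (i : 'I_e.+1) : is_prime (C i) by apply: pC; rewrite -ltnS.
exists (fun i => prime_pred (pC' i) : prime_idealr R) => i j ltij.
have sub d k : (k + d <= e)%N -> sub_ideal (C k) (C (k + d)%N).
  elim: d => [|d IHd] le x; first by rewrite addn0.
  rewrite addnS in le *; move=> Cx; apply: (sC _ le).1; apply: IHd => //.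
  exact: ltnW.
have lej : (j <= e)%N by rewrite -ltnS.
have sij1 : sub_ideal (C i.+1) (C j).
  by rewrite -(subnKC ltij); apply: sub; rewrite subnKC.
have [sCi nsCi] := sC i (leq_trans ltij lej).
split=> [x /prime_predE Cx|sji]; first exact/prime_predE/sij1/sCi.
apply: nsCi => x /sij1 Cx; apply/prime_predE/sji; exact/prime_predE.
Qed.

Section Generators.
Variables (R : comNzRingType) (d : nat) (z : 'I_d -> R).

Lemma form_value1E r : form_value z d 1 r <-> exists c, r = \sum_i c i * z i.
Proof.
split=> [|[c ->]]; last first.
  apply: ideal_sum => [|i _]; first exact: form_value_ideal.
  by apply: idealM; [exact: form_value_ideal | exact: form_value_var].
pose I r := exists c : 'I_d -> R, r = \sum_i c i * z i.
apply: (form_value1_min (I := I)) => [|j _].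
  split; first by exists (fun=> 0); rewrite big1 // => i _; rewrite mul0r.
    move=> _ _ [a ->] [b ->]; exists (fun i => a i + b i).
    by rewrite -big_split; apply: eq_bigr => i _; rewrite mulrDl.
  move=> a _ [b ->]; exists (fun i => a * b i).
  by rewrite mulr_sumr; apply: eq_bigr => i _; rewrite mulrA.
exists (fun i => (i == j)%:R); rewrite (bigD1 j) //= eqxx mul1r big1 ?addr0 //.
by move=> i /negPf ->; rewrite mul0r.
Qed.

End Generators.

Section Krull.
Variables (R : comNzRingType) (m : maximal_idealr R).
Hypotheses (nR : noetherian R).
Hypothesis local_m : forall r, r \notin m -> exists v, v * r = 1.

Definition generates d (z : 'I_d -> R) :=
  forall r, r \in m <-> form_value z d 1 r.

Definition independent_mod_sq d (z : 'I_d -> R) :=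
  forall c, \sum_i c i * z i \in ideal_exp m 2 -> forall i, c i \in m.

(** The height theorem bounds the length of chains by the number of generators;
    a chain of length [d] is given by the ideals of the first generators. *)
Lemma quasi_regular_krull_dim d (z : 'I_d -> R) :
  generates z -> quasi_regular m z <-> has_krull_dim R d.
Proof.
move=> z_gen; have pm := idealr_is_prime m; have loc := local_mP local_m.
have sz_z : size (codom z) = d by rewrite size_codom card_ord.
have mz x : x \in codom z -> x \in m.
  by move=> /codomP[j ->]; apply: (mem_gen_max z_gen).
have smz : sub_ideal (fun r => r \in m) (foldl (@adjoin R) (@zero_ideal R) (codom z)).
  move=> r /z_gen; apply: form_value1_min => [|j _].
    exact/foldl_adjoin_ideal/zero_ideal_ideal.
  apply: mem_foldl_adjoin; first exact: zero_ideal_ideal.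
  exact: codom_f.
split=> [qr|[[P /prime_chain_chain chP] _]].
  have ind := quasi_regular_lex_independent z_gen qr.
  have [C [chC _]] :=
    chain_of_lex_independent nR pm loc (@zero_ideal_ideal R) mz smz ind.
  rewrite sz_z in chC; split=> [|e P /prime_chain_chain chP].
    exact: chain_prime_chain chC.
  by have := chain_leq_generators nR pm loc mz smz chP; rewrite sz_z.
apply: (lex_independent_quasi_regular nR local_m z_gen).
apply: (lex_independent_of_chain nR pm loc mz smz (C := fun i r => r \in P (inord i))).
by rewrite sz_z.
Qed.

Section Sq.
Variables (d : nat) (z : 'I_d -> R).
Hypothesis z_gen : generates z.

Lemma sqrE r : r \in ideal_exp m 2 ->
  exists a, (forall i, a i \in m) /\ r = \sum_i a i * z i.
Proof.
move=> /(ideal_expE z_gen)/form_valueSE[F [fF cF <-]].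
exists (fun i => F@_U_(i)); split=> [i|]; first exact/z_gen/cF.
rewrite {1}(linear_formE ((form_homog _ _).1 fF)) raddf_sum; apply: eq_bigr => i _.
by rewrite /= mevalZ mevalXU.
Qed.

(** The elements [s] outside [m] are units, so that the relations express the
    generators [z] by the [y] modulo [m] times the [z]. *)
Lemma nakayama_generates t (y : 'I_t -> R) :
    (forall j, y j \in m) ->
    (forall i, exists s a, [/\ s \notin m, forall j, a j \in m &
       form_value y t 1 (s * z i - \sum_j a j * z j)]) ->
  generates y.
Proof.
move=> my rel r; have iy := form_value_ideal y t 1.
have yz i : form_value y t 1 (z i).
  apply: (nakayama (idealr_is_prime m) iy) i => [s r' /negP /local_m[v vE] Is|i].
    by rewrite -[r']mul1r -vE -mulrA; apply: idealM.
  by have [s [a [/negP ns ma Ia]]] := rel i; exists s, a.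
split=> [/z_gen|].
  by apply: form_value1_min => // j _; apply: yz.
apply: (form_value1_min (I := fun r => r \in m)) => [|j _]; last exact: my.
exact: prime_ideal (idealr_is_prime m).
Qed.

Lemma generator_cot i : z i \in m. Proof. exact: (mem_gen_max z_gen). Qed.

Definition cot_gen i : cotangent m := cot_proj (IdealElt (generator_cot i)).

Lemma cot_sum (a : 'I_d -> R) (x : ideal_elt m) :
  ideal_val x = \sum_i a i * z i -> cot_proj x = \sum_i qproj m (a i) *: cot_gen i.
Proof.
move=> xE; pose y i := ideal_scale (a i) (IdealElt (generator_cot i)).
have -> : x = \sum_i y i.
  apply: val_inj; rewrite /= xE.
  by rewrite (big_morph (@ideal_val R m) (id1 := 0) (op1 := +%R)).
by rewrite raddf_sum; apply: eq_bigr => i _; symmetry; apply: cot_scaleE.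
Qed.

Lemma sum_mem_max (a : 'I_d -> R) : \sum_i a i * z i \in m.
Proof. by apply: rpred_sum => i _; apply: idealMr; apply: generator_cot. Qed.

Lemma independent_has_dim : independent_mod_sq z -> has_dim (cotangent m) d.
Proof.
move=> ind; pose f (v : 'rV[{ideal_quot m}]_d) := \sum_i v 0 i *: cot_gen i.
have f_lin : linear f.
  move=> a u v; rewrite /f scaler_sumr -big_split; apply: eq_bigr => i _.
  by rewrite !mxE scalerDl scalerA.
have f_inj u v : f u = f v -> u = v.
  move=> /eqP; rewrite -subr_eq0 => /eqP fuv0; apply/eqP; rewrite -subr_eq0.
  apply/eqP/matrixP => i0 i; rewrite ord1 !mxE {i0}.
  have [a aE] := choice (fun i => qprojP (u 0 i - v 0 i)).
  rewrite aE; apply/eqP; rewrite qproj_eq0.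
  apply: (ind a); rewrite -[_ \in _](cot_proj_eq0 (IdealElt (sum_mem_max a))).
  rewrite (cot_sum (a := a)) //; apply/eqP; rewrite -[RHS]fuv0 /f -sumrB.
  by apply: eq_bigr => j _; rewrite -scalerBl aE.
have f_surj w : exists v, f v = w.
  have [x ->] := cot_projP w; have /z_gen/form_value1E[a xE] := ideal_valP x.
  exists (\row_i qproj m (a i)); rewrite (cot_sum xE); apply: eq_bigr => i _.
  by rewrite mxE.
have [g fK] := choice f_surj; exists g; split.
  by move=> a u v; apply: f_inj; rewrite fK f_lin !fK.
by exists f => v //; apply: f_inj; rewrite fK.
Qed.
End Sq.

(** Lift a basis of the cotangent space; the lifts generate [m] by Nakayama's
    lemma. *)
Lemma has_dim_generators d : has_dim (cotangent m) d ->
  exists z : 'I_d -> R, generates z /\ independent_mod_sq z.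
Proof.
move=> [g [g_lin [f gK fK]]].
have [y yE] := choice (fun i => cot_projP (f (delta_mx 0 i))).
pose z i := ideal_val (y i); exists z.
have [t [x [mx x_gen]]] := nR (prime_ideal (idealr_is_prime m)).
have gen_x : generates x.
  move=> r; split=> [/x_gen[a ->]|/form_value1E[a ->]].
    by apply/form_value1E; exists a.
  by apply: rpred_sum => i _; apply/idealMr/mx.
pose gl : {linear cotangent m -> 'rV[{ideal_quot m}]_d} :=
  HB.pack g (GRing.isLinear.Build _ _ _ _ g g_lin).
have g_sum (c : 'I_d -> R) (w : ideal_elt m) : ideal_val w = \sum_i c i * z i ->
    g (cot_proj w) = \row_i qproj m (c i).
  move=> wE; have -> : w = \sum_i ideal_scale (c i) (y i).
    apply: val_inj; rewrite /= wE.
    by rewrite (big_morph (@ideal_val R m) (id1 := 0) (op1 := +%R)).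
  rewrite raddf_sum -[LHS]/(gl _) raddf_sum [RHS]row_sum_delta.
  apply: eq_bigr => i _.
  transitivity (gl (qproj m (c i) *: f (delta_mx 0 i))).
    by congr (gl _); rewrite yE; symmetry; apply: cot_scaleE.
  by rewrite linearZ /= fK mxE.
have mz i : z i \in m by apply: ideal_valP.
split; last first.
  move=> c c2 i.
  have mc : \sum_i c i * z i \in m by apply: rpred_sum => j _; apply/idealMr.
  have : g (cot_proj (IdealElt mc)) = \row_i qproj m (c i) by apply: g_sum.
  have /eqP -> : cot_proj (IdealElt mc) == 0 by rewrite cot_proj_eq0.
  rewrite [g 0](raddf0 gl).
  by move/rowP/(_ i); rewrite !mxE => /esym/eqP; rewrite qproj_eq0.
apply: (nakayama_generates gen_x) => // i.
have [c cE] := choice (fun j => qprojP (g (cot_proj (IdealElt (mx i))) 0 j)).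
have mc : \sum_i c i * z i \in m by apply: rpred_sum => j _; apply/idealMr.
have E : cot_proj (IdealElt (mx i)) = cot_proj (IdealElt mc).
  apply: (can_inj gK); rewrite (g_sum c (IdealElt mc)) //; apply/rowP => j.
  by rewrite mxE -cE.
have [|a [ma aE]] := sqrE gen_x (r := x i - \sum_i c i * z i).
  rewrite -[_ \in _](cot_proj_eq0 (IdealElt (mx i) - IdealElt mc)).
  by rewrite raddfB /= E subrr.
exists 1, a; split=> //; first by rewrite idealr1.
by rewrite -aE mul1r subKr; apply/form_value1E; exists c.
Qed.

(** A generating family of least size is independent modulo the square of the
    maximal ideal: a relation would make one generator superfluous. *)
Lemma exists_minimal_generators :
  exists d (z : 'I_d -> R), generates z /\ independent_mod_sq z.
Proof.
have [t [x [mx x_gen]]] := nR (prime_ideal (idealr_is_prime m)).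
pose B d := `[< exists z : 'I_d -> R, generates z >].
have exB : exists d, B d.
  exists t; apply/asboolP; exists x => r; split=> [/x_gen[a ->]|/form_value1E[a ->]].
    by apply/form_value1E; exists a.
  by apply: rpred_sum => i _; apply/idealMr/mx.
case: (ex_minnP exB) => d /asboolP[z z_gen] min_d; exists d, z; split=> // c c2 i0.
apply: contrapT => /negP nci0; case: d => [|d] in z z_gen min_d c c2 i0 nci0 *.
  by case: i0 nci0.
suff : B d by move/min_d; rewrite ltnn.
apply/asboolP; exists (fun j => z (lift i0 j)).
apply: (nakayama_generates z_gen) => [j|i]; first exact: generator_cot.
have iy := form_value_ideal (fun j => z (lift i0 j)) d 1.
have [->|ni] := eqVneq i i0; last first.
  exists 1, (fun=> 0); rewrite idealr1; split=> // [j|]; first exact: idealr0.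
  rewrite big1 => [|j _]; last by rewrite mul0r.
  have [j ->|eii0] := unliftP i0 i; last by rewrite eii0 eqxx in ni.
  by rewrite mul1r subr0; apply: (form_value_var (fun j => z (lift i0 j))).
have [a [ma aE]] := sqrE z_gen c2; exists (c i0), a; split=> //.
rewrite -aE (bigD1_ord i0) //= opprD addrA subrr sub0r.
apply: ideal_opp => //; apply: ideal_sum => // j _; apply: idealM => //.
exact: form_value_var.
Qed.

End Krull.

(** * The associated graded ring as a quotient of a polynomial ring *)

Section Order.
Variables (F : fieldType) (d : nat).
Implicit Types p q : {mpoly F[d]}.

Definition has_order n p := forall a, (mdeg a < n)%N -> p@_a = 0.

Lemma has_order0 n : has_order n 0.
Proof. by move=> a _; rewrite mcoeff0. Qed.

Lemma has_orderD n p q : has_order n p -> has_order n q -> has_order n (p + q).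
Proof. by move=> op oq a lt; rewrite mcoeffD op // oq // addr0. Qed.

Lemma has_orderZ n c p : has_order n p -> has_order n (c *: p).
Proof. by move=> op a lt; rewrite mcoeffZ op // mulr0. Qed.

Lemma has_order_leq n n' p : (n' <= n)%N -> has_order n p -> has_order n' p.
Proof. by move=> le op a lt; apply: op; apply: leq_trans le. Qed.

Lemma has_orderM n n' p q :
  has_order n p -> has_order n' q -> has_order (n + n') (p * q).
Proof.
move=> op oq a lt; apply/eqP; rewrite mcoeff_eq0; apply/negP.
move=> /msuppM_le/allpairsP[[b c] /= [pb qc aE]].
move: lt pb qc; rewrite aE mdegD !mcoeff_msupp.
have [ltb|leb] := ltnP (mdeg b) n; first by rewrite (op b) // eqxx.
have [ltc|lec] := ltnP (mdeg c) n'; first by rewrite (oq c) // eqxx.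
by rewrite ltnNge leq_add.
Qed.

Lemma has_orderX a : has_order (mdeg a) 'X_[a].
Proof. by move=> b lt; rewrite mcoeffX; case: eqP => // E; rewrite E ltnn in lt. Qed.

(** A substitution that fixes the variables to first order does not change
    lowest forms. *)
Lemma tangent_to_id_injective (chi : {rmorphism {mpoly F[d]} -> {mpoly F[d]}}) :
    (forall c, chi c%:MP = c%:MP) -> (forall i, has_order 2 (chi 'X_i - 'X_i)) ->
  forall p, chi p = 0 -> p = 0.
Proof.
move=> chiC chiX p chip0.
pose G n q := has_order n q /\ has_order n.+1 (chi q - q).
have GM n n' q q' : G n q -> G n' q' -> G (n + n')%N (q * q').
  move=> [oq cq] [oq' cq']; split; first exact: has_orderM.
  have -> : chi (q * q') - q * q' = (chi q - q) * chi q' + q * (chi q' - q').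
    by rewrite rmorphM; ring.
  apply: has_orderD; last by rewrite -addnS; apply: has_orderM.
  rewrite -addSn; apply: has_orderM => //.
  rewrite -(subrK q' (chi q')); apply: has_orderD => //.
  exact: has_order_leq cq'.
have G1 : G 0%N 1 by split=> //; rewrite rmorph1 subrr; apply: has_order0.
have GX a : G (mdeg a) 'X_[a].
  rewrite mpolyXE_id mdegE.
  apply: (big_ind2 G) => [|n1 q1 n2 q2|i _]; [exact: G1 | exact: GM |].
  elim: (a i) => [|n IHn]; first by rewrite expr0.
  rewrite exprS -add1n; apply: GM => //; split; last exact: chiX.
  by have := @has_orderX U_(i); rewrite mdeg1.
have step n : has_order n p -> has_order n.+1 (chi p - p).
  move=> op; rewrite {1 2}(mpolyE p) rmorph_sum -sumrB big_seq.
  elim/big_rec: _ => [|a q ap oq]; first exact: has_order0.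
  apply: has_orderD oq; rewrite -mul_mpolyC rmorphM chiC -mulrBr mul_mpolyC.
  apply: has_orderZ; apply: has_order_leq (GX a).2; rewrite ltnS leqNgt.
  by apply/negP => lt; move: ap; rewrite mcoeff_msupp op // eqxx.
have ord n : has_order n p.
  elim: n => [|n /step]; first by [].
  by rewrite chip0 sub0r => op a lt; apply/eqP; rewrite -oppr_eq0 -mcoeffN op.
by apply/mpolyP => a; rewrite mcoeff0; apply: (ord (mdeg a).+1).
Qed.

End Order.

Section Lambda.
Variables (R : comNzRingType) (m : maximal_idealr R).
Local Notation K := {ideal_quot m}.

Lemma rees_varP (a : R) : a \in m -> a *: 'X \in rees_pred m.
Proof.
move=> ma; apply/asboolP => i; rewrite coefZ coefX; case: eqP => [->|_].
  by rewrite mulr1 ideal_exp1.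
by rewrite mulr0 rpred0.
Qed.

Definition rees_var (a : R) (ma : a \in m) : rees m := Rees (rees_varP ma).

Variables (d : nat) (x : 'I_d -> R).
Hypothesis mx : forall i, x i \in m.

Definition rees_map : {mpoly R[d]} -> rees m :=
  mmap (@rees_const R m) (fun i => rees_var (mx i)).
HB.instance Definition _ := GRing.RMorphism.on rees_map.

(** The homomorphism from [K[Y]] to [gr m] that sends [Y_i] to the class of
    [x_i]. Its lift to coefficients in [R] is [rees_map]. *)
Definition gr_map : {mpoly K[d]} -> gr m :=
  mmap (@gr_const R m) (fun i => qproj (@rees_shift R m) (rees_var (mx i))).
HB.instance Definition _ := GRing.RMorphism.on gr_map.

Lemma rees_mapC c : rees_map c%:MP = rees_const m c.
Proof. by rewrite /rees_map mmapC. Qed.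

Lemma rees_mapX i : rees_map 'X_i = rees_var (mx i).
Proof. by rewrite /rees_map mmapX mmap1U. Qed.

Lemma gr_mapC c : gr_map c%:MP = gr_const c.
Proof. by rewrite /gr_map mmapC. Qed.

Lemma gr_mapX i : gr_map 'X_i = qproj (@rees_shift R m) (rees_var (mx i)).
Proof. by rewrite /gr_map mmapX mmap1U. Qed.

Lemma gr_mapZ c p : gr_map (c *: p) = c *: gr_map p.
Proof. by rewrite -mul_mpolyC rmorphM /= gr_mapC. Qed.

HB.instance Definition _ :=
  GRing.isScalable.Build K {mpoly K[d]} (gr m) *:%R gr_map gr_mapZ.

Lemma rees_map_coef P n : (rees_val (rees_map P))`_n = (pihomog mdeg n P).@[x].
Proof.
elim/mpolyind: P => [|c a P _ _ IHP].
  by rewrite rmorph0 pihomog0 meval0 coef0.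
rewrite rmorphD linearP /= mevalD coefD IHP; congr (_ + _).
have XE : rees_val (rees_map 'X_[a]) = ('X_[a]).@[x] *: 'X^(mdeg a).
  rewrite mpolyXE_id rmorph_prod (big_morph (@rees_val R m) (id1 := 1) (op1 := *%R)) //.
  rewrite -mpolyXE_id mevalX mdegE -prodrXr -scaler_prod; apply: eq_bigr => i _.
  rewrite -exprZn rmorphXn /= rees_mapX.
  by elim: (a i) => [|e IHe]; rewrite ?expr0 // !exprS -IHe.
rewrite -mul_mpolyC rmorphM /= rees_mapC XE coefCM coefZ coefXn mevalZ pihomogX.
by rewrite eq_sym; case: eqP => _; rewrite ?mulr1 // meval0 !mulr0.
Qed.

Lemma gr_map_residue P :
  gr_map (map_mpoly (qproj m) P) = qproj (@rees_shift R m) (rees_map P).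
Proof.
apply: (mpoly_rmorph_ext (g := gr_map \o map_mpoly (qproj m))
  (h := qproj (@rees_shift R m) \o rees_map)) => [c|i] /=.
  by rewrite map_mpolyC gr_mapC rees_mapC gr_constE.
by rewrite map_mpolyX gr_mapX rees_mapX.
Qed.

Lemma gr_map_residue_eq0 P : gr_map (map_mpoly (qproj m) P) = 0 <->
  forall n, (pihomog mdeg n P).@[x] \in ideal_exp m n.+1.
Proof.
rewrite gr_map_residue; split=> [/eqP|mP]; last apply/eqP.
  by rewrite qproj_eq0 => /asboolP mP n; rewrite -rees_map_coef.
by rewrite qproj_eq0; apply/asboolP => n; rewrite rees_map_coef.
Qed.

Lemma residue_lift p : exists P : {mpoly R[d]}, map_mpoly (qproj m) P = p.
Proof.
elim/mpolyind: p => [|c a p _ _ [P <-]]; first by exists 0; rewrite rmorph0.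
have [b ->] := qprojP c; exists (b *: 'X_[a] + P).
by rewrite rmorphD /= -!mul_mpolyC rmorphM /= map_mpolyC map_mpolyX.
Qed.

Lemma gr_map_linear (c : 'I_d -> R) r (mr : r \in m) : r = \sum_i c i * x i ->
  gr_map (\sum_i qproj m (c i) *: 'X_i) = qproj (@rees_shift R m) (rees_var mr).
Proof.
move=> rE; rewrite raddf_sum /=.
transitivity (qproj (@rees_shift R m) (\sum_i rees_const m (c i) * rees_var (mx i))).
  rewrite raddf_sum; apply: eq_bigr => i _.
  by rewrite linearZ /= gr_mapX /GRing.scale /= /gr_scale gr_constE -rmorphM.
congr (qproj _ _); apply: val_inj => /=.
rewrite (big_morph (@rees_val R m) (id1 := 0) (op1 := +%R)) // rE scaler_suml.
by apply: eq_bigr => i _; rewrite /= mul_polyC scalerA.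
Qed.

Lemma gr_map_pihomog_eq0 p e : gr_map p = 0 -> gr_map (pihomog mdeg e p) = 0.
Proof.
have [P <-] := residue_lift p => /gr_map_residue_eq0 mP.
rewrite pihomog_map_mpoly.
apply/gr_map_residue_eq0 => e'; have [->|ne] := eqVneq e' e.
  by rewrite pihomog_id.
by rewrite (pihomog_ne0 _ (pihomogP _ _ _)) ?meval0 ?rpred0 // eq_sym.
Qed.

Hypothesis x_gen : generates m x.

Lemma gr_map_surjective y : exists p, gr_map p = y.
Proof.
have [r ->] := qprojP y; have /asboolP rP := rees_valP r.
have ex n : exists2 F, F \is n.-homog & F.@[x] = (rees_val r)`_n.
  have [F /form_homog hF FE] := (ideal_expE x_gen n _).1 (rP n).
  by exists F.
have /choice[F FP] : forall n, exists F : {mpoly R[d]},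
    F \is n.-homog /\ F.@[x] = (rees_val r)`_n.
  by move=> n; have [F] := ex n; exists F.
exists (map_mpoly (qproj m) (\sum_(n < size (rees_val r)) F n)).
rewrite gr_map_residue; congr (qproj _ _); apply: val_inj; apply/polyP => n.
rewrite rees_map_coef.
have piF k : pihomog mdeg n (F k) = if k == n then F k else 0.
  have [hF _] := FP k; case: eqP => [<-|nkn]; first exact: pihomog_dE.
  by apply: pihomog_ne0 hF; apply/eqP.
have -> : pihomog mdeg n (\sum_(k < size (rees_val r)) F k) =
    \sum_(k < size (rees_val r)) (if k == n :> nat then F k else 0).
  by rewrite raddf_sum; apply: eq_bigr => k _; apply: piF.
have [ltn|len] := ltnP n (size (rees_val r)).
  rewrite (bigD1 (Ordinal ltn)) //= eqxx big1 ?addr0; first by have [] := FP n.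
  by move=> k /eqP nk; case: eqP => // E; case: nk; apply: val_inj.
rewrite big1 ?meval0 ?nth_default // => k _; case: eqP => // E.
by have := ltn_ord k; rewrite E ltnNge len.
Qed.

Lemma gr_map_injective_quasi_regular :
  (forall p, gr_map p = 0 -> p = 0) <-> quasi_regular m x.
Proof.
split=> [inj n F hF mF a|qr p].
  have : map_mpoly (qproj m) F = 0.
    apply/inj/gr_map_residue_eq0 => n'; have [->|ne] := eqVneq n' n.
      by rewrite pihomog_dE.
    rewrite (pihomog_ne0 _ hF) ?meval0 ?rpred0 //.
    by rewrite eq_sym.
  move/mpolyP/(_ a); rewrite mcoeff_map_mpoly mcoeff0 => /eqP.
  by rewrite qproj_eq0.
have [P <-] := residue_lift p => /gr_map_residue_eq0 mP.
apply/mpolyP => a; rewrite mcoeff_map_mpoly mcoeff0; apply/eqP.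
rewrite qproj_eq0; have := qr (mdeg a) (pihomog mdeg (mdeg a) P) _ (mP _) a.
rewrite mcoeff_pihomog eqxx; apply; exact: pihomogP.
Qed.

(** Independence modulo the square of [m] excludes linear terms. *)
Lemma gr_map_kernel_order p :
  independent_mod_sq m x -> gr_map p = 0 -> has_order 2 p.
Proof.
move=> ind; have [P <-] := residue_lift p => /gr_map_residue_eq0 mP a.
rewrite mcoeff_map_mpoly => lta; apply/eqP; rewrite qproj_eq0.
have := mP (mdeg a); case da: (mdeg a) lta => [|[|//]] _.
  move/eqP: da; rewrite mdeg_eq0 => /eqP ->.
  have -> : pihomog mdeg 0 P = (P@_0%MM)%:MP.
    apply/mpolyP => b; rewrite mcoeff_pihomog mcoeffC mdeg_eq0.
    by case: eqP => [->|_]; rewrite ?mulr1 ?mulr0.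
  by rewrite mevalC; apply: ideal_exp_sub.
have /mdeg1P[i /eqP ->] : mdeg a == 1%N by rewrite da.
rewrite (linear_formE (pihomogP _ _ _)) raddf_sum /=.
under eq_bigr do rewrite mevalZ mevalXU.
by move=> /ind/(_ i); rewrite mcoeff_pihomog mdeg1.
Qed.

End Lambda.

(** * The criterion for local rings *)

Section Subst.
Variables (F : fieldType) (s d : nat) (A : 'I_s -> 'I_d -> F).

Definition linear_subst : {mpoly F[s]} -> {mpoly F[d]} :=
  mmap (@mpolyC d F) (fun j => \sum_b A j b *: 'X_b).
HB.instance Definition _ := GRing.RMorphism.on linear_subst.

Lemma linear_substC c : linear_subst c%:MP = c%:MP.
Proof. by rewrite /linear_subst mmapC. Qed.

Lemma linear_substX j : linear_subst 'X_j = \sum_b A j b *: 'X_b.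
Proof. by rewrite /linear_subst mmapX mmap1U. Qed.

Lemma linear_subst_homog p : p \is 1.-homog -> linear_subst p \is 1.-homog.
Proof.
move=> /linear_formE ->; rewrite rmorph_sum; apply: rpred_sum => j _.
rewrite -mul_mpolyC rmorphM /= linear_substC linear_substX mul_mpolyC.
by apply/dhomogZ/rpred_sum => b _; apply: dhomogZ; rewrite dhomogX /= mdeg1.
Qed.
End Subst.

(** The polynomials [p] with this property include the constants and the variables,
    and they are closed under sums and products. *)
Lemma sub_subst_mem_gen (R : comNzRingType) s
    (chi : {rmorphism {mpoly R[s]} -> {mpoly R[s]}}) (S : {mpoly R[s]} -> Prop) :
    (forall c, chi c%:MP = c%:MP) ->
    (forall j, 'X_j - chi 'X_j \in ideal_gen S) ->
  forall p, p - chi p \in ideal_gen S.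
Proof.
move=> chiC chiX.
have SM p q : p - chi p \in ideal_gen S -> q - chi q \in ideal_gen S ->
    p * q - chi (p * q) \in ideal_gen S.
  move=> Sp Sq; have -> : p * q - chi (p * q) = q * (p - chi p) + chi p * (q - chi q).
    by rewrite rmorphM; ring.
  by rewrite ideal_genD // ideal_genMl.
have SC c : c%:MP - chi c%:MP \in ideal_gen S by rewrite chiC subrr rpred0.
elim/mpolyind => [|c a p _ _ Sp]; first by rewrite rmorph0 subrr rpred0.
rewrite rmorphD opprD addrACA rpredD // -mul_mpolyC; apply: (SM c%:MP) => //.
rewrite mpolyXE_id.
apply: (big_ind (fun p => p - chi p \in ideal_gen S)) => [||i _].
- exact: SC.
- exact: SM.
elim: (a i) => [|n IHn]; first exact: SC.
by rewrite exprS; apply: SM.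
Qed.

Section LocalCriterion.
Variables (R : comNzRingType) (m : maximal_idealr R).
Hypotheses (nR : noetherian R).
Hypothesis local_m : forall r, r \notin m -> exists v, v * r = 1.
Local Notation K := {ideal_quot m}.

Section MinimalGenerators.
Variables (d : nat) (z : 'I_d -> R).
Hypotheses (z_gen : generates m z) (z_ind : independent_mod_sq m z).
Hypothesis mz : forall i, z i \in m.

Lemma gr_map_injective_polynomial :
  (forall p, gr_map mz p = 0 -> p = 0) -> is_polynomial_ring (gr m).
Proof.
move=> inj; exists d, (gr_map mz).
have [g gK] := choice (gr_map_surjective mz z_gen).
exists g => [p|y]; last exact: gK.
by apply/eqP; rewrite -subr_eq0; apply/eqP/inj; rewrite raddfB /= gK subrr.
Qed.

(** Lift the variables of a polynomial presentation of the graded ring along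
    [gr_map]. Composed with this lift, [gr_map] becomes an endomorphism of a
    polynomial ring which is tangent to the identity, because the kernel of
    [gr_map] has order two. *)
Lemma polynomial_gr_map_injective :
  is_polynomial_ring (gr m) -> forall p, gr_map mz p = 0 -> p = 0.
Proof.
move=> [D [phi [phi' phiK phi'K]]] p p0.
have [q qE] := choice (fun i => gr_map_surjective mz z_gen (phi 'X_i)).
pose h : {rmorphism {mpoly K[D]} -> {mpoly K[d]}} := mmap (@mpolyC d K) q.
pose w i := phi' (gr_map mz 'X_i).
pose om : {rmorphism {mpoly K[d]} -> {mpoly K[D]}} := mmap (@mpolyC D K) w.
have phiC c : phi c%:MP = gr_const c.
  rewrite -[c%:MP]mulr1 mul_mpolyC linearZ /= rmorph1.
  by rewrite /GRing.scale /= /gr_scale mulr1.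
have hC c : h c%:MP = c%:MP by rewrite /h /= mmapC.
have omC c : om c%:MP = c%:MP by rewrite /om /= mmapC.
have hE u : gr_map mz (h u) = phi u.
  apply: (mpoly_rmorph_ext (g := gr_map mz \o h) (h := phi)) => [c|i] /=.
    by rewrite mmapC gr_mapC phiC.
  by rewrite mmapX mmap1U qE.
have omE u : phi (om u) = gr_map mz u.
  apply: (mpoly_rmorph_ext (g := phi \o om) (h := gr_map mz)) => [c|i] /=.
    by rewrite mmapC gr_mapC phiC.
  by rewrite mmapX mmap1U /w phi'K.
apply: (tangent_to_id_injective (chi := h \o om)) => [c|i|] /=.
- by rewrite omC hC.
- apply: gr_map_kernel_order z_ind _ => //.
  by rewrite raddfB /= hE omE subrr.
have -> : om p = 0 by apply: (can_inj phiK); rewrite omE p0 raddf0.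
by rewrite rmorph0.
Qed.

Lemma linear_kernel_eq0 p : p \is 1.-homog -> gr_map mz p = 0 -> p = 0.
Proof.
move=> hp /(gr_map_kernel_order z_ind) op; apply/mpolyP => a.
rewrite mcoeff0; have [da|nda] := eqVneq (mdeg a) 1%N; last first.
  exact: dhomog_nemf_coeff hp nda.
by apply: op; rewrite da.
Qed.

Variables (s : nat) (x : 'I_s -> R).
Hypotheses (x_gen : generates m x) (mx : forall j, x j \in m).

(** Each family consists of linear combinations of the other one. The composite
    substitution is the identity on [K[Z]], because it moves each variable by a
    linear form in the kernel. *)
Lemma exists_substitutions :
  exists (A : 'I_s -> 'I_d -> K) (B : 'I_d -> 'I_s -> K),
    [/\ forall p, gr_map mz (linear_subst A p) = gr_map mx p,
        forall p, gr_map mx (linear_subst B p) = gr_map mz p &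
        forall p, linear_subst A (linear_subst B p) = p].
Proof.
have [a aE] := choice (fun j => (form_value1E z (x j)).1 ((z_gen (x j)).1 (mx j))).
have [b bE] := choice (fun i => (form_value1E x (z i)).1 ((x_gen (z i)).1 (mz i))).
exists (fun j i => qproj m (a j i)), (fun i j => qproj m (b i j)).
set f := linear_subst _; set g := linear_subst _.
have fE p : gr_map mz (f p) = gr_map mx p.
  apply: (mpoly_rmorph_ext (g := gr_map mz \o f) (h := gr_map mx)) => [c|j] /=.
    by rewrite linear_substC !gr_mapC.
  by rewrite linear_substX (gr_map_linear mz (mx j)) // gr_mapX.
have gE p : gr_map mx (g p) = gr_map mz p.
  apply: (mpoly_rmorph_ext (g := gr_map mx \o g) (h := gr_map mz)) => [c|i] /=.
    by rewrite linear_substC !gr_mapC.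
  by rewrite linear_substX (gr_map_linear mx (mz i)) // gr_mapX.
split=> // p; apply: (mpoly_rmorph_ext (g := f \o g) (h := idfun)) => [c|i] /=.
  by rewrite !linear_substC.
have hX : 'X_i \is [in K[d], 1.-homog] by rewrite dhomogX /= mdeg1.
apply/eqP; rewrite -subr_eq0; apply/eqP/linear_kernel_eq0.
  by rewrite rpredB // !linear_subst_homog // dhomogX /= mdeg1.
by rewrite raddfB /= fE gE subrr.
Qed.

(** The substitution [B] followed by [A] is the identity, since the kernel of the
    map attached to [z] contains no linear form; for the same reason [A] kills
    the linear forms in the kernel for [x]. If the map for [z] is injective, the
    kernel for [x] is that of [A], which is generated by the differences of the
    variables and their images under [A] followed by [B]. *)
Lemma linear_kernel_injective :
  generated_by_linear (fun p => gr_map mx p == 0) <->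
  (forall p, gr_map mz p = 0 -> p = 0).
Proof.
have [A [B [AE BE AB]]] := exists_substitutions.
split=> [[S [S_lin SE]] p p0|inj].
  rewrite -(AB p); have : linear_subst B p \in ideal_gen S.
    by rewrite -SE; apply/eqP; rewrite BE.
  apply: (@ideal_gen_sub _ S (fun q => linear_subst A q = 0)) => [|q Sq].
    split=> [|u v|u v]; first exact: rmorph0.
      by move=> u0 v0; rewrite rmorphD /= u0 v0 addr0.
    by move=> v0; rewrite rmorphM /= v0 mulr0.
  apply: linear_kernel_eq0; first exact/linear_subst_homog/S_lin.
  by rewrite AE; apply/eqP; have := mem_ideal_gen Sq; rewrite -SE.
pose chi : {rmorphism {mpoly K[s]} -> {mpoly K[s]}} := linear_subst B \o linear_subst A.
exists (fun q => exists j, q = 'X_j - chi 'X_j); split=> [_ [j ->]|p].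
  by rewrite rpredB // ?linear_subst_homog // dhomogX /= mdeg1.
apply/idP/idP => [/eqP p0|].
  have chip : chi p = 0.
    by rewrite /chi /= (inj (linear_subst A p)) ?rmorph0 // AE.
  rewrite -[p]subr0 -chip; apply: sub_subst_mem_gen => [c|j].
    by rewrite /chi /= !linear_substC.
  by apply: mem_ideal_gen; exists j.
move=> Sp; apply/eqP; move: p Sp.
apply: ideal_gen_sub => [|_ [j ->]].
  split=> [|u v|u v]; first exact: rmorph0.
    by move=> u0 v0; rewrite rmorphD /= u0 v0 addr0.
  by move=> v0; rewrite rmorphM /= v0 mulr0.
by rewrite raddfB /= BE AE subrr.
Qed.

End MinimalGenerators.

(** Each of the three conditions says that the homomorphism attached to a minimal
    family of generators is injective. *)
Theorem regular_local_tfae s (x : 'I_s -> R) (mx : forall j, x j \in m) :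
    generates m x ->
  [<-> is_regular_local m; is_polynomial_ring (gr m);
       generated_by_linear (fun p => gr_map mx p == 0)].
Proof.
move=> x_gen; tfae=> [[d [/(has_dim_generators nR local_m)[z zP] dim_d]]|poly_gr|lin].
- have [z_gen z_ind] := zP; have mz := generator_cot z_gen.
  apply: (gr_map_injective_polynomial z_gen (mz := mz)).
  apply/gr_map_injective_quasi_regular => //.
  exact/quasi_regular_krull_dim.
- have [d [z [z_gen z_ind]]] := exists_minimal_generators nR local_m.
  have mz := generator_cot z_gen.
  apply/(linear_kernel_injective z_gen z_ind mz x_gen mx).
  exact: polynomial_gr_map_injective.
have [d [z [z_gen z_ind]]] := exists_minimal_generators nR local_m.
have mz := generator_cot z_gen; exists d; split; first exact: independent_has_dim.
apply/(quasi_regular_krull_dim nR local_m z_gen).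
apply/(gr_map_injective_quasi_regular mz).
exact/(linear_kernel_injective z_gen z_ind mz x_gen mx).
Qed.

End LocalCriterion.

(** * The ideal of initial forms *)

Lemma meval_map_mpoly (R S : comNzRingType) (phi : {rmorphism R -> S}) d
    (v : 'I_d -> R) p :
  (map_mpoly phi p).@[fun i => phi (v i)] = phi p.@[v].
Proof.
apply: (mpoly_rmorph_ext (g := meval (fun i => phi (v i)) \o map_mpoly phi)
  (h := phi \o meval v)) => [c|i] /=.
  by rewrite map_mpolyC !mevalC.
by rewrite map_mpolyX !mevalXU.
Qed.

Lemma clear_meval (B C : comNzRingType) (phi : {rmorphism B -> C}) d (v : 'I_d -> B)
    c (g : {mpoly C[d]}) g0 : c *: g = map_mpoly phi g0 ->
  phi g0.@[v] = c * g.@[fun i => phi (v i)].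
Proof. by move=> gE; rewrite -meval_map_mpoly -gE mevalZ. Qed.

Lemma clear_mcoeff (B C : comNzRingType) (phi : {rmorphism B -> C}) d
    c (g : {mpoly C[d]}) g0 a : c *: g = map_mpoly phi g0 -> phi g0@_a = c * g@_a.
Proof. by move=> gE; rewrite -mcoeffZ gE mcoeff_map_mpoly. Qed.

Lemma generated_by_linear_eq (F : fieldType) s (I I' : {pred {mpoly F[s]}}) :
  I =i I' -> generated_by_linear I -> generated_by_linear I'.
Proof.
by move=> eqI [S [S1 SE]]; exists S; split=> // p; rewrite -SE eqI.
Qed.

Lemma mpoly_common_denominator (B C : comNzRingType) (phi : {rmorphism B -> C})
    (S : B -> Prop) :
    S 1 -> (forall a b, S a -> S b -> S (a * b)) ->
    (forall c, exists b q, S b /\ phi b * c = phi q) ->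
  forall s (g : {mpoly C[s]}), exists b g0, S b /\ phi b *: g = map_mpoly phi g0.
Proof.
move=> S1 SM clear s; elim/mpolyind => [|c a g _ _ [b [g0 [Sb bE]]]].
  by exists 1, 0; rewrite scaler0 rmorph0.
have [b' [q [Sb' b'E]]] := clear c.
exists (b * b'), (b *: (q *: 'X_[a]) + b' *: g0); split; first exact: SM.
apply/mpolyP => a'; rewrite mcoeff_map_mpoly /= !(mcoeffD, mcoeffZ, mcoeffX).
rewrite rmorphD !rmorphM -b'E rmorph_nat.
have -> : phi g0@_a' = phi b * g@_a' by rewrite -mcoeffZ bE mcoeff_map_mpoly.
ring.
Qed.

Lemma init_form_lowest (k : fieldType) n (U : {set 'I_n}) s
    (g : {mpoly {mpoly {fraction {mpoly k[#|U|]}}[#|~: U|]}[s]}) e a :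
    g@_a != 0 -> mdeg a = e -> (forall b, g@_b != 0 -> (e <= mdeg b)%N) ->
  init_form g = pihomog mdeg e g.
Proof.
move=> ga da min_e; congr (pihomog _ _ _); apply/eqP; rewrite eqn_leq; apply/andP; split.
  have : a \in msupp g by rewrite mcoeff_msupp.
  elim: (msupp g) => // b r IHr; rewrite inE big_cons => /predU1P[<-|/IHr le].
    by rewrite da geq_minl.
  by rewrite geq_min le orbT.
rewrite big_seq; apply: (big_ind (fun x => (e <= x)%N)) => [|x y ex ey|b].
- by rewrite -da ltnW // msize_mdeg_lt // mcoeff_msupp.
- by rewrite leq_min ex.
by rewrite mcoeff_msupp => /min_e.
Qed.

Lemma init_form_degree (k : fieldType) n (U : {set 'I_n}) s
    (g : {mpoly {mpoly {fraction {mpoly k[#|U|]}}[#|~: U|]}[s]}) :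
  exists2 e, init_form g = pihomog mdeg e g & forall b, g@_b != 0 -> (e <= mdeg b)%N.
Proof.
exists (\big[minn/msize g]_(b <- msupp g) mdeg b)%N => // b.
rewrite -mcoeff_msupp; elim: (msupp g) => // c r IHr.
rewrite inE big_cons => /predU1P[<-|/IHr le]; first exact: geq_minl.
by rewrite geq_min le orbT.
Qed.

Section InitialIdealKernel.
Variables (k : fieldType) (n : nat).
Local Notation Q := {mpoly k[n]}.
Variables (H J : prime_idealr Q) (sHJ : {subset H <= J}) (U : {set 'I_n}).
Local Notation kU := {mpoly k[#|U|]}.
Local Notation Q0 := {mpoly {fraction kU}[#|~: U|]}.
Local Notation L := (quo_prime sHJ).
Local Notation R := (loc L).
Local Notation m := (loc_ideal L).
Local Notation K := {ideal_quot m}.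
Hypothesis indU : independent U J.
Variables (s : nat) (f : 'I_s -> Q).
Hypothesis Jf : J =i ideal_gen (fun p : Q => exists j : 'I_s, p = f j).

Definition to_local : Q -> R := loc_in L \o qproj H.
HB.instance Definition _ := GRing.RMorphism.on to_local.

Lemma to_local_max q : (to_local q \in m) = (q \in J).
Proof. by rewrite loc_ideal_in quo_primeE. Qed.

Lemma to_local_eq0 q : (to_local q == 0) = (q \in H).
Proof.
rewrite -qproj_eq0 -[RHS]tofrac_eq0; apply/eqP/eqP => [/(congr1 val)//|q0].
exact: val_inj.
Qed.

Lemma to_local_clear (r : R) : exists t q, t \notin J /\ to_local t * r = to_local q.
Proof.
have [a [b [bL bE _]]] := loc_valM_in r.
have [q aE] := qprojP a; have [t bE'] := qprojP b.
by exists t, q; rewrite -to_local_max loc_ideal_in -bE' bL /to_local /= -bE' -aE.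
Qed.

Lemma to_local_unit t : t \notin J -> exists v, v * to_local t = 1.
Proof. by rewrite -to_local_max; apply: loc_local. Qed.

Definition local_gen j : R := to_local (f j).

Lemma local_gen_max j : local_gen j \in m.
Proof. by rewrite to_local_max Jf mem_ideal_gen //; exists j. Qed.

Lemma local_gen_generates : generates m local_gen.
Proof.
have iV := form_value_ideal local_gen s 1.
move=> r; split; last first.
  apply: (form_value1_min (I := fun r => r \in m)) => [|j _]; last exact: local_gen_max.
  exact: prime_ideal (idealr_is_prime m).
move=> mr; have [t [q [tJ tE]]] := to_local_clear r.
have [v vE] := to_local_unit tJ.
have : q \in J by rewrite -to_local_max -tE idealMr.
rewrite Jf => qf; rewrite -[r]mul1r -vE -mulrA tE; apply: idealM => //.
move: q qf {tE}; apply: ideal_gen_sub => [|_ [j ->]]; last first.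
  exact: (form_value_var local_gen).
split=> [|a b Va Vb|a b Vb]; rewrite ?rmorph0 ?rmorphD ?rmorphM.
- exact: ideal0.
- exact: idealD.
exact: idealM.
Qed.

(** Clear the denominators of the coefficients of a form over the local ring. *)
Lemma ideal_exp_clear e (r : R) : r \in ideal_exp m e ->
  exists t (F : {mpoly Q[s]}),
    [/\ t \notin J, F \is e.-homog & to_local t * r = to_local F.@[f]].
Proof.
pose T (r : R) := exists t (F : {mpoly Q[s]}),
  [/\ t \notin J, F \is e.-homog & to_local t * r = to_local F.@[f]].
move=> /(ideal_expE local_gen_generates); apply: (form_value_sub (I := T)) => [|a da _].
  split.
  - exists 1, 0; rewrite idealr1 dhomog0 mulr0 meval0 rmorph0.
    by split.
  - move=> r1 r2 [t1 [F1 [tJ1 h1 E1]]] [t2 [F2 [tJ2 h2 E2]]].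
    exists (t1 * t2), (t2 *: F1 + t1 *: F2); split.
    + by rewrite prime_idealrM negb_or tJ1.
    + by rewrite dhomogD ?dhomogZ.
    rewrite mevalD !mevalZ rmorphD !rmorphM /= -E1 -E2; ring.
  move=> c r1 [t1 [F1 [tJ1 h1 E1]]]; have [t [q [tJ tE]]] := to_local_clear c.
  exists (t * t1), (q *: F1); split.
  - by rewrite prime_idealrM negb_or tJ.
  - exact: dhomogZ.
  by rewrite mevalZ !rmorphM /= -E1 -tE; ring.
exists 1, 'X_[a]; rewrite idealr1 dhomogX /= da; split=> //.
rewrite rmorph1 mul1r !mevalX rmorph_prod; apply: eq_bigr => j _.
by rewrite rmorphXn.
Qed.

Local Notation F0 := (fun j => Q_in0 U (f j)).
Local Notation H0 := (ideal_ext (Q_in0 U) H).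

(** The graph ideal consists of the polynomials whose value at [Y = f] is in
    [H0]; this lemma and the next one are the two inclusions. *)
Lemma graph_ideal_meval (g : {mpoly Q0[s]}) :
  g \in graph_ideal H f -> g.@[F0] \in H0.
Proof.
move=> /asboolP[y [z [yG zH ->]]]; rewrite mevalD rpredD //.
  suff -> : y.@[F0] = 0 by rewrite rpred0.
  move: y yG {g}; apply: ideal_gen_sub => [|_ [j ->]].
    split=> [|u v|u v]; first exact: meval0.
      by move=> u0 v0; rewrite mevalD u0 v0 addr0.
    by move=> v0; rewrite mevalM v0 mulr0.
  by rewrite mevalB mevalC mevalXU subrr.
move: z zH; apply: ideal_gen_sub => [|_ [h hH ->]]; last by rewrite mevalC.
split=> [|u v|u v]; first by rewrite meval0 rpred0.
  by move=> Hu Hv; rewrite mevalD rpredD.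
by move=> Hv; rewrite mevalM ideal_genMl.
Qed.

Lemma mem_graph_ideal (g : {mpoly Q0[s]}) :
  g.@[F0] \in H0 -> g \in graph_ideal H f.
Proof.
move=> gH; apply/asboolP; exists (g - (g.@[F0])%:MP), (g.@[F0])%:MP; split.
- apply: (sub_subst_mem_gen (chi := @mpolyC s Q0 \o meval F0)) => [c|j] /=.
    by rewrite mevalC.
  by rewrite mevalXU -opprB rpredN mem_ideal_gen //; exists j.
- by apply: mem_ideal_gen; exists g.@[F0].
by rewrite subrK.
Qed.

(** The residue map of [H] itself, in place of [J], detects membership in [H]. *)
Lemma Q_in0_contract q : Q_in0 U q \in H0 -> q \in H.
Proof.
have sHH : {subset H <= H} by [].
have indUH : independent U H by move=> p /sHJ/indU.
move=> /(Q0_to_residue_eq0 sHH indUH); rewrite Q0_to_residue_Q // => /eqP.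
by rewrite to_residue_eq0.
Qed.

Local Notation rho := (@Q0_to_residue k n H J sHJ U).
Local Notation res := (to_residue sHJ).
Local Notation red := (@init_red k n H J sHJ U s).
Local Notation lambda := (gr_map local_gen_max).

Lemma init_red_coef (g : {mpoly Q0[s]}) a :
  (red g)@_a = rho (init_form g)@_a.
Proof. exact: (mcoeff_map_mpoly (Q0_to_residue_rmorph sHJ indU)). Qed.

Let rho0 : rho 0 = 0 := rmorph0 (Q0_to_residue_rmorph sHJ indU).
Let rhoM x y : rho (x * y) = rho x * rho y := rmorphM (Q0_to_residue_rmorph sHJ indU) x y.

(** After multiplication by a denominator, [g] comes from a polynomial over [Q]
    whose value at [f] is in [H], so that the value of its lowest form in the
    local ring is opposite to that of terms of higher degree. *)
Lemma init_red_kernel g : g \in graph_ideal H f -> lambda (red g) = 0.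
Proof.
move=> gG; have [e gE min_e] := init_form_degree g.
pose S t := exists b : kU, b != 0 /\ t = kU_in b :> Q.
have S1 : S 1 by exists 1; rewrite oner_neq0 rmorph1.
have SM t t' : S t -> S t' -> S (t * t').
  by move=> [a [a0 ->]] [b [b0 ->]]; exists (a * b); rewrite mulf_neq0 // rmorphM.
have Sclear (c : Q0) : exists t q, S t /\ Q_in0 U t * c = Q_in0 U q.
  have [b [q [b0 bE]]] := Q0_clear c; exists (kU_in b), q.
  by rewrite Q_in0_kU; split=> //; exists b.
have [_ [g0 [[b [b0 ->]] bE]]] := mpoly_common_denominator S1 SM Sclear g.
have {}bE : kU_in0 b *: g = map_mpoly (Q_in0 U) g0.
  by rewrite -(Q_in0_kU b); exact: bE.
have g0H : g0.@[f] \in H.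
  have E : Q_in0 U g0.@[f] = kU_in0 b * g.@[F0].
    exact: (clear_meval f bE).
  apply: Q_in0_contract; rewrite E; apply: ideal_genMl.
  exact: graph_ideal_meval.
pose P := map_mpoly to_local g0.
have P0 : P.@[local_gen] = 0.
  by rewrite meval_map_mpoly; apply/eqP; rewrite to_local_eq0.
have lowP a : (mdeg a < e)%N -> P@_a = 0.
  move=> lt; rewrite mcoeff_map_mpoly; apply/eqP; rewrite to_local_eq0.
  have E : Q_in0 U g0@_a = kU_in0 b * g@_a by exact: (clear_mcoeff a bE).
  apply: Q_in0_contract; rewrite E.
  have [->|/min_e] := eqVneq g@_a 0; first by rewrite mulr0 rpred0.
  by rewrite leqNgt lt.
have mP : (pihomog mdeg e P).@[local_gen] \in ideal_exp m e.+1.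
  rewrite -rpredN -sub0r -P0 -mevalB.
  apply: (supported_value_exp local_gen_generates (M := predT)) => a.
  rewrite mcoeffB mcoeff_pihomog; case: (mdeg a =P e) => [_|ne].
    by rewrite subrr eqxx.
  rewrite subr0 => nz; split=> //; rewrite ltn_neqAle eq_sym; apply/andP; split.
    exact/eqP.
  by rewrite leqNgt; apply: contra nz => lt; rewrite lowP.
have : lambda (map_mpoly (qproj m) (pihomog mdeg e P)) = 0.
  apply/gr_map_residue_eq0 => e'; have [->|ne] := eqVneq e' e.
    by rewrite pihomog_id.
  by rewrite (pihomog_ne0 _ (pihomogP _ _ _)) ?meval0 ?rpred0 // eq_sym.
have -> : map_mpoly (qproj m) (pihomog mdeg e P) = rho (kU_in0 b) *: red g.
  apply/mpolyP => a; rewrite mcoeff_map_mpoly mcoeff_pihomog mcoeffZ init_red_coef gE.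
  rewrite mcoeff_pihomog; case: ifP => _; last by rewrite raddf0 rho0 mulr0.
  have E : Q_in0 U g0@_a = kU_in0 b * g@_a.
    exact: (clear_mcoeff a bE).
  by rewrite mcoeff_map_mpoly -[LHS]/(res g0@_a) -(Q0_to_residue_Q sHJ indU) E rhoM.
have rb0 : rho (kU_in0 b) != 0 by rewrite Q0_to_residue_kU // kU_res_eq0.
move=> lam0; rewrite -[red g]scale1r -(mulVf rb0) -scalerA linearZ /=.
by rewrite lam0 scaler0.
Qed.

Lemma residue_clear (c : K) : exists t q, t \notin J /\ res t * c = res q.
Proof.
have [r ->] := qprojP c; have [t [q [tJ tE]]] := to_local_clear r.
by exists t, q; split=> //; rewrite -[RHS]/(qproj m (to_local q)) -tE rmorphM.
Qed.

Lemma init_ideal_ideal : is_ideal (fun p => p \in init_ideal sHJ U f).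
Proof.
exact: (ideal_gen_ideal (fun p => exists2 g, g \in graph_ideal H f & p = red g)).
Qed.

Lemma mem_init_ideal g : g \in graph_ideal H f -> red g \in init_ideal sHJ U f.
Proof.
move=> gG.
apply: (mem_ideal_gen (S := fun p => exists2 g, g \in graph_ideal H f & p = red g)).
by exists g.
Qed.

(** Lift [p] to a form [G] over [Q]. Its value in the local ring has order
    greater than [e], so that up to a denominator [t'] it is also the value of a
    form [F] of degree [e + 1]. Then [t' G - F] is in the graph ideal, and its
    initial form is a multiple of [p]. *)
Lemma homog_kernel_init p e :
  p \is e.-homog -> lambda p = 0 -> p \in init_ideal sHJ U f.
Proof.
move=> hp lam0; have [->|nz] := eqVneq p 0; first exact: (ideal0 init_ideal_ideal).
have [a pa] : exists a, p@_a != 0.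
  apply: contrapT => p0; case/eqP: nz; apply/mpolyP => a; rewrite mcoeff0.
  by apply/eqP/negP => /negP pa; apply: p0; exists a.
have da : mdeg a = e.
  by apply/eqP; apply: contraNT pa => /(dhomog_nemf_coeff hp)->.
have SJ t t' : t \notin J -> t' \notin J -> t * t' \notin J.
  by rewrite prime_idealrM negb_or => -> ->.
have [t [G0 [tJ G0E]]] := mpoly_common_denominator (phi := res) (S := fun t => t \notin J)
  (negbT (idealr1 J)) SJ residue_clear p.
pose G := pihomog mdeg e G0.
have resG b : res G@_b = res t * p@_b.
  rewrite mcoeff_pihomog; case: ifP => [_|/negbT nb]; first exact: clear_mcoeff G0E.
  by rewrite (dhomog_nemf_coeff hp nb) mulr0 rmorph0.
have hG : map_mpoly to_local G \is e.-homog.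
  apply/dhomogP => b; rewrite mcoeff_msupp mcoeff_map_mpoly mcoeff_pihomog.
  by case: (mdeg b =P e) => //; rewrite raddf0 eqxx.
have mG : to_local G.@[f] \in ideal_exp m e.+1.
  rewrite -(meval_map_mpoly to_local) -(pihomog_dE hG).
  apply: (gr_map_residue_eq0 local_gen_max _).1.
  have -> : map_mpoly (qproj m) (map_mpoly to_local G) = res t *: p.
    by apply/mpolyP => b; rewrite !mcoeff_map_mpoly mcoeffZ -resG.
  by rewrite linearZ /= lam0 scaler0.
have [t' [F [t'J hF FE]]] := ideal_exp_clear mG.
pose g0 := t' *: G - F.
have g0H : g0.@[f] \in H.
  rewrite -to_local_eq0 mevalB mevalZ raddfB /= subr_eq0; apply/eqP.
  by rewrite rmorphM.
have [g gE] : exists g : {mpoly Q0[s]}, 1 *: g = map_mpoly (Q_in0 U) g0.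
  by exists (map_mpoly (Q_in0 U) g0); rewrite scale1r.
have g_meval : g.@[F0] = Q_in0 U g0.@[f].
  by apply: esym; rewrite -[RHS]mul1r; exact: (clear_meval f gE).
have g_coef b : g@_b = Q_in0 U g0@_b.
  by apply: esym; rewrite -[RHS]mul1r; exact: (clear_mcoeff b gE).
have gG : g \in graph_ideal H f.
  apply: mem_graph_ideal; rewrite g_meval.
  by apply: mem_ideal_gen; exists g0.@[f].
have rho_g b : rho g@_b = res g0@_b.
  by rewrite g_coef (Q0_to_residue_Q sHJ indU).
have res_g0 b : mdeg b = e -> res g0@_b = res t' * res t * p@_b.
  move=> db; rewrite mcoeffB mcoeffZ (dhomog_nemf_coeff hF); last first.
    by rewrite /= db ltn_eqF.
  by rewrite subr0 rmorphM /= resG mulrA.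
have c0 : res t' * res t != 0.
  by rewrite mulf_eq0 !to_residue_eq0 negb_or t'J.
have ga : g@_a != 0.
  apply/eqP => ga0; have := rho_g a; rewrite ga0 rho0 (res_g0 a da) => /esym/eqP.
  by rewrite mulf_eq0 (negPf c0) (negPf pa).
have min_e b : g@_b != 0 -> (e <= mdeg b)%N.
  rewrite g_coef leqNgt; apply: contra => lt.
  have -> : g0@_b = 0; last by rewrite raddf0.
  rewrite mcoeffB mcoeffZ mcoeff_pihomog (ltn_eqF lt) mulr0 sub0r.
  by rewrite (dhomog_nemf_coeff hF) ?oppr0 //= ltn_eqF // ltnW.
have redE : red g = (res t' * res t) *: p.
  apply/mpolyP => b; rewrite init_red_coef (init_form_lowest ga da min_e).
  rewrite mcoeff_pihomog mcoeffZ; case: (mdeg b =P e) => [db|/eqP nb].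
    by rewrite rho_g res_g0.
  by rewrite rho0 (dhomog_nemf_coeff hp nb) mulr0.
have -> : p = ((res t' * res t)^-1)%:MP * red g.
  by rewrite redE mul_mpolyC scalerA mulVf ?scale1r.
by apply: (idealM init_ideal_ideal); apply: mem_init_ideal.
Qed.

Lemma init_ideal_kernel :
  init_ideal sHJ U f =i (fun p => lambda p == 0).
Proof.
move=> p; apply/idP/idP => [pI|/eqP p0].
  apply/eqP; move: p pI; apply: ideal_gen_sub => [|_ [g gG ->]]; last first.
    exact: init_red_kernel.
  split=> [|u v|u v]; first exact: rmorph0.
    by move=> u0 v0; rewrite rmorphD /= u0 v0 addr0.
  by move=> v0; rewrite rmorphM /= v0 mulr0.
rewrite (pihomog_partitionE (mf := mdeg) (leqnn (msize p))).
apply: (ideal_sum _ init_ideal_ideal) => e _.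
apply: (@homog_kernel_init _ e); first exact: pihomogP.
exact: gr_map_pihomog_eq0.
Qed.

End InitialIdealKernel.

Theorem proposition8 (k : fieldType) (n : nat)
    (H J : prime_idealr {mpoly k[n]}) (sHJ : {subset H <= J})
    (s : nat) (f : 'I_s -> {mpoly k[n]})
    (Jf : J =i ideal_gen (fun p : {mpoly k[n]} => exists j : 'I_s, p = f j))
    (U : {set 'I_n}) (maxU : max_independent J U) :
  [<-> is_regular_local (loc_ideal (quo_prime sHJ));
       is_polynomial_ring (gr (loc_ideal (quo_prime sHJ)));
       generated_by_linear (init_ideal sHJ U f)].
Proof.
have indU : independent U J by move/maxsetp: maxU => /asboolP.
have nR : noetherian (loc (quo_prime sHJ)).
  exact/noetherian_loc/noetherian_quot/noetherian_mpoly.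
have tf := regular_local_tfae nR (@loc_local _ (quo_prime sHJ))
  (local_gen_max sHJ Jf) (local_gen_generates (sHJ := sHJ) Jf).
have E := init_ideal_kernel (sHJ := sHJ) indU Jf.
tfae.
- by move/(tf 0%N 1%N).
- by move/(tf 1%N 2%N); apply: generated_by_linear_eq => p; rewrite E.
by move=> lin; apply/(tf 2%N 0%N)/(generated_by_linear_eq E lin).
Qed.
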